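(* Let $V$ be an Orlicz function and $R\in(0,\infty)$. For each $n\in\mathbb N$ let $X_R^{n,V}=\big(X_R^{n,V}(1),\dots,X_R^{n,V}(n)\big)$ be uniformly distributed on the Orlicz ball $\mathbb B_R^{n,V}$. Then there exists a unique $\overline\alpha\in(-\infty,0)$ such that the sequence of empirical measures $$\mathcal L^{n,V}:=\frac1n\sum_{i=1}^n\delta_{X_R^{n,V}(i)},\qquad n\in\mathbb N,$$ satisfies a large deviation principle in $\mathscr M_1(\mathbb R)$ (with the weak topology) with the strictly convex good rate function $\mathbb I_V:\mathscr M_1(\mathbb R)\to[0,\infty]$, $$\mathbb I_V(\mu)=\begin{cases} H(\mu\,|\,\mu_{V,\overline\alpha})+\overline\alpha\,\big[m_V(\mu)-R\big] & \text{if } m_V(\mu)\le R,\\ \infty & \text{otherwise.}\end{cases}$$ In addition, if there exists another Orlicz function $W$ such that $V(x)/W(x)\to\infty$ as $|x|\to\infty$, then $(\mathcal L^{n,V})_{n\in\mathbb N}$ satisfies a large deviation principle in $(\mathscr M_1^W(\mathbb R),d_W)$ (with the same rate function $\mathbb I_V$).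
   Context: An Orlicz function is a convex, symmetric function $V:\mathbb R\to[0,\infty)$ with $V(0)=0$ and $V(x)>0$ for $x\neq0$. For $R>0$, $\mathbb B_R^{n,V}:=\{x\in\mathbb R^n:\sum_{k=1}^nV(x_k)\le Rn\}$. For $\beta<0$, the Gibbs measure $\mu_{V,\beta}$ is the probability measure on $\mathbb R$ with Lebesgue density $e^{\beta V(x)}/\int_{\mathbb R}e^{\beta V(t)}dt$. $\mathscr M_1(\mathbb R)$ is the set of Borel probability measures on $\mathbb R$; for $\mu\in\mathscr M_1(\mathbb R)$, $m_V(\mu):=\int V\,d\mu$, and $\mathscr M_1^V(\mathbb R):=\{\mu: m_V(\mu)<\infty\}$. For a metric $d_w$ inducing weak convergence on $\mathscr M_1(\mathbb R)$, $d_V(\mu,\nu):=d_w(\mu,\nu)+|m_V(\mu)-m_V(\nu)|$ on $\mathscr M_1^V(\mathbb R)$. $H(\mu|\nu)=\int\log\frac{d\mu}{d\nu}\,d\mu$ if $\mu\ll\nu$, and $\infty$ otherwise (relative entropy). A sequence $(\xi_n)$ of random elements of a topological space $X$ satisfies a large deviation principle (LDP) with good rate function $\mathbb I$ (i.e. $\mathbb I:X\to[0,\infty]$ with compact level sets) if for all Borel $A\subseteq X$: $-\inf_{A^\circ}\mathbb I\le\liminf_n\frac1n\log P[\xi_n\in A^\circ]\le\limsup_n\frac1n\log P[\xi_n\in\overline A]\le-\inf_{\overline A}\mathbb I$. *)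

(* Defs.v *)
From HB Require Import structures.
From mathcomp Require Import all_boot all_order all_algebra.
From mathcomp Require Import all_classical all_reals all_analysis.
Import Order.TTheory GRing.Theory Num.Theory numFieldNormedType.Exports.

Set Implicit Arguments.
Unset Strict Implicit.
Unset Printing Implicit Defensive.

Local Open Scope classical_set_scope.
Local Open Scope ring_scope.

Definition orlicz_fun (R : realType) (V : R -> R) : Prop :=
  [/\ (forall x y t : R, 0 <= t <= 1 ->
         V (t * x + (1 - t) * y) <= t * V x + (1 - t) * V y),
      (forall x, V (- x) = V x),
      V 0 = 0 &
      (forall x, x != 0 -> 0 < V x)].

(* Points of R^n are represented as sequences of reals of size n. *)
Definition orlicz_ball (R : realType) (V : R -> R) (Rad : R) (n : nat)
  : set (seq R) :=
  [set s | size s = n /\ \sum_(x <- s) V x <= Rad * n%:R].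

(* n-dimensional Lebesgue measure of a set of points of R^n, by iterated
   one-dimensional Lebesgue integration (Cavalieri / Tonelli):
   vol 0 A = 1 if the unique point of R^0 lies in A, 0 otherwise;
   vol (n+1) A = \int vol n {s | (x :: s) \in A} dx.                  *)
Fixpoint vol (R : realType) (n : nat) (A : set (seq R)) : \bar R :=
  match n with
  | 0%N => if `[< A [::] >] then 1%E else 0%E
  | n'.+1 => (\int[@lebesgue_measure R]_x vol n' [set s | A (x :: s)])%E
  end.

Notation M1 R := (probability R R).

Definition mV (R : realType) (V : R -> R) (mu : M1 R) : \bar R :=
  (\int[mu]_x (V x)%:E)%E.

Definition is_empirical (R : realType) (s : seq R) (mu : M1 R) : Prop :=
  forall A : set R, measurable A ->
    mu A = ((size s)%:R^-1 * \sum_(x <- s) \1_A x)%:E.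

Definition gibbs (R : realType) (V : R -> R) (beta : R) : set R -> \bar R :=
  fun A =>
    ((\int[@lebesgue_measure R]_(x in A) (expR (beta * V x))%:E) *
     ((fine (\int[@lebesgue_measure R]_x (expR (beta * V x))%:E))^-1)%:E)%E.

Definition abs_cont (R : realType) (mu nu : set R -> \bar R) : Prop :=
  forall A : set R, measurable A -> nu A = 0%E -> mu A = 0%E.

Definition is_density (R : realType) (mu nu : set R -> \bar R) (f : R -> R)
  : Prop :=
  [/\ measurable_fun setT f, (forall x, 0 <= f x) &
      forall A : set R, measurable A ->
        mu A = (\int[nu]_(x in A) (f x)%:E)%E].

Definition RN_deriv (R : realType) (mu nu : set R -> \bar R) : R -> R :=
  xget (fun _ => 0) [set f | is_density mu nu f].

Definition rel_entropy (R : realType) (mu : M1 R) (nu : set R -> \bar R)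
  : \bar R :=
  if `[< abs_cont mu nu >] then (\int[mu]_x (ln (RN_deriv mu nu x))%:E)%E
  else +oo%E.

Definition rate_IV (R : realType) (V : R -> R) (Rad alpha : R) (mu : M1 R)
  : \bar R :=
  if (mV V mu <= Rad%:E)%E then
    (rel_entropy mu (gibbs V alpha) + alpha%:E * (mV V mu - Rad%:E))%E
  else +oo%E.

Definition bounded_continuous (R : realType) (f : R -> R) : Prop :=
  continuous f /\ exists M : R, forall x, `|f x| <= M.

(* Generic: the space D (a subset of M_1(R)) with the coarsest topology
   making mu |-> \int f dmu (f bounded continuous) and the functional h
   continuous.  Basic neighbourhoods of mu:
     {nu in D | |\int f_i dnu - \int f_i dmu| < eps (i < k),
                |h nu - h mu| < eps }.                                  *)
Definition basic_nbhd (R : realType) (D : set (M1 R)) (h : M1 R -> R)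
  (k : nat) (f : 'I_k -> R -> R) (eps : R) (mu : M1 R) : set (M1 R) :=
  [set nu | D nu /\
     (forall i, `|fine (\int[nu]_x (f i x)%:E)%E
                  - fine (\int[mu]_x (f i x)%:E)%E| < eps) /\
     `|h nu - h mu| < eps].

Definition sp_open (R : realType) (D : set (M1 R)) (h : M1 R -> R)
  (U : set (M1 R)) : Prop :=
  U `<=` D /\
  forall mu, U mu -> exists (k : nat) (f : 'I_k -> R -> R) (eps : R),
    [/\ forall i, bounded_continuous (f i), 0 < eps &
        basic_nbhd D h f eps mu `<=` U].

Definition sp_interior (R : realType) (D : set (M1 R)) (h : M1 R -> R)
  (A : set (M1 R)) : set (M1 R) :=
  [set mu | exists U, [/\ sp_open D h U, U mu & U `<=` A]].

Definition sp_closure (R : realType) (D : set (M1 R)) (h : M1 R -> R)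
  (A : set (M1 R)) : set (M1 R) :=
  [set mu | D mu /\ forall U, sp_open D h U -> U mu -> exists nu, U nu /\ A nu].

Definition sp_compact (R : realType) (D : set (M1 R)) (h : M1 R -> R)
  (K : set (M1 R)) : Prop :=
  K `<=` D /\
  forall C : set (set (M1 R)), (forall U, C U -> sp_open D h U) ->
    K `<=` (fun mu => exists U, C U /\ U mu) ->
    exists (m : nat) (g : 'I_m -> set (M1 R)),
      (forall j, C (g j)) /\ K `<=` (fun mu => exists j, g j mu).

Definition weakD (R : realType) : set (M1 R) := setT.
Definition weakh (R : realType) : M1 R -> R := fun _ => 0.

(* (M_1^W(R), d_W) with d_W = d_w + |m_W - m_W| *)
Definition WD (R : realType) (W : R -> R) : set (M1 R) :=
  [set mu | (mV W mu < +oo)%E].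
Definition Wh (R : realType) (W : R -> R) : M1 R -> R :=
  fun mu => fine (mV W mu).

Definition elog (R : realType) (x : \bar R) : \bar R :=
  match x with
  | EFin r => if 0 < r then (ln r)%:E else -oo%E
  | +oo%E => +oo%E
  | -oo%E => -oo%E
  end.

Definition good_rate_function (R : realType) (D : set (M1 R))
  (h : M1 R -> R) (I : M1 R -> \bar R) : Prop :=
  (forall mu, D mu -> (0 <= I mu)%E) /\
  forall c : R, sp_compact D h [set mu | D mu /\ (I mu <= c%:E)%E].

(* P n A = P[xi_n \in A]; LDP with speed n and good rate function I *)
Definition LDP (R : realType) (D : set (M1 R)) (h : M1 R -> R)
  (P : nat -> set (M1 R) -> \bar R) (I : M1 R -> \bar R) : Prop :=
  good_rate_function D h I /\
  forall A : set (M1 R), A `<=` D ->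
    (- ereal_inf (I @` sp_interior D h A)
       <= limn_einf (fun n => (n%:R^-1)%:E * elog (P n (sp_interior D h A))))%E /\
    (limn_esup (fun n => (n%:R^-1)%:E * elog (P n (sp_closure D h A)))
       <= - ereal_inf (I @` sp_closure D h A))%E.

(* Law of the empirical measure L^{n,V} of X uniform on B_R^{n,V}:
   P[L^{n,V} \in A] = vol(B \cap {x : L(x) \in A}) / vol(B).          *)
Definition emp_law (R : realType) (V : R -> R) (Rad : R) (n : nat)
  (A : set (M1 R)) : \bar R :=
  (vol n [set s | orlicz_ball V Rad n s /\
                  exists mu, A mu /\ is_empirical s mu] *
   ((fine (vol n (orlicz_ball V Rad n)))^-1)%:E)%E.

Definition strictly_convex_rate (R : realType) (I : M1 R -> \bar R) : Prop :=
  forall (mu nu rho : M1 R) (t : R), 0 < t < 1 ->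
    (forall A : set R, measurable A ->
       rho A = (t%:E * mu A + (1 - t)%:E * nu A)%E) ->
    (exists A : set R, measurable A /\ mu A <> nu A) ->
    (I mu < +oo)%E -> (I nu < +oo)%E ->
    (I rho < t%:E * I mu + (1 - t)%:E * I nu)%E.

(* Main.v *)
(* Write [phi b = ln Z(b) - b R], with [Z] the partition function of the
   Gibbs densities, and let [alpha] be its critical point, where the Gibbs
   measure has [V]-moment [R].  On [m_V <= R] the rate at [mu = p dx] equals
   [int p ln p + phi(alpha)], so it suffices to estimate volumes on the scale
   [exp(n .)]: the ball itself has volume [exp(n phi(alpha) + o(n))].

   Upper bound: for bounded [g] and [0 <= s < -alpha], tilting by
   [exp(g + (alpha + s) V)] bounds the volume of the points of the ball whose
   empirical measure lies in the halfspace
   [int g dmu > c + int (exp(g + s V) - 1) dG - s R] by [exp(n (phi(alpha) - c))].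
   By entropy duality the intersection of the complementary halfspaces is the
   level set [rate <= c].  Finitely many halfspaces cover a closed set on which
   the rate exceeds [c]: otherwise an ultrafilter avoids all of them, and the
   setwise limit along it of the measures is a countably additive point of the
   closed set with rate at most [c].  The same argument gives goodness of the
   rate.

   Lower bound: a density of finite rate is perturbed so that its moment is
   strictly below [R] and truncated so that [ln p] and all test functions are
   bounded on its support; Chebyshev's inequality for the product density then
   bounds the volume of a neighbourhood from below by [exp(-n int p ln p)].

   The exponent [alpha] is unique because [phi] has no other minimiser, while an
   LDP forces the infimum of the rate to vanish. *)
Require Import Defs.
From HB Require Import structures.
From mathcomp Require Import all_boot all_order all_algebra.
From mathcomp Require Import all_classical all_reals all_analysis.
From mathcomp Require Import measurable_realfun exponential_distribution.
From mathcomp Require Import lebesgue_integral_under ring lra.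
Import Order.TTheory GRing.Theory Num.Theory numFieldNormedType.Exports.
Set Implicit Arguments.
Unset Strict Implicit.
Unset Printing Implicit Defensive.
Local Open Scope classical_set_scope.
Local Open Scope ring_scope.

(** * Integrals of real functions *)

(** [vol] iterates integrals of sections that need not be measurable, and the events of the
    principle are interiors and closures of arbitrary sets. Everything is therefore deduced from
    monotonicity of the integral of nonnegative functions: an upper bound comes from a finite sum of
    product functions that majorises the event, so that the union bound is part of the sum, and a
    lower bound from a product density times a polynomial that minorises the event.

    The halfspaces carry the parameter [s] because bounded [g] alone detect only the relative
    entropy. The term [alpha (m_V - R)] is recovered on letting [s] tend to [- alpha]; this end
    point is excluded, since [exp ((alpha + s) V)] has to be integrable.

    Both topologies are handled by one argument with a weight [w] that is negligible against [V]:
    the moment constraint then makes [w] uniformly integrable, so that its integral passes to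
    ultralimits like that of a bounded function. *)

Section real_integrals.
Context d (T : measurableType d) (R : realType) (mu : {measure set T -> \bar R}).
Implicit Types (f g : T -> R).
Local Notation itg f := (mu.-integrable [set: T] (EFin \o f)).

Lemma itg_meas f : itg f -> measurable_fun setT f.
Proof. by move=> /measurable_int/measurable_EFinP. Qed.

Lemma itg_le f g : measurable_fun setT f -> itg g ->
  (forall x, `|f x| <= g x) -> itg f.
Proof.
move=> mf ig fg; apply: (le_integrable measurableT _ _ ig).
  exact/measurable_EFinP.
by move=> x _ /=; rewrite lee_fin (le_trans (fg x))// ler_norm.
Qed.

Lemma itgD f g : itg f -> itg g -> itg (fun x => f x + g x).
Proof. by move=> hf hg; have := integrableD measurableT hf hg. Qed.

Lemma itgB f g : itg f -> itg g -> itg (fun x => f x - g x).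
Proof. by move=> hf hg; have := integrableB measurableT hf hg. Qed.

Lemma itgZ (k : R) f : itg f -> itg (fun x => k * f x).
Proof. by move=> hf; have := integrableZl measurableT k hf. Qed.

Lemma itg_sum m (f : 'I_m -> T -> R) : (forall i, itg (f i)) ->
  itg (fun x => \sum_i f i x).
Proof.
move=> hf; have := @integrable_sum _ _ _ mu setT measurableT _ (index_enum 'I_m) predT
  (fun i x => (f i x)%:E) (fun i _ => hf i).
by apply: eq_integrable => // x _ /=; rewrite sumEFin.
Qed.

Lemma itgE f : itg f -> (\int[mu]_x (f x)%:E = (\int[mu]_x f x)%:E)%E.
Proof. by move=> hf; rewrite /Rintegral fineK//; exact: integrable_fin_num. Qed.

Lemma intD f g : itg f -> itg g ->
  \int[mu]_x (f x + g x) = \int[mu]_x f x + \int[mu]_x g x.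
Proof. by move=> *; rewrite RintegralD. Qed.

Lemma intB f g : itg f -> itg g ->
  \int[mu]_x (f x - g x) = \int[mu]_x f x - \int[mu]_x g x.
Proof. by move=> *; rewrite RintegralB. Qed.

Lemma intZ (k : R) f : itg f -> \int[mu]_x (k * f x) = k * \int[mu]_x f x.
Proof. by move=> *; rewrite RintegralZl. Qed.

Lemma int_sum m (f : 'I_m -> T -> R) : (forall i, itg (f i)) ->
  \int[mu]_x (\sum_i f i x) = \sum_i \int[mu]_x f i x.
Proof.
move=> hf; rewrite /Rintegral; under eq_integral do rewrite -sumEFin.
rewrite integral_sum//; under eq_bigr do rewrite itgE//.
by rewrite sumEFin.
Qed.

Lemma int_le f g : itg f -> itg g -> (forall x, f x <= g x) ->
  \int[mu]_x f x <= \int[mu]_x g x.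
Proof. by move=> *; apply: le_Rintegral. Qed.

Lemma int_dct (f_ : nat -> T -> R) f g :
  (forall n, measurable_fun setT (f_ n)) -> measurable_fun setT f ->
  (forall x, f_ n x @[n --> \oo] --> f x) ->
  itg g -> (forall n x, `|f_ n x| <= g x) ->
  itg f /\ \int[mu]_x f_ n x @[n --> \oo] --> \int[mu]_x f x.
Proof.
move=> mf_ mf cf ig fg.
have [||||h1 _ h2] := @dominated_convergence _ _ _ mu setT measurableT
  (fun n x => (f_ n x)%:E) (EFin \o f) (EFin \o g) _ _ _ ig.
- by move=> n; exact/measurable_EFinP.
- exact/measurable_EFinP.
- by apply: aeW => x _; apply: cvg_EFin; [exact: nearW|exact: cf].
- by apply: aeW => x n _ /=; rewrite lee_fin fg.
split => //; apply: fine_cvg.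
by rewrite -itgE.
Qed.

(* The integral of a nonnegative function is a supremum over simple functions
   below it, so no measurability is required. *)
Lemma ge0_integral_mono (f g : T -> \bar R) :
  (forall x, 0 <= f x)%E -> (forall x, f x <= g x)%E ->
  (\int[mu]_x f x <= \int[mu]_x g x)%E.
Proof.
move=> f0 fg.
have g0 x : (0 <= g x)%E := le_trans (f0 x) (fg x).
rewrite !ge0_integralTE//; apply: le_ereal_sup => _ /= [h hf <-].
by exists h => // x; exact: le_trans (hf x) (fg x).
Qed.

(** Here [g] may be nonmeasurable, as the volume of a section is. Replacing [f] by its positive part
    only increases its integral and reduces the claim to nonnegative functions. *)
Lemma int_lower f (g : T -> \bar R) : itg f ->
  (forall x, 0 <= g x)%E -> (forall x, (f x)%:E <= g x)%E ->
  ((\int[mu]_x f x)%:E <= \int[mu]_x g x)%E.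
Proof.
move=> itf g0 fg; pose f' := fun x => Num.max (f x) 0.
have itf' : itg f'.
  apply: (@itg_le _ (fun x => `|f x|)).
  - have mf := itg_meas itf; have h := measurable_maxr mf (measurable_cst (0 : R)).
    exact: h.
  - exact: integrable_norm.
  - by move=> x; rewrite /f'; have [h|h] := leP (f x) 0; rewrite ?normr0 ?normr_ge0.
apply: (@le_trans _ _ (\int[mu]_x (f' x)%:E)%E).
  by rewrite itgE// lee_fin; apply: int_le => // x; rewrite le_max lexx.
apply: ge0_integral_mono => x; first by rewrite lee_fin le_max lexx orbT.
by rewrite /f'; have [h|h] := leP (f x) 0.
Qed.

Lemma fin_measure_itg_cst (k : R) : (mu setT < +oo)%E -> itg (fun=> k).
Proof.
move=> h; apply/integrableP; split; first by apply/measurable_EFinP.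
by rewrite /= integral_cst//= lte_mul_pinfty.
Qed.

End real_integrals.

(** * Volumes in [R^n] *)

Section volume.
Context (R : realType).
Local Notation leb := (@lebesgue_measure R).
Local Notation itg f := (leb.-integrable [set: R] (EFin \o f)).

Lemma vol_ge0 n (A : set (seq R)) : (0 <= vol n A)%E.
Proof.
elim: n A => [|n IH] A /=; first by case: ifP.
by apply: integral_ge0 => x _; exact: IH.
Qed.

Lemma vol_le n m (A : set (seq R)) (C : 'I_m -> R) (g : 'I_m -> R -> R) :
  (forall j, 0 <= C j) -> (forall j x, 0 <= g j x) -> (forall j, itg (g j)) ->
  (forall s, size s = n -> A s -> 1 <= \sum_j C j * \prod_(x <- s) g j x) ->
  (vol n A <= (\sum_j C j * (\int[leb]_x g j x) ^+ n)%:E)%E.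
Proof.
move=> C0 g0 ig; elim: n A C C0 => [|n IH] A C C0 hA /=.
  case: ifP => [/asboolP h|_]; rewrite lee_fin.
    apply: le_trans (hA [::] erefl h) _; apply: ler_sum => j _.
    by rewrite big_nil expr0.
  by apply: sumr_ge0 => j _; rewrite expr0 mulr1.
pose I j := \int[leb]_x g j x.
have I0 j : 0 <= I j by apply: Rintegral_ge0.
apply: (@le_trans _ _ (\int[leb]_x (\sum_j (C j * I j ^+ n) * g j x)%:E)%E).
  apply: ge0_integral_mono => x; first exact: vol_ge0.
  (* The factor of the first coordinate is absorbed into the constants, which are general in the
     induction for this reason. *)
  have := IH [set s | A (x :: s)] (fun j => C j * g j x).
  under [in X in _ -> X]eq_bigr do rewrite mulrAC.
  apply => [j|s sn As]; first by rewrite mulr_ge0.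
  have := hA (x :: s); rewrite /= sn => /(_ erefl As).
  by under eq_bigr do rewrite big_cons mulrA.
rewrite itgE; last by apply: itg_sum => j; apply: itgZ.
rewrite int_sum; last by move=> j; apply: itgZ.
rewrite lee_fin; apply: ler_sum => j _.
by rewrite intZ// -mulrA -exprSr.
Qed.

Lemma vol_mono n (A B : set (seq R)) : A `<=` B -> (vol n A <= vol n B)%E.
Proof.
elim: n A B => [|n IH] A B AB /=.
  by case: asboolP => [/AB h|_]; case: asboolP.
by apply: ge0_integral_mono => x; [exact: vol_ge0|apply: IH => s; exact: AB].
Qed.

(* Chebyshev's inequality in integrated form: the right-hand bound is the
   expectation of the polynomial minorant under the product density. *)
Lemma vol_ge n m (A : set (seq R)) (p : R -> R) (g : 'I_m -> R -> R)
    (sg lam c : R) (b : 'I_m -> R) :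
  (forall x, 0 <= p x) -> itg p -> \int[leb]_x p x = 1 ->
  (forall j, itg (fun x => p x * g j x)) ->
  (forall j, \int[leb]_x (p x * g j x) = 0) ->
  (forall j, itg (fun x => p x * g j x ^+ 2)) ->
  (forall j, \int[leb]_x (p x * g j x ^+ 2) <= sg) ->
  0 <= lam ->
  (forall s, size s = n -> lam * (\prod_(x <- s) p x) *
     (c - \sum_j (b j + \sum_(x <- s) g j x) ^+ 2) <= \1_A s) ->
  ((lam * (c - \sum_j (b j ^+ 2 + n%:R * sg)))%:E <= vol n A)%E.
Proof.
move=> p0 ip p1 ig1 g1 ig2 g2.
(* Along the induction [lam] collects the density of the coordinates already fixed, and [b j] the
   sum of [g j] over them. *)
elim: n A lam b => [|n IH] A lam b lam0 hA /=.
  have := hA [::] erefl; rewrite big_nil mulr1.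
  rewrite (eq_bigr (fun j => b j ^+ 2)); last by move=> j _; rewrite big_nil addr0.
  rewrite (eq_bigr (fun j => b j ^+ 2) (F1 := fun j => b j ^+ 2 + 0 * sg)); last by move=> j _; rewrite mul0r addr0.
  rewrite indicE; case: asboolP => h; last by rewrite memNset// lee_fin.
  by rewrite mem_set// lee_fin.
pose K := \sum_(j < m) (n%:R * sg).
(* This is the bound of the induction hypothesis for the section at [x], expanded in [p], [p g] and
   [p g^2]. The middle terms integrate to zero because the [g j] are centred. *)
pose q x := lam * ((c - K) * p x - \sum_j (b j ^+ 2 * p x + 2 * b j * (p x * g j x) + p x * g j x ^+ 2)).
have iS j : itg (fun x => b j ^+ 2 * p x + 2 * b j * (p x * g j x) + p x * g j x ^+ 2).
  by apply: itgD => //; apply: itgD; apply: itgZ.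
have iq : itg q.
  apply: itgZ; apply: itgB; first exact: itgZ.
  exact: itg_sum.
have qE x : q x = lam * p x * (c - \sum_j ((b j + g j x) ^+ 2 + n%:R * sg)).
  rewrite /q -mulrA; congr (_ * _).
  rewrite [in RHS]big_split /= -/K [RHS]mulrBr [in RHS]mulrDr mulr_sumr.
  rewrite [in RHS](eq_bigr (fun j => b j ^+ 2 * p x + 2 * b j * (p x * g j x) + p x * g j x ^+ 2)); last first.
    by move=> j _; ring.
  by ring.
have -> : (lam * (c - \sum_j (b j ^+ 2 + n.+1%:R * sg)))%:E = (lam * (c - \sum_j (b j ^+ 2 + sg) - K))%:E.
  congr EFin; congr (_ * _); rewrite /K -addrA -opprD -big_split/=; congr (_ - _).
  by apply: eq_bigr => j _; rewrite -natr1; ring.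
apply: (@le_trans _ _ (\int[leb]_x q x)%:E).
  rewrite lee_fin intZ; last by apply: itgB; [exact: itgZ|exact: itg_sum].
  apply: ler_wpM2l => //.
  rewrite intB; [|exact: itgZ|exact: itg_sum].
  rewrite intZ// p1 mulr1 int_sum// addrAC lerB//.
  apply: ler_sum => j _.
  rewrite !intD ?intZ ?p1 ?g1//; [|exact: itgZ|exact: itgZ|by apply: itgD; exact: itgZ].
  by rewrite mulr1 mulr0 addr0 lerD2l.
apply: int_lower => // [x|x]; first exact: vol_ge0.
rewrite qE; apply: IH; first by rewrite mulr_ge0.
move=> s sn; have := hA (x :: s); rewrite /= sn => /(_ erefl).
rewrite big_cons mulrA.
rewrite (eq_bigr (fun j => (b j + g j x + \sum_(x <- s) g j x) ^+ 2)); last first.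
  by move=> j _; rewrite big_cons addrA.
move=> h; apply: (le_trans h); rewrite !indicE.
rewrite (_ : (x :: s \in A) = (s \in [set s | A (x :: s)]))//.
Qed.

End volume.

(** * Orlicz functions *)

Section orlicz.
Context (R : realType) (V : R -> R).
Hypothesis oV : orlicz_fun V.
Local Notation leb := (@lebesgue_measure R).
Local Notation itg f := (leb.-integrable [set: R] (EFin \o f)).

Lemma orlicz_ge0 x : 0 <= V x.
Proof.
have [_ _ V0 Vp] := oV; have [->|x0] := eqVneq x 0; first by rewrite V0.
exact/ltW/Vp.
Qed.

(** The point [x] is a convex combination of [y] and [- y], where [V] takes the same value. *)
Lemma orlicz_mono x y : `|x| <= `|y| -> V x <= V y.
Proof.
have [Vc Vs V0 _] := oV; move=> xy; have [y0|y0] := eqVneq y 0.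
  move: xy; rewrite y0 normr0 normr_le0 => /eqP ->; exact: lexx.
pose t := (x / y + 1) / 2.
have txy : `|x / y| <= 1 by rewrite normf_div ler_pdivrMr ?normr_gt0// mul1r.
have t01 : 0 <= t <= 1 by move: txy; rewrite ler_norml /t => /andP[h1 h2]; lra.
have := Vc y (- y) t t01; rewrite Vs (_ : _ + _ * - y = x); last by rewrite /t; field.
by move=> /le_trans; apply; lra.
Qed.

Lemma orlicz_measurable : measurable_fun setT V.
Proof.
have h : measurable_fun setT (fun x => V (Num.max (x : R) 0)).
  apply: (@nondecreasing_measurable R) => // x y xy; apply: orlicz_mono.
  by have [h1|h1] := leP x 0; have [h2|h2] := leP y 0;
    rewrite ?normr0 ?normr_ge0// ?ger0_norm //; lra.
have -> : V = (fun x => V (Num.max (x : R) 0)) \o (@Num.norm R R).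
  apply/funext => x /=; rewrite max_l//; apply/eqP.
  by rewrite eq_le !orlicz_mono// normr_id.
exact: measurableT_comp.
Qed.

(** For [|x| > 1], convexity between [0] and [|x|] is applied at the point [1]. This linear growth
    makes [exp (b V)] integrable for [b < 0]. *)
Lemma orlicz_ge_lin x : V 1 * (`|x| - 1) <= V x.
Proof.
have [Vc Vs V0 Vp] := oV; have V1 : 0 < V 1 by apply: Vp; rewrite oner_neq0.
have [x1|x1] := leP `|x| 1; first by apply: le_trans (orlicz_ge0 x); nra.
have x0 : 0 < `|x| by lra.
have t01 : 0 <= `|x|^-1 <= 1 by rewrite invr_ge0 ltW//= invf_le1// ltW.
have := Vc `|x| 0 _ t01; rewrite V0 !mulr0 !addr0 mulVf ?gt_eqF// => h.
have -> : V x = V `|x| by apply/eqP; rewrite eq_le !orlicz_mono// normr_id.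
have : V 1 * `|x| <= V `|x| by rewrite -ler_pdivlMr// mulrC.
by lra.
Qed.

Lemma orlicz_le_lin x : `|x| <= 1 -> V x <= `|x| * V 1.
Proof.
have [Vc Vs V0 Vp] := oV => x1.
have t01 : 0 <= `|x| <= 1 by rewrite normr_ge0.
have := Vc 1 0 _ t01; rewrite V0 !mulr0 !addr0 mulr1 => /(le_trans _); apply.
by apply: orlicz_mono; rewrite normr_id.
Qed.

Lemma orlicz1_gt0 : 0 < V 1.
Proof. by have [_ _ _ Vp] := oV; apply: Vp; rewrite oner_neq0. Qed.

End orlicz.

(** * Elementary Lebesgue integrals on the line *)

Section lebesgue_facts.
Context (R : realType).
Local Notation leb := (@lebesgue_measure R).
Local Notation itg f := (leb.-integrable [set: R] (EFin \o f)).

Lemma ge0_integral_opp (f : R -> \bar R) :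
  measurable_fun [set: R] f -> (forall r, 0 <= f r)%E ->
  (\int[leb]_r f (- r)%R = \int[leb]_r f r)%E.
Proof.
move=> mf f0.
transitivity (\int[pushforward leb (-%R : _ -> measurableTypeR R)]_r f r)%E; last first.
  by apply: eq_measure_integral => //= A mA AS; exact/lebesgue_measureN.
by rewrite ge0_integral_pushforward//= preimage_setT.
Qed.

Lemma leb_itg_le (f g : R -> R) : measurable_fun setT f -> itg g ->
  (forall x : R, `|f x| <= g x) -> itg f.
Proof. exact: (@itg_le _ (measurableTypeR R) R leb f g). Qed.

(** Up to the factor [a], the exponential density and its reflection cover one half-line each. *)
Lemma itg_expR_norm (a : R) : 0 < a -> itg (fun x : R => expR (- a * `|x|)).
Proof.
move=> a0.
have ie : itg (exponential_pdf a) by apply: integrable_exponential_pdf.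
have ie' : itg (fun x => exponential_pdf a (- x)).
  apply/integrableP; split.
    apply/measurable_EFinP; apply: measurableT_comp => //.
    exact: itg_meas ie.
  move/integrableP : ie => [me].
  by rewrite -(ge0_integral_opp (f := fun x => `|(EFin \o exponential_pdf a) x|%E))//;
    apply: measurableT_comp.
apply: (@itg_le _ _ _ leb _ (fun x : R => a^-1 * (exponential_pdf a x + exponential_pdf a (- x)))).
- apply: measurableT_comp => //; apply: measurable_funM => //.
- by apply: itgZ; apply: itgD.
- move=> x; rewrite ger0_norm ?expR_ge0// mulrDr.
  have pos y : 0 <= a^-1 * exponential_pdf a y.
    by rewrite mulr_ge0 ?invr_ge0 ?exponential_pdf_ge0// ltW.
  have [x0|x0] := leP 0 x.
    have -> : expR (- a * `|x|) = a^-1 * exponential_pdf a x.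
      by rewrite exponential_pdfE// mulrA mulVf ?gt_eqF// mul1r ger0_norm.
    by rewrite lerDl pos.
  have -> : expR (- a * `|x|) = a^-1 * exponential_pdf a (- x).
    rewrite exponential_pdfE; last by lra.
    by rewrite mulrA mulVf ?gt_eqF// mul1r ltr0_norm.
  by rewrite lerDr pos.
Qed.

Lemma itg_indic_itv (a b : R) : itg (\1_(`[a, b]%classic) : R -> R).
Proof. exact: integrable_indic_itv. Qed.

Lemma int_indic_itv (a b : R) : a <= b -> \int[leb]_x (\1_(`[a, b]%classic) x) = b - a.
Proof.
move=> ab; rewrite /Rintegral integral_indic// setIT/= lebesgue_measure_itv/= lte_fin.
case: ltP => // ba; have -> : a = b by apply/eqP; rewrite eq_le ab.
by rewrite subrr.
Qed.

End lebesgue_facts.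

(** * Densities *)

Lemma probability_of (R : realType) (m : set R -> \bar R) :
  m set0 = 0%E -> (forall A, 0 <= m A)%E -> semi_sigma_additive m ->
  m setT = 1%E -> exists P : M1 R, P = m :> (set R -> \bar R).
Proof.
move=> m0 mge msa m1.
pose mM := isMeasure.Build _ _ _ m m0 mge msa.
pose mm : {measure set R -> \bar R} := HB.pack m mM.
pose P : M1 R := HB.pack m mM (@Measure_isProbability.Build _ _ R mm m1).
by exists P.
Qed.

Section ae_tools.
Context d (T : measurableType d) (R : realType) (mu : {measure set T -> \bar R}).
Implicit Types (f g : T -> R).
Local Notation itg f := (mu.-integrable [set: T] (EFin \o f)).

Lemma ae_int f g : measurable_fun setT f -> measurable_fun setT g ->
  {ae mu, forall x, f x = g x} -> \int[mu]_x f x = \int[mu]_x g x.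
Proof.
move=> mf mg fg; congr fine; apply: ae_eq_integral => //.
- exact/measurable_EFinP.
- exact/measurable_EFinP.
- by apply: filterS fg => x fgx _ /=; rewrite fgx.
Qed.

Lemma ae_itg f g : measurable_fun setT f -> measurable_fun setT g ->
  {ae mu, forall x, f x = g x} -> itg f -> itg g.
Proof.
move=> mf mg fg /integrableP[_ fi]; apply/integrableP; split.
  exact/measurable_EFinP.
suff <- : (\int[mu]_x `|(EFin \o f) x| = \int[mu]_x `|(EFin \o g) x|)%E by [].
apply: ae_eq_integral => //.
- by apply: measurableT_comp => //; exact/measurable_EFinP.
- by apply: measurableT_comp => //; exact/measurable_EFinP.
- by apply: filterS fg => x fgx _ /=; rewrite fgx.
Qed.

End ae_tools.

Section density.
Context (R : realType) (P : M1 R) (nu : {sigma_finite_measure set R -> \bar R}).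
Implicit Types f g : R -> R.

Lemma density_exists : (forall A, measurable A -> nu A = 0 -> P A = 0)%E ->
  exists f, is_density P nu f.
Proof.
move=> ac.
have dom : P `<< nu.
  move=> A nA B mB BA; apply: ac => //; exact: nA.
pose F := Radon_Nikodym_SigmaFinite.f P nu.
have F0 := Radon_Nikodym_SigmaFinite.f_ge0 dom.
have Ffin := Radon_Nikodym_SigmaFinite.f_fin_num dom.
exists (fun x => fine (F x)); split.
- apply: measurableT_comp => //.
  exact: measurable_int (Radon_Nikodym_SigmaFinite.f_integrable dom).
- by move=> x; rewrite fine_ge0.
- move=> A mA; rewrite (Radon_Nikodym_SigmaFinite.f_integral dom)//.
  by apply: eq_integral => x _; rewrite fineK.
Qed.

Lemma density_dominates f : is_density P nu f -> P `<< nu.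
Proof.
move=> [mf f0 fP] A nA B mB BA; rewrite fP//.
apply: null_set_integral => //; last exact: nA.
by apply/measurable_funTS; exact/measurable_EFinP.
Qed.

Lemma density_itg1 f : is_density P nu f -> nu.-integrable setT (EFin \o f).
Proof.
move=> [mf f0 fP]; apply/integrableP; split; first exact/measurable_EFinP.
under eq_integral do rewrite /= ger0_norm//.
by rewrite -fP// probability_setT ltry.
Qed.

Lemma density_int1 f : is_density P nu f -> \int[nu]_x f x = 1.
Proof.
by move=> [mf f0 fP]; rewrite /Rintegral -fP// probability_setT.
Qed.

Lemma density_ae f (F : R -> \bar R) : is_density P nu f ->
  measurable_fun setT F ->
  (forall A, measurable A -> P A = \int[nu]_(x in A) F x)%E ->
  ae_eq nu setT (EFin \o f) F.
Proof.
move=> df mF hF; apply: integral_ae_eq => //; first exact: density_itg1.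
by move=> A _ mA; rewrite -hF//; case: df => _ _ <-.
Qed.

Lemma density_unique f g : is_density P nu f -> is_density P nu g ->
  {ae nu, forall x, f x = g x}.
Proof.
move=> df [mg g0 gP].
have mg' : measurable_fun setT (EFin \o g) by exact/measurable_EFinP.
by apply: filterS (density_ae df mg' gP) => x /= /(_ I)[].
Qed.

(** Change of variables holds for the chosen Radon-Nikodym derivative, which agrees with [f] almost
    everywhere. *)
Lemma ge0_integral_density f (g : R -> \bar R) : is_density P nu f ->
  measurable_fun setT g -> (forall x, 0 <= g x)%E ->
  (\int[P]_x g x = \int[nu]_x (g x * (f x)%:E))%E.
Proof.
move=> df mg g0; have dom := density_dominates df.
have [mf f0 fP] := df.
rewrite -(Radon_Nikodym_SigmaFinite.change_of_variables dom)//.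
have mF := measurable_int _ (Radon_Nikodym_SigmaFinite.f_integrable dom).
apply: ge0_ae_eq_integral => //.
- exact: emeasurable_funM.
- by apply: emeasurable_funM => //; exact/measurable_EFinP.
- by move=> x _; rewrite mule_ge0// (Radon_Nikodym_SigmaFinite.f_ge0 dom).
- by move=> x _; rewrite mule_ge0// lee_fin.
- have := density_ae df mF (Radon_Nikodym_SigmaFinite.f_integral dom).
  by apply: filterS => x /= /(_ I) h _; rewrite -h.
Qed.

Lemma density_itg f g : is_density P nu f -> measurable_fun setT g ->
  P.-integrable setT (EFin \o g) <->
  nu.-integrable setT (EFin \o (fun x => f x * g x)).
Proof.
move=> df mg; have [mf f0 fP] := df.
have E : (\int[P]_x `|(EFin \o g) x| = \int[nu]_x `|(EFin \o (fun x => (f x * g x)%R)) x|)%E.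
  rewrite (ge0_integral_density df)//; last first.
    by apply: measurableT_comp => //; exact/measurable_EFinP.
  by apply: eq_integral => x _ /=; rewrite normrM (ger0_norm (f0 x)) -EFinM mulrC.
have mfg : measurable_fun setT (EFin \o (fun x => f x * g x)).
  by apply/measurable_EFinP; exact: measurable_funM.
split => /integrableP[_ h]; apply/integrableP; split => //.
- by rewrite -E.
- exact/measurable_EFinP.
- by rewrite E.
Qed.

Lemma density_int f g : is_density P nu f -> P.-integrable setT (EFin \o g) ->
  \int[P]_x g x = \int[nu]_x (f x * g x).
Proof.
move=> df ig; have [mf f0 fP] := df; have mg := itg_meas ig.
pose gp x := Num.max (g x) 0; pose gn x := Num.max (- g x) 0.
have gE x : g x = gp x - gn x.
  rewrite /gp /gn; have [h|h] := leP (g x) 0; have [h'|h'] := leP (- g x) 0; lra.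
have gp0 x : 0 <= gp x by rewrite le_max lexx orbT.
have gn0 x : 0 <= gn x by rewrite le_max lexx orbT.
have mgp : measurable_fun setT gp by have h := measurable_maxr mg (measurable_cst (0 : R)); exact: h.
have mgn : measurable_fun setT gn.
  have h := measurable_maxr (measurable_funN mg) (measurable_cst (0 : R)); exact: h.
have igp : P.-integrable setT (EFin \o gp).
  apply: (itg_le (g := fun x => `|g x|) mgp) => [|x]; first exact: integrable_norm.
  by rewrite ger0_norm// /gp; have [h|h] := leP (g x) 0; rewrite ?normr_ge0 ?ler_norm.
have ign : P.-integrable setT (EFin \o gn).
  apply: (itg_le (g := fun x => `|g x|) mgn) => [|x]; first exact: integrable_norm.
  rewrite ger0_norm// /gn; have [h|h] := leP (- g x) 0; rewrite ?normr_ge0//.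
  by rewrite -normrN ler_norm.
have pos (h : R -> R) : measurable_fun setT h -> (forall x, 0 <= h x) ->
    \int[P]_x h x = \int[nu]_x (f x * h x).
  move=> mh h0; congr fine.
  rewrite (ge0_integral_density df)//; last by exact/measurable_EFinP.
  by apply: eq_integral => x _ /=; rewrite -EFinM mulrC.
have -> : \int[P]_x g x = \int[P]_x (gp x - gn x) by apply: eq_Rintegral => x _.
rewrite intB// pos// pos// -intB; last 2 first.
- exact/(density_itg df mgp).
- exact/(density_itg df mgn).
by apply: eq_Rintegral => x _; rewrite gE mulrBr.
Qed.

End density.

(* The Borel structure of [R] comes in two copies which differ by their display
   only: [lebesgue_measure] lives on one of them, [M1 R] on the other. *)
Section lebesgue_display.
Context (R : realType).
Local Notation leb := (@lebesgue_measure R).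
Local Notation itg f := (leb.-integrable [set: R] (EFin \o f)).

(** Pushing forward along this identity transports integrals from one copy to the other. *)
Let idR : measurableTypeR R -> R := idfun.

Let midR : measurable_fun setT idR.
Proof. by move=> _ Y mY; rewrite setTI; exact: mY. Qed.

Lemma lebesgue_default : exists L : {sigma_finite_measure set R -> \bar R},
  L = leb :> (set R -> \bar R).
Proof.
pose m : set R -> \bar R := leb.
have m0 : m set0 = 0%E by exact: measure0.
have mge A : (0 <= m A)%E by exact: (measure_ge0 leb A).
have msa : semi_sigma_additive m by exact: (@measure_semi_sigma_additive _ _ _ leb).
pose mM := isMeasure.Build _ _ _ m m0 mge msa.
pose mm : {measure set R -> \bar R} := HB.pack m mM.
have sf : sigma_finite setT m by exact: (sigma_finiteT leb).
pose L : {sigma_finite_measure set R -> \bar R} := HB.pack m mM (@Measure_isSigmaFinite.Build _ _ R mm sf).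
by exists L.
Qed.

Let intR (nu : set R -> \bar R) A f := (\int[nu]_(x in A) f x)%E.

Lemma integral_lebesgue_default A (f : R -> \bar R) : measurable A ->
  measurable_fun A f -> (forall x, 0 <= f x)%E ->
  intR leb A f = (\int[leb]_(x in A) f x)%E.
Proof.
move=> mA mf f0; have := @ge0_integral_pushforward _ _ _ _ R idR midR leb A f mA mf.
by move=> <-// y _; exact: f0.
Qed.

Lemma lebesgue_densityP (P : M1 R) f : is_density P leb f <->
  [/\ measurable_fun setT f, (forall x, 0 <= f x) &
    forall A, measurable A -> P A = (\int[leb]_(x in A) (f x)%:E)%E].
Proof.
split=> -[mf f0 fP]; split => // A mA; rewrite fP//.
- rewrite -integral_lebesgue_default//; first by apply/measurable_funTS; exact/measurable_EFinP.
- rewrite -integral_lebesgue_default//; first by apply/measurable_funTS; exact/measurable_EFinP.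
Qed.

Lemma lebesgue_density_int1 (P : M1 R) f : is_density P leb f ->
  itg f /\ \int[leb]_x f x = 1.
Proof.
move=> /lebesgue_densityP[mf f0 fP].
have E : (\int[leb]_x (f x)%:E = 1)%E by rewrite -fP// probability_setT.
split; last by rewrite /Rintegral E.
apply/integrableP; split; first exact/measurable_EFinP.
under eq_integral do rewrite /= ger0_norm//.
by rewrite E ltry.
Qed.

Lemma lebesgue_ge0_integral_density (P : M1 R) f (g : R -> \bar R) :
  is_density P leb f -> measurable_fun setT g -> (forall x, 0 <= g x)%E ->
  (\int[P]_x g x = \int[leb]_x (g x * (f x)%:E))%E.
Proof.
have [L LE] := lebesgue_default.
rewrite -[X in is_density _ X _]LE => df mg g0.
have [mf f0 fP] := df.
rewrite (ge0_integral_density df mg g0) LE.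
rewrite -[RHS]integral_lebesgue_default//.
- by apply: emeasurable_funM => //; exact/measurable_EFinP.
- by move=> x; rewrite mule_ge0// lee_fin.
Qed.

Lemma itg_lebesgue_default (L : {sigma_finite_measure set R -> \bar R}) (f : R -> R) :
  L = leb :> (set R -> \bar R) ->
  L.-integrable [set: R] (EFin \o f) <-> itg f.
Proof.
move=> LE; have E : measurable_fun setT f -> (\int[L]_x `|(EFin \o f) x|)%E = (\int[leb]_x `|(EFin \o f) x|)%E.
  move=> mf; rewrite LE -[RHS]integral_lebesgue_default//.
  by apply: measurableT_comp => //; exact/measurable_EFinP.
split=> /integrableP[/measurable_EFinP mf h]; apply/integrableP; split; first exact/measurable_EFinP.
- by rewrite -E.
- exact/measurable_EFinP.
- by rewrite E.
Qed.

Lemma lebesgue_density_itg (P : M1 R) f g : is_density P leb f ->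
  measurable_fun setT g ->
  P.-integrable setT (EFin \o g) <-> itg (fun x => f x * g x).
Proof.
have [L LE] := lebesgue_default.
move=> df mg; rewrite -(itg_lebesgue_default _ LE).
by apply: density_itg => //; rewrite LE.
Qed.

Lemma lebesgue_density_int (P : M1 R) f g : is_density P leb f ->
  P.-integrable setT (EFin \o g) ->
  \int[P]_x g x = \int[leb]_x (f x * g x).
Proof.
move=> df ig; have [mf f0 fP] := df; have mg := itg_meas ig.
have pos (h : R -> R) : measurable_fun setT h -> (forall x, 0 <= h x) ->
    \int[P]_x h x = \int[leb]_x (f x * h x).
  move=> mh h0; congr fine.
  rewrite (lebesgue_ge0_integral_density df)//; last by exact/measurable_EFinP.
  by apply: eq_integral => x _ /=; rewrite -EFinM mulrC.
pose gn : R -> R := fun x => `|g x| - g x.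
have ian : P.-integrable setT (EFin \o (fun x => `|g x|)) by exact: integrable_norm.
have ign : P.-integrable setT (EFin \o gn) by exact: itgB.
have -> : \int[P]_x g x = \int[P]_x (`|g x| - gn x).
  by apply: eq_Rintegral => x _; rewrite /gn; lra.
have h1 := pos _ (itg_meas ian) (fun x => normr_ge0 (g x)).
have h2 : \int[P]_x gn x = \int[leb]_x (f x * gn x).
  by apply: pos (itg_meas ign) _ => x; rewrite /gn subr_ge0 ler_norm.
rewrite intB// h1 h2.
rewrite -intB.
- by apply: eq_Rintegral => x _; rewrite /gn; lra.
- by apply/(lebesgue_density_itg df) => //; exact: itg_meas ian.
- by apply/(lebesgue_density_itg df) => //; exact: itg_meas ign.
Qed.

End lebesgue_display.

(** * Gibbs measures *)

Definition partition_fun (R : realType) (V : R -> R) (b : R) : R :=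
  \int[@lebesgue_measure R]_x expR (b * V x).

Section gibbs_measure.
Context (R : realType) (V : R -> R).
Hypothesis oV : orlicz_fun V.
Local Notation leb := (@lebesgue_measure R).
Local Notation itg f := (leb.-integrable [set: R] (EFin \o f)).
Local Notation Z := (partition_fun V).

Lemma measurable_expRV (b : R) : measurable_fun setT (fun x => expR (b * V x)).
Proof.
apply: measurableT_comp => //; apply: measurable_funM => //.
exact: orlicz_measurable.
Qed.

Lemma itg_expRV (b : R) : b < 0 -> itg (fun x => expR (b * V x)).
Proof.
move=> b0; have V1 := orlicz1_gt0 oV.
have h : 0 < - b * V 1 by nra.
apply: (leb_itg_le (g := fun x : R => expR (- b * V 1) * expR (- (- b * V 1) * `|x|))).
- exact: measurable_expRV.
- by apply: itgZ; exact: itg_expR_norm.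
- move=> x; rewrite ger0_norm ?expR_ge0// -expRD ler_expR.
  by have := orlicz_ge_lin oV x; nra.
Qed.

(** Half of the exponent absorbs the factor [V], because [y exp(-y) <= 1]. *)
Lemma itg_VexpRV (b : R) : b < 0 -> itg (fun x => V x * expR (b * V x)).
Proof.
move=> b0.
apply: (leb_itg_le (g := fun x : R => (2 / - b) * expR (b / 2 * V x))).
- apply: measurable_funM; [exact: orlicz_measurable|exact: measurable_expRV].
- by apply: itgZ; apply: itg_expRV; lra.
- move=> x; rewrite ger0_norm ?mulr_ge0 ?expR_ge0 ?orlicz_ge0//.
  set y := - b / 2 * V x.
  have ye : y * expR (- y) <= 1.
    rewrite expRN ler_pdivrMr ?expR_gt0// mul1r.
    by apply: le_trans (expR_ge1Dx y); lra.
  have -> : b * V x = - y + b / 2 * V x by rewrite /y; lra.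
  have -> : V x * expR (- y + b / 2 * V x) = 2 / - b * ((y * expR (- y)) * expR (b / 2 * V x)).
    by rewrite expRD /y; field; rewrite lt_eqF.
  rewrite ler_pM2l ?divr_gt0//; last lra.
  by rewrite -[leRHS]mul1r ler_wpM2r ?expR_ge0.
Qed.

Lemma partition_gt0 (b : R) : b < 0 -> 0 < Z b.
Proof.
move=> b0; apply: (@lt_le_trans _ _ (expR (b * V 1) * 2)).
  by rewrite mulr_gt0 ?expR_gt0.
have -> : 2 = \int[leb]_x (\1_(`[-1, 1]%classic) x) :> R.
  by rewrite int_indic_itv//; lra.
rewrite -intZ; last exact: itg_indic_itv.
apply: int_le; [exact/itgZ/itg_indic_itv|exact: itg_expRV|move=> x].
rewrite indicE; case: (boolP (x \in _)) => [|_]; last by rewrite mulr0 expR_ge0.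
rewrite inE/= in_itv/= => /andP[x1 x2]; rewrite mulr1 ler_expR.
apply: ler_wnM2l; first exact: ltW.
by apply: orlicz_mono => //; rewrite normr1 ler_norml x1.
Qed.

Lemma gibbs_probability (b : R) : b < 0 -> exists G : M1 R, G = gibbs V b :> (set R -> \bar R).
Proof.
move=> b0; apply: probability_of.
- by rewrite /gibbs integral_set0 mul0e.
- move=> A; rewrite /gibbs mule_ge0//.
    by apply: integral_ge0 => x _; rewrite lee_fin expR_ge0.
  by rewrite lee_fin invr_ge0 fine_ge0// integral_ge0// => x _; rewrite lee_fin expR_ge0.
- move=> F mF tF mUF; rewrite /gibbs.
  under eq_fun => n.
    rewrite -ge0_sume_distrl; last by move=> i _; apply: integral_ge0 => x _; rewrite lee_fin expR_ge0.
    over.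
  rewrite ge0_integral_bigcup//=; last first.
    by apply/measurable_funTS/measurable_EFinP; exact: measurable_expRV.
  apply: cvgeZr => //; apply: is_cvg_ereal_nneg_natsum => n _.
  by apply: integral_ge0 => x _; rewrite lee_fin expR_ge0.
- rewrite /gibbs itgE; last exact: itg_expRV.
  by rewrite -EFinM /= divff// gt_eqF// partition_gt0.
Qed.

Lemma gibbs_density (b : R) : b < 0 ->
  is_density (gibbs V b) leb (fun x => expR (b * V x) / Z b).
Proof.
move=> b0; have Z0 := partition_gt0 b0.
have [G GE] := gibbs_probability b0; rewrite -GE; apply/lebesgue_densityP; split.
- by apply: measurable_funM => //; exact: measurable_expRV.
- by move=> x; rewrite divr_ge0 ?expR_ge0// ltW.
- move=> A mA; rewrite GE /gibbs.
  under [RHS]eq_integral do rewrite EFinM.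
  rewrite ge0_integralZr//; last 2 first.
  + by apply/measurable_funTS/measurable_EFinP; exact: measurable_expRV.
  + by rewrite lee_fin invr_ge0 ltW.
Qed.

(* The equation says that the Gibbs measure has [V]-moment [Rad]. *)
Lemma exists_critical (Rad : R) : 0 < Rad -> exists2 a : R, a < 0 &
  \int[leb]_x ((V x - Rad) * expR (a * V x)) = 0.
Proof.
move=> R0; have V1 := orlicz1_gt0 oV.
pose F (b : R) x := (V x - Rad) * expR (b * V x).
have iF (b : R) : b < 0 -> itg (F b).
  move=> b0; have -> : F b = (fun x => V x * expR (b * V x) - Rad * expR (b * V x)).
    by apply/funext => x; rewrite /F; lra.
  by apply: itgB; [exact: itg_VexpRV|apply: itgZ; exact: itg_expRV].
have cont (u v : R) : v < 0 -> {in `]u, v[, continuous (fun b => \int[leb]_x F b x)}.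
  move=> v0.
  have H := @continuity_under_integral R _ _ leb F setT measurableT u v _ _
    (fun x => V x * expR (v * V x) + Rad * expR (v * V x)).
  move=> b buv; apply: H => //.
  - move=> c; rewrite /= in_itv/= => /andP[_ cv]; apply: iF; lra.
  - apply: aeW => x _ c _; apply: cvgM; first exact: cvg_cst.
    apply: (@cvg_comp _ _ _ (fun z => z * V x) expR); last exact: continuous_expR.
    by apply: cvgM; [exact: cvg_id|exact: cvg_cst].
  - by apply: itgD; [exact: itg_VexpRV|apply: itgZ; exact: itg_expRV].
  - move=> c; rewrite /= in_itv/= => /andP[_ cv]; apply: aeW => x _.
    rewrite /F normrM (ger0_norm (expR_ge0 _)) -mulrDl.
    apply: ler_pM => //.
      by have Vx := orlicz_ge0 oV x; rewrite ler_norml; apply/andP; split; lra.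
    by rewrite ler_expR ler_wpM2r ?orlicz_ge0// ltW.
  - by rewrite inE.
have [b2 b20 pos] : exists2 b : R, b < 0 & 0 <= \int[leb]_x F b x.
  (* Outside [[-r, r]] one has [V >= 2 Rad] by linear growth. The exponent [b] is so close to [0]
     that [exp (b V) >= 1/2] up to [5 r]. The loss, at most [Rad] on a length [2 r], is then
     balanced by the gain, at least [Rad / 2] on the length [4 r] of [[r, 5 r]]. *)
  pose r := 1 + 2 * Rad / V 1.
  have r0 : 0 < r by rewrite addr_gt0 ?divr_gt0 ?mulr_gt0.
  have VL : 0 < V (5 * r) by have [_ _ _ Vp] := oV; apply: Vp; rewrite gt_eqF ?mulr_gt0.
  pose b := - (2 * V (5 * r))^-1.
  have b0 : b < 0 by rewrite oppr_lt0 invr_gt0 mulr_gt0.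
  have eb : 1 / 2 <= expR (b * V (5 * r)).
    apply: le_trans (expR_ge1Dx _).
    by rewrite /b mulNr invfM -mulrA mulVf ?gt_eqF//; lra.
  exists b => //.
  pose q x := - Rad * \1_(`[- r, r]%classic) x + Rad / 2 * \1_(`[r, 5 * r]%classic) x : R.
  apply: (@le_trans _ _ (\int[leb]_x q x)).
    rewrite intD; [|exact/itgZ/itg_indic_itv|exact/itgZ/itg_indic_itv].
    rewrite !intZ; [|exact: itg_indic_itv|exact: itg_indic_itv].
    by rewrite !int_indic_itv; [nra|lra|lra].
  apply: int_le; [|exact: iF|move=> x].
    by apply: itgD; exact/itgZ/itg_indic_itv.
  have Vx := orlicz_ge0 oV x; have e0 := expR_ge0 (b * V x).
  have e1 : expR (b * V x) <= 1 by rewrite -expR0 ler_expR nmulr_rle0.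
  rewrite /q /F !indicE.
  case: (boolP (x \in `[r, 5 * r]%classic)) => h1; last first.
    rewrite mulr0 addr0; case: (boolP (x \in `[- r, r]%classic)) => h2 /=.
      by rewrite mulr1; nra.
    rewrite mulr0 mulr_ge0// subr_ge0.
    apply: le_trans (orlicz_ge_lin oV x).
    have xr : r <= `|x|.
      rewrite leNgt; apply/negP => /ltW xr; move/negP : h2; apply.
      by rewrite inE/= in_itv/= -ler_norml.
    have -> : Rad = V 1 * (Rad / V 1) by field; rewrite gt_eqF.
    have q0 : 0 < Rad / V 1 by rewrite divr_gt0.
    by rewrite ler_pM2l//; move: xr; rewrite /r; lra.
  move: h1; rewrite inE/= in_itv/= => /andP[x1 x2].
  have x5 : V x <= V (5 * r) by apply: orlicz_mono => //; rewrite !ger0_norm; lra.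
  have xR : 2 * Rad <= V x.
    apply: le_trans (orlicz_ge_lin oV x); rewrite ger0_norm; last lra.
    have -> : 2 * Rad = V 1 * (2 * Rad / V 1) by field; rewrite gt_eqF.
    by rewrite ler_pM2l//; move: x1; rewrite /r; lra.
  have ex : 1 / 2 <= expR (b * V x).
    by apply: le_trans eb _; rewrite ler_expR ler_wnM2l// ltW.
  have : Rad / 2 <= (V x - Rad) * expR (b * V x) by nra.
  by rewrite mulr1; case: (_ \in _); rewrite ?mulr1 ?mulr0; lra.
have [b1 b10 neg] : exists2 b : R, b < 0 & \int[leb]_x F b x <= 0.
  (* After factoring out [exp (b Rad)], the part [V > Rad] contributes at most [exp(Rad) K] as soon
     as [b <= -1], while on [[-dl, dl]] one has [V <= Rad / 2] and the integrand is at most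
     [- Rad / 2 exp (- b Rad / 2)]. The constant [M] is the size of this exponential at which the
     two balance, and [b] is chosen to reach it. *)
  pose K := \int[leb]_x (V x * expR (- 1 * V x)).
  have iK : itg (fun x => V x * expR (- 1 * V x)) by apply: itg_VexpRV; lra.
  have K0 : 0 <= K by apply: Rintegral_ge0 => x _; rewrite mulr_ge0 ?expR_ge0 ?orlicz_ge0.
  pose dl := Num.min 1 (Rad / 2 / V 1).
  have dl0 : 0 < dl by rewrite lt_min ltr01 !divr_gt0.
  pose M := expR Rad * K / (Rad * dl).
  have M0 : 0 <= M by rewrite divr_ge0 ?mulr_ge0 ?expR_ge0// ltW.
  pose b := - (1 + 2 * M / Rad).
  have MR : 0 <= M / Rad by apply: divr_ge0 => //; exact: ltW.
  have b1 : b <= - 1 by rewrite /b; lra.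
  exists b; first lra.
  have eM : M <= expR (- b * (Rad / 2)).
    apply: le_trans (expR_ge1Dx _).
    have -> : - b * (Rad / 2) = Rad / 2 + M by rewrite /b; field; rewrite gt_eqF.
    by lra.
  pose q x := expR (b * Rad) * (expR Rad * (V x * expR (- 1 * V x))
     - Rad / 2 * expR (- b * (Rad / 2)) * \1_(`[- dl, dl]%classic) x) : R.
  have iq : itg q.
    apply: itgZ; apply: itgB; first exact: itgZ.
    exact/itgZ/itg_indic_itv.
  apply: (@le_trans _ _ (\int[leb]_x q x)).
    apply: int_le => //; first by apply: iF; lra.
    move=> x; have Vx := orlicz_ge0 oV x.
    have -> : F b x = expR (b * Rad) * ((V x - Rad) * expR (b * (V x - Rad))).
      by rewrite /F mulrCA -expRD; congr (_ * expR _); lra.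
    rewrite ler_pM2l ?expR_gt0//.
    have tail : 0 <= expR Rad * (V x * expR (- 1 * V x)).
      by rewrite !mulr_ge0 ?expR_ge0.
    rewrite indicE; case: (boolP (x \in _)) => [|_].
      rewrite inE/= in_itv/= -ler_norml mulr1 => xd.
      have xd1 : `|x| <= 1 by move: xd; rewrite le_min => /andP[].
      have VR : V x <= Rad / 2.
        apply: le_trans (orlicz_le_lin oV xd1) _.
        by rewrite -ler_pdivlMr//; move: xd; rewrite le_min => /andP[].
      have : expR (- b * (Rad / 2)) <= expR (b * (V x - Rad)).
        by rewrite ler_expR; nra.
      by have := expR_ge0 (- b * (Rad / 2)); nra.
    rewrite mulr0 subr0; have [VR|VR] := leP (V x) Rad.
      by apply: le_trans tail; rewrite mulr_le0_ge0 ?expR_ge0//; lra.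
    rewrite mulrCA -expRD ler_pM ?expR_ge0//; [lra|lra|rewrite ler_expR; nra].
  rewrite intZ; last by apply: itgB; [exact: itgZ|exact/itgZ/itg_indic_itv].
  rewrite mulr_ge0_le0 ?expR_ge0//.
  rewrite intB; [|exact: itgZ|exact/itgZ/itg_indic_itv].
  rewrite !intZ//; last exact: itg_indic_itv.
  rewrite int_indic_itv; last lra.
  rewrite subr_le0 -/K.
  have -> : expR Rad * K = Rad * dl * M by rewrite /M; field; rewrite !gt_eqF.
  have := mulr_gt0 R0 dl0; nra.
(* The open interval from [u - 1] to [v / 2] contains [[u, v]] and its right end is still negative,
   as the dominating function requires. *)
have sub (u v : R) : v < 0 -> {within `[u, v], continuous (fun b => \int[leb]_x F b x)}.
  move=> v0; apply: continuous_in_subspaceT => c; rewrite inE/= in_itv/= => /andP[c1 c2].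
  apply: (@cont (u - 1) (v / 2)); first lra.
  by rewrite in_itv/=; apply/andP; split; lra.
have [b12|b21] := leP b1 b2.
  have [|c] := IVT b12 (sub _ _ b20) (v := 0).
    by rewrite ge_min le_max neg pos orbT.
  by rewrite in_itv/= => /andP[_ cb2] cE; exists c => //; lra.
have [|c] := IVT (ltW b21) (sub _ _ b10) (v := 0).
  by rewrite ge_min le_max neg pos orbT.
by rewrite in_itv/= => /andP[_ cb1] cE; exists c => //; lra.
Qed.

End gibbs_measure.

(** * The rate function *)

(** Young's inequality for the conjugate pair [u ln u - u] and [exp y]; it is [1 + z <= exp z] at
    [z = y - ln u]. At [u = 0] the product [u ln u] is [0]. *)
Lemma young_ln (R : realType) (u y : R) : 0 <= u -> u * y <= u * ln u - u + expR y.
Proof.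
rewrite le_eqVlt => /predU1P[<-|u0]; first by rewrite !mul0r subr0 add0r expR_ge0.
have := expR_ge1Dx (y - ln u); rewrite expRB lnK ?posrE// ler_pdivlMr//.
by lra.
Qed.

Lemma xlnx_ge (R : realType) (u : R) : 0 <= u -> u - 1 <= u * ln u.
Proof. by move=> /(young_ln 0); rewrite expR0 mulr0; lra. Qed.

Lemma measurable_xlnx (R : realType) d (T : measurableType d) (f : T -> R) :
  measurable_fun setT f -> measurable_fun setT (fun x => f x * ln (f x)).
Proof.
move=> mf; apply: measurable_funM => //.
by apply: measurableT_comp => //; exact: measurable_ln.
Qed.

Definition free_energy (R : realType) (V : R -> R) (Rad b : R) : R :=
  ln (partition_fun V b) - b * Rad.

Section rate_formula.
Context (R : realType) (V : R -> R) (Rad b : R) (mu G : M1 R).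
Hypothesis oV : orlicz_fun V.
Hypothesis b0 : b < 0.
Hypothesis GE : G = gibbs V b :> (set R -> \bar R).
Local Notation leb := (@lebesgue_measure R).
Local Notation itg f := (leb.-integrable [set: R] (EFin \o f)).
Local Notation Z := (partition_fun V).

Lemma mV_fin : (mV V mu < +oo)%E -> mu.-integrable setT (EFin \o V).
Proof.
move=> h; apply/integrableP; split.
  by apply/measurable_EFinP; exact: orlicz_measurable.
by under eq_integral do rewrite /= ger0_norm ?orlicz_ge0//.
Qed.

Lemma mVE : mu.-integrable setT (EFin \o V) -> mV V mu = (\int[mu]_x V x)%:E.
Proof. by move=> h; rewrite /mV itgE. Qed.

(** The negative part of [ln rho] always has [mu]-integral at most [1], because [- u ln u <= 1 - u].
    Hence an integral below [+oo] bounds the positive part too. *)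
Lemma ln_density_itg rho : is_density mu G rho ->
  (\int[mu]_x (ln (rho x))%:E < +oo)%E ->
  mu.-integrable setT (EFin \o (fun x => ln (rho x))).
Proof.
move=> dr hlt; have [mr r0 _] := dr.
have ml : measurable_fun setT (EFin \o (fun x => ln (rho x))).
  by apply/measurable_EFinP; apply: measurableT_comp => //; exact: measurable_ln.
have neg : (\int[mu]_x (EFin \o (fun x => ln (rho x)))^\- x <= 1)%E.
  rewrite (ge0_integral_density dr)//; last exact: measurable_funeneg.
  apply: (@le_trans _ _ (\int[G]_x 1)%E); last first.
    by rewrite integral_cst//= mul1e (@probability_setT _ _ _ G).
  apply: ge0_integral_mono => x; first by rewrite mule_ge0// lee_fin.
  rewrite funenegE /= -EFin_max -EFinM lee_fin.
  have := xlnx_ge (r0 x); have := r0 x.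
  by have [h|h] := leP (- ln (rho x)) 0; rewrite ?mul0r//; lra.
have pos : (\int[mu]_x (EFin \o (fun x => ln (rho x)))^\+ x < +oo)%E.
  rewrite ltNge leye_eq; apply/negP => /eqP E.
  have nf : (\int[mu]_x (EFin \o (fun x => ln (rho x)))^\- x)%E \is a fin_num.
    rewrite ge0_fin_numE; last exact: integral_ge0.
    exact: le_lt_trans neg (ltry _).
  have : (\int[mu]_x (EFin \o (fun x => ln (rho x))) x = +oo)%E.
    by rewrite integralE E -(fineK nf) -EFinN addye.
  by move=> E'; move: hlt; rewrite [X in (X < _)%E]E'.
apply/integrableP; split => //.
rewrite -[X in (integral _ _ X)]/(abse \o (EFin \o (fun x => ln (rho x)))) fune_abse.
rewrite ge0_integralD//; [|exact: measurable_funepos|exact: measurable_funeneg].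
by apply: lte_add_pinfty => //; exact: le_lt_trans neg (ltry _).
Qed.

Lemma rate_fin : (rate_IV V Rad b mu < +oo)%E -> exists rho,
  [/\ is_density mu G rho,
      G.-integrable setT (EFin \o (fun x => rho x * ln (rho x))),
      mu.-integrable setT (EFin \o V),
      \int[mu]_x V x <= Rad &
      rate_IV V Rad b mu = (\int[G]_x (rho x * ln (rho x)) + b * (\int[mu]_x V x - Rad))%:E].
Proof.
rewrite /rate_IV; case: ifP => // mR.
have iV := mV_fin (le_lt_trans mR (ltry _)).
rewrite mVE// in mR *; rewrite lee_fin in mR; rewrite -EFinB -EFinM.
rewrite /rel_entropy; case: asboolP => [ac|_]; last by rewrite addye.
rewrite -GE in ac *.
have ex : exists f, is_density mu G f by apply: density_exists => A; exact: ac.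
have dr : is_density mu G (RN_deriv mu G) by exact: (xgetPex _ ex).
move=> h; have hlt : (\int[mu]_x (ln (RN_deriv mu G x))%:E < +oo)%E.
  by rewrite ltNge leye_eq; apply/negP => /eqP E; move: h; rewrite E addye.
have il := ln_density_itg dr hlt.
exists (RN_deriv mu G); split => //.
- by apply/(density_itg dr) => //; exact: itg_meas il.
- by rewrite itgE// EFinD (density_int dr).
Qed.

(** The entropy is defined through one chosen density; almost everywhere uniqueness allows any other
    one in its place. *)
Lemma rate_val rho : is_density mu G rho ->
  G.-integrable setT (EFin \o (fun x => rho x * ln (rho x))) ->
  mu.-integrable setT (EFin \o V) -> \int[mu]_x V x <= Rad ->
  rate_IV V Rad b mu = (\int[G]_x (rho x * ln (rho x)) + b * (\int[mu]_x V x - Rad))%:E.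
Proof.
move=> dr ir iV VR; rewrite /rate_IV mVE// lee_fin VR -EFinB -EFinM.
have ac : abs_cont mu G.
  move=> A mA GA; have := density_dominates dr; move/(_ A); apply => // B mB BA.
  by apply/eqP; rewrite eq_le measure_ge0 andbT -[leRHS]GA le_measure ?inE.
rewrite /rel_entropy -GE asboolT//.
have ex : exists f, is_density mu G f by exists rho.
have dr' : is_density mu G (RN_deriv mu G) by exact: (xgetPex _ ex).
set r' := RN_deriv mu G in dr' *.
have [mr _ _] := dr; have [mr' _ _] := dr'.
have ml : measurable_fun setT (fun x => ln (r' x)).
  by apply: measurableT_comp => //; exact: measurable_ln.
have rr' : {ae G, forall x, rho x * ln (rho x) = r' x * ln (r' x)}.
  by apply: filterS (density_unique dr dr') => x ->.
have ir' : G.-integrable setT (EFin \o (fun x => r' x * ln (r' x))).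
  by apply: ae_itg ir => //; exact: measurable_xlnx.
have il : mu.-integrable setT (EFin \o (fun x => ln (r' x))).
  exact/(density_itg dr').
by rewrite itgE// -EFinD (density_int dr')// (ae_int _ _ rr')//; exact: measurable_xlnx.
Qed.

Lemma gibbs_to_lebesgue_density rho : is_density mu G rho ->
  is_density mu leb (fun x => rho x * (expR (b * V x) / Z b)).
Proof.
move=> [mr r0 rP]; have Z0 := partition_gt0 oV b0.
have dG : is_density G leb (fun x => expR (b * V x) / Z b) by rewrite GE; exact: gibbs_density.
have [mg g0 _] := dG.
apply/lebesgue_densityP; split.
- exact: measurable_funM.
- by move=> x; rewrite mulr_ge0.
- move=> A mA; rewrite rP// integral_mkcond.
  rewrite (lebesgue_ge0_integral_density dG)//; last 2 first.
  + by apply/(measurable_restrict _ _ _) => //; apply/measurable_funTS; exact/measurable_EFinP.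
  + by move=> x; rewrite patchE; case: ifP => // _; rewrite lee_fin.
  rewrite [RHS]integral_mkcond; apply: eq_integral => x _.
  by rewrite !patchE; case: ifP => // _; rewrite ?mul0e// EFinM.
Qed.

Lemma lebesgue_to_gibbs_density p : is_density mu leb p ->
  is_density mu G (fun x => p x * (Z b * expR (- b * V x))).
Proof.
move=> /lebesgue_densityP[mp p0 pP]; have Z0 := partition_gt0 oV b0.
have dG : is_density G leb (fun x => expR (b * V x) / Z b) by rewrite GE; exact: gibbs_density.
have mq : measurable_fun setT (fun x => p x * (Z b * expR (- b * V x))).
  by apply: measurable_funM => //; apply: measurable_funM => //; exact: measurable_expRV.
have q0 x : 0 <= p x * (Z b * expR (- b * V x)).
  by rewrite !mulr_ge0 ?expR_ge0// ltW.
split => // A mA; rewrite pP// [RHS]integral_mkcond.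
rewrite (lebesgue_ge0_integral_density dG)//; last 2 first.
- by apply/(measurable_restrict _ _ _) => //; apply/measurable_funTS; exact/measurable_EFinP.
- by move=> x; rewrite patchE; case: ifP => // _; rewrite lee_fin.
rewrite [LHS]integral_mkcond; apply: eq_integral => x _.
rewrite !patchE; case: ifP => // _; rewrite ?mul0e// -EFinM; congr EFin.
by rewrite mulNr expRN; field; rewrite !gt_eqF// expR_gt0.
Qed.

(** Where [rho > 0], [ln p = ln rho + b V - ln (Z b)]; where [rho = 0], both entropy integrands
    vanish. The difference is integrable by the finite moment. *)
Lemma entropy_shift rho : is_density mu G rho ->
  mu.-integrable setT (EFin \o V) ->
  let p x := rho x * (expR (b * V x) / Z b) in
  (G.-integrable setT (EFin \o (fun x => rho x * ln (rho x))) <->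
   itg (fun x => p x * ln (p x))) /\
  (G.-integrable setT (EFin \o (fun x => rho x * ln (rho x))) ->
   \int[leb]_x (p x * ln (p x)) =
   \int[G]_x (rho x * ln (rho x)) + b * (\int[mu]_x V x) - ln (Z b)).
Proof.
move=> dr iV p; have Z0 := partition_gt0 oV b0.
have dG : is_density G leb (fun x => expR (b * V x) / Z b) by rewrite GE; exact: gibbs_density.
have dp : is_density mu leb p := gibbs_to_lebesgue_density dr.
have [mr r0 _] := dr; have [mp p0 _] := dp.
have [ip p1] := lebesgue_density_int1 dp.
have ipV : itg (fun x => p x * V x).
  by apply/(lebesgue_density_itg dp) => //; exact: orlicz_measurable.
pose k x := expR (b * V x) / Z b * (rho x * ln (rho x)).
have mrl : measurable_fun setT (fun x => rho x * ln (rho x)) by exact: measurable_xlnx.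
have kE x : p x * ln (p x) = k x + (b * (p x * V x) - ln (Z b) * p x).
  have := r0 x; rewrite /k /p le_eqVlt => /predU1P[<-|rx]; first by ring.
  rewrite lnM ?posrE//; last by rewrite divr_gt0 ?expR_gt0.
  rewrite ln_div ?posrE ?expR_gt0// expRK; ring.
have il : itg (fun x => b * (p x * V x) - ln (Z b) * p x).
  by apply: itgB; exact: itgZ.
split; last first.
  move=> ir; have ik : itg k by apply/(lebesgue_density_itg dG).
  rewrite (lebesgue_density_int dG ir) (lebesgue_density_int dp iV).
  have -> : (fun x => p x * ln (p x)) = (fun x => k x + (b * (p x * V x) - ln (Z b) * p x)).
    by apply/funext.
  by rewrite intD// intB ?intZ//; [rewrite p1; ring|exact: itgZ|exact: itgZ].
split => [ir|ir].
  have ik : itg k by apply/(lebesgue_density_itg dG).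
  have -> : (fun x => p x * ln (p x)) = (fun x => k x + (b * (p x * V x) - ln (Z b) * p x)).
    by apply/funext.
  exact: itgD.
apply/(lebesgue_density_itg dG) => //.
have -> : (fun x => expR (b * V x) / Z b * (rho x * ln (rho x))) =
  (fun x => p x * ln (p x) - (b * (p x * V x) - ln (Z b) * p x)).
  by apply/funext => x; rewrite kE /k; ring.
exact: itgB.
Qed.

(** In this form [b] enters only through an additive constant, so the rates for two exponents can be
    compared when uniqueness is proved. *)
Lemma rate_fin_lebesgue : (rate_IV V Rad b mu < +oo)%E -> exists p,
  [/\ is_density mu leb p, itg (fun x => p x * ln (p x)),
      mu.-integrable setT (EFin \o V), \int[mu]_x V x <= Rad &
      rate_IV V Rad b mu = (\int[leb]_x (p x * ln (p x)) + free_energy V Rad b)%:E].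
Proof.
move=> /rate_fin[rho [dr ir iV VR ->]].
have [h1 h2] := entropy_shift dr iV.
exists (fun x => rho x * (expR (b * V x) / Z b)); split => //.
- exact: gibbs_to_lebesgue_density.
- exact/h1.
- by rewrite h2// /free_energy; congr EFin; ring.
Qed.

Lemma rate_val_lebesgue p : is_density mu leb p -> itg (fun x => p x * ln (p x)) ->
  mu.-integrable setT (EFin \o V) -> \int[mu]_x V x <= Rad ->
  rate_IV V Rad b mu = (\int[leb]_x (p x * ln (p x)) + free_energy V Rad b)%:E.
Proof.
move=> dp ip iV VR; have Z0 := partition_gt0 oV b0.
have dr := lebesgue_to_gibbs_density dp.
have [h1 h2] := entropy_shift dr iV.
have pE : (fun x => p x * (Z b * expR (- b * V x)) * (expR (b * V x) / Z b)) = p.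
  by apply/funext => x; rewrite mulNr expRN; field; rewrite !gt_eqF// expR_gt0.
have pE' : (fun x => (p x * (Z b * expR (- b * V x)) * (expR (b * V x) / Z b)) *
   ln (p x * (Z b * expR (- b * V x)) * (expR (b * V x) / Z b))) = (fun x => p x * ln (p x)).
  by apply/funext => x; have := congr1 (@^~ x) pE => /= ->.
rewrite pE' in h1 h2; have ir := (h1.2 ip).
by rewrite (rate_val dr ir)// h2// /free_energy; congr EFin; ring.
Qed.

End rate_formula.

(** * Ultralimits of probability measures *)

Definition ulim (R : realType) T (F : set_system T) (h : T -> R) (l : R) :=
  forall e : R, 0 < e -> F [set t | `|h t - l| < e].

Section ultralimits.
Context (R : realType) (T : Type) (F : set_system T) (UF : UltraFilter F).
Implicit Types (h : T -> R) (l : R).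

(** The limit is the supremum of the levels that [h] exceeds on a set of the ultrafilter; for a
    level above it, the complementary set belongs to [F]. *)
Lemma ulim_exists h M : (forall t, `|h t| <= M) -> exists l, ulim F h l.
Proof.
move=> hM; pose S := [set r | F [set t | r <= h t]].
have SM : S (- M).
  by apply: filterS filterT => t _ /=; move: (hM t); rewrite ler_norml => /andP[].
have ubS : ubound S M.
  move=> r /filter_ex[t /= rt]; apply: le_trans rt _.
  by move: (hM t); rewrite ler_norml => /andP[].
have hs : has_sup S by split; [exists (- M)|exists M].
exists (sup S) => e e0.
have [r Sr rl] := sup_adherent e0 hs.
have [h1|h2] := in_ultra_setVsetC [set t | sup S + e <= h t] UF.
  have : sup S + e <= sup S by apply: (ub_le_sup hs.2).
  by lra.
apply: filterS (filterI Sr h2) => t /= [rt /negP]; rewrite -ltNge => th.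
by rewrite ltr_norml; apply/andP; split; lra.
Qed.

Lemma ulim_le h1 h2 l1 l2 : F [set t | h1 t <= h2 t] ->
  ulim F h1 l1 -> ulim F h2 l2 -> l1 <= l2.
Proof.
move=> h12 u1 u2; apply/ler_addgt0Pr => e e0.
have e2 : 0 < e / 2 by lra.
have [t /= [[ht]]] := filter_ex (filterI (filterI h12 (u1 _ e2)) (u2 _ e2)).
by move: ht => /=; rewrite !ltr_norml => ht /andP[? ?] /andP[? ?]; lra.
Qed.

Lemma ulim_cst l : ulim F (fun=> l) l.
Proof. by move=> e e0; apply: filterS filterT => t _ /=; rewrite subrr normr0. Qed.

Lemma ulim_unique h l1 l2 : ulim F h l1 -> ulim F h l2 -> l1 = l2.
Proof.
move=> u1 u2; apply/eqP; rewrite eq_le.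
by rewrite !(ulim_le _ u1 u2, ulim_le _ u2 u1)//; apply: filterS filterT => t _ /=.
Qed.

Lemma ulimD h1 h2 l1 l2 : ulim F h1 l1 -> ulim F h2 l2 ->
  ulim F (fun t => h1 t + h2 t) (l1 + l2).
Proof.
move=> u1 u2 e e0; have e2 : 0 < e / 2 by lra.
apply: filterS (filterI (u1 _ e2) (u2 _ e2)) => t /= [].
by rewrite !ltr_norml => /andP[? ?] /andP[? ?]; apply/andP; split; lra.
Qed.

Lemma ulimZ k h l : ulim F h l -> ulim F (fun t => k * h t) (k * l).
Proof.
move=> u e e0; have k0 : 0 < `|k| + 1 by rewrite ltr_wpDl.
apply: filterS (u _ (divr_gt0 e0 k0)) => t /=; rewrite -mulrBr normrM.
rewrite ltr_pdivlMr// => h1; apply: le_lt_trans h1; rewrite mulrC ler_wpM2l// lerDl//.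
Qed.

Lemma ulim_sum m (h : 'I_m -> T -> R) (l : 'I_m -> R) : (forall i, ulim F (h i) (l i)) ->
  ulim F (fun t => \sum_i h i t) (\sum_i l i).
Proof.
move=> u; elim: m h l u => [|m IH] h l u.
  rewrite big_ord0; have -> : (fun t => \sum_(i < 0) h i t) = (fun=> 0).
    by apply/funext => t; rewrite big_ord0.
  exact: ulim_cst.
rewrite big_ord_recr; have -> : (fun t => \sum_(i < m.+1) h i t) =
    (fun t => \sum_(i < m) h (widen_ord (leqnSn m) i) t + h ord_max t).
  by apply/funext => t; rewrite big_ord_recr.
by apply: ulimD => //; exact: IH.
Qed.

End ultralimits.

(** * Uniform approximation of bounded measurable functions by step functions *)

Section staircase.
Context (R : realType).

(** The sum is the minimum of [K] and the integer part of [z], written with indicators so that it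
    becomes a step function when [z] is a multiple of [g x]. *)
Lemma staircaseP (z : R) K : 0 <= z ->
  let S := \sum_(j < K) (j.+1%:R <= z)%R%:R : R in
  [/\ S <= z, S <= K%:R & (z - 1 <= S) || (S == K%:R)].
Proof.
move=> z0; elim: K => [|K /= [IH1 IH2 IH3]] /=.
  by rewrite big_ord0 z0 lexx eqxx orbT.
rewrite big_ord_recr /=; set S := \sum_(j < K) _ in IH1 IH2 IH3 *.
have K1 : K.+1%:R = K%:R + 1 :> R by rewrite -natr1.
rewrite K1; have [zK|zK] := leP (K%:R + 1) z; rewrite ?addr0 /=.
  have SK : S = K%:R.
    by case/orP : IH3 => [h|/eqP//]; apply/eqP; rewrite eq_le IH2/=; lra.
  by rewrite SK eqxx orbT zK lexx.
split => //; first by lra.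
by apply/orP; left; case/orP : IH3 => [//|/eqP ->]; lra.
Qed.

Lemma staircase_approx (g : R -> R) (M : R) : measurable_fun setT g ->
  (forall x, 0 <= g x <= M) -> forall e : R, 0 < e ->
  exists (k : R) (m : nat) (A : 'I_m -> set R),
    [/\ forall j, measurable (A j) &
        forall x, `|g x - \sum_j k * \1_(A j) x| <= e].
Proof.
move=> mg gM e e0.
pose N := (Num.truncn e^-1).+1.
have N0 : 0 < N%:R :> R by rewrite ltr0n.
have Ne : N%:R^-1 <= e.
  by rewrite invf_ple ?posrE// ltW// truncnS_gt.
(* There are more steps than [N g] can reach, so the staircase never saturates below [N g]. *)
pose m := (Num.truncn (N%:R * M)).+1.
have mM : N%:R * M < m%:R by rewrite truncnS_gt.
exists N%:R^-1, m, (fun j => [set x | j.+1%:R <= N%:R * g x]); split.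
  move=> j; rewrite -[X in measurable X]setTI.
  have mNg : measurable_fun setT (fun x => N%:R * g x) by exact: measurable_funM.
  have := mNg measurableT `[j.+1%:R, +oo[%classic (measurable_itv _).
  rewrite (_ : _ @^-1` _ = [set x | j.+1%:R <= N%:R * g x])//.
  by apply/seteqP; split => x /=; rewrite in_itv/= andbT.
move=> x; have /andP[g0 gx] := gM x.
have z0 : 0 <= N%:R * g x by rewrite mulr_ge0.
have [] := staircaseP m z0; set S := \sum_(j < m) _ => S1 S2 S3.
have -> : \sum_(j < m) N%:R^-1 * \1_[set x | j.+1%:R <= N%:R * g x] x = N%:R^-1 * S.
  rewrite -mulr_sumr; congr (_ * _); apply: eq_bigr => j _; rewrite indicE.
  by congr ((nat_of_bool _)%:R); apply/idP/idP => [/set_mem//|/mem_set].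
have -> : g x - N%:R^-1 * S = N%:R^-1 * (N%:R * g x - S).
  by field; rewrite gt_eqF.
have N0' : 0 <= N%:R^-1 :> R by rewrite invr_ge0.
rewrite normrM (ger0_norm N0').
apply: le_trans Ne; rewrite -[leRHS]mulr1; apply: ler_wpM2l => //.
rewrite ler_norml; apply/andP; split; first lra.
case/orP : S3 => [|/eqP]; first lra.
by move=> E; have := ler_wpM2l (ltW N0) gx; lra.
Qed.

End staircase.

Lemma limn_esup_le_near (R : realType) (u : nat -> \bar R) (C : \bar R) :
  (\forall n \near \oo, u n <= C)%E -> (limn_esup u <= C)%E.
Proof.
move=> uC; rewrite /limn_esup /limf_esup.
apply: (@le_trans _ _ (ereal_sup (u @` [set n | (u n <= C)%E]))).
  by apply: ereal_inf_lbound; exists [set n | (u n <= C)%E].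
by apply: ge_ereal_sup => _ [n /= nC <-].
Qed.

Lemma limn_einf_ge_near (R : realType) (u : nat -> \bar R) (C : \bar R) :
  (\forall n \near \oo, C <= u n)%E -> (C <= limn_einf u)%E.
Proof.
move=> uC; rewrite /limn_einf leeNr; apply: limn_esup_le_near.
by apply: filterS uC => n /= h; rewrite leeN2.
Qed.

Section fatou_bound.
Context d (T : measurableType d) (R : realType) (mu : {measure set T -> \bar R}).

Lemma fatou_le (f_ : nat -> T -> R) (f : T -> R) (C : R) :
  (forall n, measurable_fun setT (f_ n)) -> (forall n x, 0 <= f_ n x) ->
  (forall x, f_ n x @[n --> \oo] --> f x) ->
  (forall n, \int[mu]_x (f_ n x)%:E <= C%:E)%E ->
  (\int[mu]_x (f x)%:E <= C%:E)%E.
Proof.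
move=> mf f0 cf fC.
have := @fatou _ _ _ mu setT measurableT (fun n x => (f_ n x)%:E)
  (fun n => (measurable_EFinP _ _).2 (mf n)) (fun n x _ => f0 n x).
have -> : (\int[mu]_x limn_einf (fun n => (f_ n x)%:E) = \int[mu]_x (f x)%:E)%E.
  apply: eq_integral => x _.
  have : (f_ n x)%:E @[n --> \oo] --> (f x)%:E by apply: cvg_EFin; [exact: nearW|exact: cf].
  by move=> /cvg_limn_einf_sup[].
move=> /le_trans; apply.
have := limn_einf_sup (fun n => \int[mu]_x (f_ n x)%:E)%E.
move=> /le_trans; apply.
by apply: limn_esup_le_near; exists 0%N => // n _; exact: fC.
Qed.

End fatou_bound.

Section probability_integrals.
Context (R : realType) (P : M1 R).

Lemma prob_fine A : measurable A -> P A = (fine (P A))%:E.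
Proof. by move=> mA; rewrite fineK// fin_num_measure. Qed.

Lemma prob_fine_ge0 A : 0 <= fine (P A).
Proof. exact/fine_ge0/measure_ge0. Qed.

Lemma prob_fine_le1 A : measurable A -> fine (P A) <= 1.
Proof. by move=> mA; rewrite -lee_fin -prob_fine// probability_le1. Qed.

Lemma prob_itg_cst (k : R) : P.-integrable setT (EFin \o (fun=> k)).
Proof. by apply: fin_measure_itg_cst; rewrite /= (@probability_setT _ _ _ P) ltry. Qed.

Lemma prob_itg (g : R -> R) (M : R) : measurable_fun setT g ->
  (forall x, `|g x| <= M) -> P.-integrable setT (EFin \o g).
Proof.
by move=> mg gM; apply: (itg_le (g := fun=> M) mg) => //; exact: prob_itg_cst.
Qed.

Lemma prob_int_cst (k : R) : \int[P]_x k = k.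
Proof. by rewrite Rintegral_cst//= (@probability_setT _ _ _ P) mulr1. Qed.

Lemma prob_int_indic A : measurable A -> \int[P]_x \1_A x = fine (P A).
Proof. by move=> mA; rewrite /Rintegral integral_indic// setIT. Qed.

Lemma prob_itg_indic A : measurable A -> P.-integrable setT (EFin \o \1_A).
Proof. by move=> mA; exact: integrable_indic. Qed.

Lemma prob_int_bound (g : R -> R) (M : R) : measurable_fun setT g ->
  (forall x, `|g x| <= M) -> `|\int[P]_x g x| <= M.
Proof.
move=> mg gM; apply: le_trans (le_normr_Rintegral _ _) _ => //; first exact: prob_itg gM.
rewrite -[leRHS]prob_int_cst; apply: int_le => //.
- by apply: integrable_norm => //; exact: prob_itg gM.
- exact: prob_itg_cst.
Qed.

Lemma prob_int_diff (g h : R -> R) (e : R) :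
  P.-integrable setT (EFin \o g) -> P.-integrable setT (EFin \o h) ->
  (forall x, `|g x - h x| <= e) -> `|\int[P]_x g x - \int[P]_x h x| <= e.
Proof.
move=> ig ih gh; rewrite -intB//; apply: prob_int_bound => //.
exact: (measurable_funB (itg_meas ig) (itg_meas ih)).
Qed.

Lemma prob_tail (B : nat -> set R) n : (forall i, measurable (B i)) ->
  trivIset setT B ->
  fine (P ((\bigcup_i B i) `\` \big[setU/set0]_(i < n) B i)) =
  fine (P (\bigcup_i B i)) - \sum_(i < n) fine (P (B i)).
Proof.
move=> mB tB; have mU : measurable (\bigcup_i B i) by exact: bigcupT_measurable.
have mS : measurable (\big[setU/set0]_(i < n) B i) by exact: bigsetU_measurable.
rewrite measureD//; last by rewrite (le_lt_trans (probability_le1 _ _))// ltry.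
rewrite setIidr; last first.
  by rewrite -bigcup_mkord => x [i _ Bi]; exists i.
rewrite fineB ?fin_num_measure//; congr (_ - _).
rewrite measure_bigsetU//.
rewrite (eq_bigr (fun i : 'I_n => (fine (P (B i)))%:E)); last by move=> i _; exact: prob_fine.
by rewrite sumEFin.
Qed.

End probability_integrals.

Section limit_measure.
Context (R : realType) (G : M1 R) (c : R) (F : set_system (M1 R)).
Hypothesis UF : UltraFilter F.
(** The dual inequality for [g = t 1_A] and [s = 0]. With [t] large it forces the limit of [mu A] to
    be small as soon as [G A] is small. *)
Hypothesis HF : forall A (t : R), measurable A -> 0 <= t ->
  F [set mu | t * fine (mu A) <= c + (expR t - 1) * fine (G A)].

Lemma limit_setfun : exists l : set R -> R, forall A, measurable A ->
  ulim F (fun mu : M1 R => fine (mu A)) (l A).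
Proof.
have : forall A : set R, exists l : R, measurable A -> ulim F (fun mu : M1 R => fine (mu A)) l.
  move=> A; have [mA|nA] := pselect (measurable A); last by exists 0.
  have [|l hl] := @ulim_exists R (M1 R) F UF (fun mu => if pselect (measurable A) then fine (mu A) else 0) 1.
    by move=> mu; case: pselect => //= _; rewrite ger0_norm ?prob_fine_ge0// prob_fine_le1.
  exists l => _; move: hl; case: pselect => // _; exact.
by move=> H; have [l hl] := choice H; exists l.
Qed.

(* Countable additivity comes from the uniform exponential bound [HF]. *)
Lemma limit_measure : exists P : M1 R,
  (forall A, measurable A -> ulim F (fun mu : M1 R => fine (mu A)) (fine (P A))) /\
  abs_cont P G.
Proof.
have [l hl] := limit_setfun.
have l0 A : measurable A -> 0 <= l A.
  move=> mA; apply: (ulim_le UF _ (ulim_cst UF 0) (hl A mA)).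
  by apply: filterS filterT => mu _ /=; exact: prob_fine_ge0.
have lb A t : measurable A -> 0 <= t -> t * l A <= c + (expR t - 1) * fine (G A).
  move=> mA t0; apply: (ulim_le UF (HF mA t0) _ (ulim_cst UF _)).
  by apply: ulimZ => //; exact: hl.
(* Nothing is known of [l] on nonmeasurable sets, and a measure has to be nonnegative on all
   sets. *)
pose m (A : set R) := if `[< measurable A >] then (l A)%:E else 0%E.
have mE A : measurable A -> m A = (l A)%:E by move=> mA; rewrite /m asboolT.
have m0 : m set0 = 0%E.
  rewrite mE//; congr EFin; apply: (ulim_unique UF (hl set0 measurable0)).
  have -> : (fun mu : M1 R => fine (mu set0)) = (fun=> 0).
    by apply/funext => mu; rewrite measure0.
  exact: ulim_cst.
have m1 : m setT = 1%E.
  rewrite mE//; congr EFin; apply: (ulim_unique UF (hl setT measurableT)).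
  have -> : (fun mu : M1 R => fine (mu setT)) = (fun=> 1).
    by apply/funext => mu; rewrite probability_setT.
  exact: ulim_cst.
have mge A : (0 <= m A)%E by rewrite /m; case: asboolP => // mA; rewrite lee_fin l0.
have msa : semi_sigma_additive m.
  move=> B mB tB mUB; rewrite mE//.
  have -> : (fun n => \sum_(0 <= i < n) m (B i))%E = (fun n => (\sum_(i < n) l (B i))%:E).
    apply/funext => n; rewrite big_mkord -sumEFin; apply: eq_bigr => i _.
    exact: mE.
  apply: cvg_EFin; first exact: nearW.
  apply/cvgrPdist_le => e e0.
  pose C n := (\bigcup_i B i) `\` \big[setU/set0]_(i < n) B i.
  have mC n : measurable (C n) by apply: measurableD => //; exact: bigsetU_measurable.
  have lC n : l (C n) = l (\bigcup_i B i) - \sum_(i < n) l (B i).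
    apply: (ulim_unique UF (hl _ (mC n))).
    have -> : (fun mu : M1 R => fine (mu (C n))) =
      (fun mu : M1 R => fine (mu (\bigcup_i B i)) + (-1) * \sum_(i < n) fine (mu (B i))).
      by apply/funext => mu; rewrite prob_tail// mulN1r.
    rewrite -[X in _ + X]mulN1r; apply: ulimD => //; first exact: hl.
    by apply: ulimZ => //; apply: ulim_sum => // i; exact: hl.
  (* Once [(exp t - 1) G (C n) <= 1], the exponential bound gives [t l (C n) <= |c| + 1 = t e / 2]
     for the tail [C n] of the union. *)
  pose t := 2 * (`|c| + 1) / e.
  have t0 : 0 < t by rewrite divr_gt0// mulr_gt0// ltr_wpDl.
  have et : 1 < expR t by rewrite expR_gt1.
  have dl0 : 0 < (expR t - 1)^-1 by rewrite invr_gt0 subr_gt0.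
  have GC : \forall n \near \oo, fine (G (C n)) <= (expR t - 1)^-1.
    have : (fun n => \sum_(0 <= i < n) G (B i))%E @ \oo --> G (\bigcup_n B n).
      exact: (@measure_semi_sigma_additive _ _ _ G B mB tB mUB).
    have -> : (fun n => \sum_(0 <= i < n) G (B i))%E = (fun n => (\sum_(i < n) fine (G (B i)))%:E).
      apply/funext => n; rewrite big_mkord -sumEFin; apply: eq_bigr => i _.
      exact: prob_fine.
    rewrite (prob_fine _ mUB) => /fine_cvg /= /cvgrPdist_le /(_ _ dl0).
    apply: filterS => n /=; rewrite /C prob_tail//.
    by apply: le_trans; exact: ler_norm.
  apply: filterS GC => n Gn; rewrite -lC ger0_norm ?l0//.
  have h := lb _ _ (mC n) (ltW t0).
  have h2 : (expR t - 1) * fine (G (C n)) <= 1.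
    by rewrite -ler_pdivlMl ?subr_gt0// mulr1.
  have h3 : t * l (C n) <= t * (e / 2).
    apply: le_trans h _; have -> : t * (e / 2) = `|c| + 1 by rewrite /t; field; rewrite gt_eqF.
    by have := ler_norm c; lra.
  by move: h3; rewrite ler_pM2l//; lra.
have [P PE] := probability_of m0 mge msa m1.
exists P; split => [A mA|A mA GA]; first by rewrite PE mE//; exact: hl.
rewrite PE mE//; congr EFin; apply/eqP; rewrite eq_le l0// andbT.
rewrite leNgt; apply/negP => lA.
(* When [G A = 0] the bound reads [t l A <= c] for every [t >= 0], which fails at this [t]. *)
have t0 : 0 <= (`|c| + 1) / l A by rewrite divr_ge0 ?addr_ge0// ltW.
have := lb _ _ mA t0; rewrite GA /= mulr0 addr0 divfK ?gt_eqF//.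
by have := ler_norm c; lra.
Qed.

(** A bounded [g], shifted to be nonnegative, is uniformly close to a step function, whose integral
    converges because the measures converge setwise. *)
Lemma ulim_integral (P : M1 R) (g : R -> R) (M : R) :
  (forall A, measurable A -> ulim F (fun mu : M1 R => fine (mu A)) (fine (P A))) ->
  measurable_fun setT g -> (forall x, `|g x| <= M) ->
  ulim F (fun mu : M1 R => \int[mu]_x g x) (\int[P]_x g x).
Proof.
move=> hP mg gM.
pose g' x := g x + M.
have mg' : measurable_fun setT g' by exact: measurable_funD.
have g'M x : 0 <= g' x <= M + M.
  by have := gM x; rewrite ler_norml /g' => /andP[? ?]; apply/andP; split; lra.
have g'M' x : `|g' x| <= M + M by have /andP[? ?] := g'M x; rewrite ger0_norm.
suff h : ulim F (fun mu : M1 R => \int[mu]_x g' x) (\int[P]_x g' x).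
  have E (mu : M1 R) : \int[mu]_x g' x = \int[mu]_x g x + M.
    by rewrite intD; [rewrite prob_int_cst|exact: prob_itg gM|exact: prob_itg_cst].
  move=> e e0; apply: filterS (h e e0) => mu /=; rewrite !E.
  by rewrite opprD addrACA subrr addr0.
move=> e e0; have e3 : 0 < e / 3 by lra.
have [k [m [A [mA gA]]]] := staircase_approx mg' g'M e3.
have iA (mu : M1 R) j : mu.-integrable setT (EFin \o (fun x => k * \1_(A j) x)).
  by apply: itgZ; exact: prob_itg_indic.
have sE (mu : M1 R) : \int[mu]_x (\sum_j k * \1_(A j) x) = \sum_j k * fine (mu (A j)).
  rewrite int_sum; last by move=> j; exact: iA.
  apply: eq_bigr => j _.
  by rewrite intZ ?prob_int_indic//; exact: prob_itg_indic.
have close (mu : M1 R) : `|\int[mu]_x g' x - \sum_j k * fine (mu (A j))| <= e / 3.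
  rewrite -sE; apply: prob_int_diff => //; first exact: prob_itg g'M'.
  by apply: itg_sum => j; exact: iA.
have u : ulim F (fun mu : M1 R => \sum_j k * fine (mu (A j))) (\sum_j k * fine (P (A j))).
  by apply: ulim_sum => // j; apply: ulimZ => //; exact: hP.
apply: filterS (u _ e3) => mu /=.
have := close mu; have := close P.
rewrite !ler_norml !ltr_norml => /andP[? ?] /andP[? ?] /andP[? ?].
by apply/andP; split; lra.
Qed.

End limit_measure.

(** * Duality and compactness *)

Lemma cvg_eventually (R : realType) (u : nat -> R) (l : R) :
  (exists N, forall n, (N <= n)%N -> u n = l) -> u n @[n --> \oo] --> l.
Proof.
by move=> [N hN]; apply: cvg_near_cst; exists N => // n /= /hN.
Qed.

(** The passage to the limit [s -> - a] from below, carried out at [s = - a - dl] with an error at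
    most [dl (1 - D)]. *)
Lemma le_affine_limit (R : realType) (a X Y D : R) : a < 0 -> D <= 0 ->
  (forall s, 0 <= s -> s < - a -> X <= Y + s * D) -> X <= Y - a * D.
Proof.
move=> a0 D0 h; apply/ler_addgt0Pr => e e0.
have D1 : 0 < 1 - D by lra.
have ed : 0 < e / (1 - D) by rewrite divr_gt0.
pose dl := Num.min (- a) (e / (1 - D)).
have dl0 : 0 < dl by rewrite lt_min ed andbT; lra.
have dla : dl <= - a by rewrite ge_min lexx.
have dle : dl <= e / (1 - D) by rewrite ge_min lexx orbT.
have hs : X <= Y + (- a - dl) * D by apply: h; lra.
have : dl * (1 - D) <= e by rewrite -ler_pdivlMr.
by nra.
Qed.

Section entropy_duality.
Context (R : realType) (V : R -> R) (Rad a : R) (G : M1 R).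
Hypothesis oV : orlicz_fun V.
Hypothesis a0 : a < 0.
Hypothesis GE : G = gibbs V a :> (set R -> \bar R).

Lemma gibbs_itg_expR (s : R) : s < - a ->
  G.-integrable setT (EFin \o (fun x => expR (s * V x))).
Proof.
move=> sa.
have dG : is_density G (@lebesgue_measure R) (fun x => expR (a * V x) / partition_fun V a).
  by rewrite GE; exact: gibbs_density.
apply/(lebesgue_density_itg dG); first exact: measurable_expRV.
have -> : (fun x => expR (a * V x) / partition_fun V a * expR (s * V x)) =
    (fun x => (partition_fun V a)^-1 * expR ((a + s) * V x)).
  by apply/funext => x; rewrite mulrDl expRD; ring.
by apply: itgZ; apply: itg_expRV => //; lra.
Qed.

Lemma gibbs_itg_expR_bounded (g : R -> R) (M s : R) : measurable_fun setT g ->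
  (forall x, g x <= M) -> s < - a ->
  G.-integrable setT (EFin \o (fun x => expR (g x + s * V x))).
Proof.
move=> mg gM sa; apply: (itg_le (g := fun x => expR M * expR (s * V x))).
- apply: measurableT_comp => //; apply: measurable_funD => //.
  by apply: measurable_funM => //; exact: orlicz_measurable.
- by apply: itgZ; exact: gibbs_itg_expR.
- by move=> x; rewrite ger0_norm ?expR_ge0// -expRD ler_expR lerD2r.
Qed.

Lemma truncV_cvg x : Num.min (V x) n%:R @[n --> \oo] --> V x.
Proof.
apply: cvg_eventually; exists (Num.truncn (V x)).+1 => n hn.
apply/min_idPl; apply: le_trans (ltW (truncnS_gt _)) _.
by rewrite ler_nat.
Qed.

Lemma measurable_truncV (k : R) : measurable_fun setT (fun x => Num.min (V x) k).
Proof.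
have mV := orlicz_measurable oV.
have h := measurable_minr mV (measurable_cst k); exact: h.
Qed.

Lemma truncV_ge0 x (n : nat) : 0 <= Num.min (V x) n%:R.
Proof. by rewrite le_min orlicz_ge0/=. Qed.

Lemma truncV_le x (k : R) : Num.min (V x) k <= V x.
Proof. by rewrite ge_min lexx. Qed.

(* The test functions are truncations of [ln (dm/dG) - s V], with [s] tending
   to [- a]. *)
Lemma rate_le_of_dual (m : M1 R) (c : R) : abs_cont m G ->
  m.-integrable setT (EFin \o V) -> \int[m]_x V x <= Rad ->
  (forall (g : R -> R) (M s : R), measurable_fun setT g ->
    (forall x, `|g x| <= M) -> 0 <= s -> s < - a ->
    \int[m]_x g x <= c + \int[G]_x (expR (g x + s * V x) - 1) - s * Rad) ->
  (rate_IV V Rad a m <= c%:E)%E.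
Proof.
move=> ac iV VR dual; have mV := orlicz_measurable oV.
pose D := \int[m]_x V x - Rad.
have D0 : D <= 0 by rewrite /D; lra.
(* The parameter [s] is eliminated: the inequality is used for [h - s min(V, n)], first [n] tends to
   infinity by dominated convergence under [m] and under [G], then [s] tends to [- a]. *)
have dualV (h : R -> R) (M : R) : measurable_fun setT h ->
    (forall x, `|h x| <= M) ->
    \int[m]_x h x <= c + \int[G]_x (expR (h x) - 1) - a * D.
  move=> mh hM.
  have hM' x : h x <= M by rewrite (le_trans (ler_norm _)).
  have ih := prob_itg m mh hM.
  apply: le_affine_limit => // s s0 sa.
  suff : \int[m]_x (h x - s * V x) <= c + \int[G]_x (expR (h x) - 1) - s * Rad.
    by rewrite intB//; [rewrite intZ// /D; lra|exact: itgZ].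
  pose g n x := h x - s * Num.min (V x) n%:R.
  have mg n : measurable_fun setT (g n).
    apply: measurable_funB => //; apply: measurable_funM => //.
    exact: measurable_truncV.
  have M0 : 0 <= M by apply: le_trans (hM 0).
  have gM n x : `|g n x| <= M + s * n%:R.
    rewrite /g (le_trans (ler_normB _ _))// lerD//.
    by rewrite ger0_norm ?mulr_ge0 ?truncV_ge0// ler_wpM2l// ge_min lexx orbT.
  have sn n : 0 <= s * n%:R by rewrite mulr_ge0.
  have cg x : g n x @[n --> \oo] --> h x - s * V x.
    by apply: cvgB; [exact: cvg_cst|apply: cvgM; [exact: cvg_cst|exact: truncV_cvg]].
  have [_ L] : m.-integrable setT (EFin \o (fun x => h x - s * V x)) /\
      \int[m]_x g n x @[n --> \oo] --> \int[m]_x (h x - s * V x).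
    apply: (int_dct mg _ cg (g := fun x => M + s * V x)).
    - by apply: measurable_funB => //; exact: measurable_funM.
    - by apply: itgD; [exact: prob_itg_cst|exact: itgZ].
    - move=> n x; rewrite /g (le_trans (ler_normB _ _))// lerD//.
      by rewrite ger0_norm ?mulr_ge0 ?truncV_ge0// ler_wpM2l// truncV_le.
  have mE n : measurable_fun setT (fun x => expR (g n x + s * V x) - 1).
    apply: measurable_funB => //; apply: measurableT_comp => //.
    by apply: measurable_funD => //; exact: measurable_funM.
  have [_ L'] : G.-integrable setT (EFin \o (fun x => expR (h x) - 1)) /\
      \int[G]_x (expR (g n x + s * V x) - 1) @[n --> \oo] --> \int[G]_x (expR (h x) - 1).
    apply: (int_dct mE _ _ (g := fun x => expR M * expR (s * V x) + 1)).
    - by apply: measurable_funB => //; apply: measurableT_comp.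
    - move=> x; apply: cvgB; last exact: cvg_cst.
      apply: (@cvg_comp _ _ _ (fun n => g n x + s * V x) expR _ (nbhs (h x))); last exact: continuous_expR.
      have -> : h x = h x - s * V x + s * V x by ring.
      by apply: cvgD; [exact: cg|exact: cvg_cst].
    - by apply: itgD; [apply: itgZ; exact: gibbs_itg_expR|exact: prob_itg_cst].
    - move=> n x; rewrite (le_trans (ler_normB _ _))// normr1 lerD2r.
      rewrite ger0_norm ?expR_ge0// -expRD ler_expR lerD2r /g.
      by have := truncV_ge0 x n; have := hM' x; nra.
  have L2 : c + \int[G]_x (expR (g n x + s * V x) - 1) - s * Rad @[n --> \oo] -->
      c + \int[G]_x (expR (h x) - 1) - s * Rad.
    by apply: cvgB; [apply: cvgD => //; exact: cvg_cst|exact: cvg_cst].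
  apply: (ler_cvg_to L L2); apply: nearW => n.
  exact: (dual _ _ _ (mg n) (gM n) s0 sa).
have [rho dr] : exists f, is_density m G f by apply: density_exists => A; exact: ac.
have [mr r0 _] := dr.
have [ir r1] : G.-integrable setT (EFin \o rho) /\ \int[G]_x rho x = 1.
  by split; [exact: density_itg1 dr|exact: density_int1 dr].
pose kp (n : nat) : R := n.+1%:R.
have kp1 n : 1 <= kp n by rewrite /kp ler1n.
have kp0 n : 0 < kp n by rewrite ltr0n.
have kpV n : (kp n)^-1 <= 1 by rewrite invf_le1.
(* Clamping the density between [1 / (n + 1)] and [n + 1] makes [ln (rk n)] a bounded test
   function. *)
pose rk n x := Num.max (Num.min (rho x) (kp n)) (kp n)^-1.
have rk_ge n x : (kp n)^-1 <= rk n x by rewrite le_max lexx orbT.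
have rk_gt0 n x : 0 < rk n x by rewrite (lt_le_trans _ (rk_ge n x))// invr_gt0.
have rk_le n x : rk n x <= kp n.
  by rewrite ge_max ge_min lexx orbT/= (le_trans (kpV n)).
have mrk n : measurable_fun setT (rk n).
  have h1 := measurable_minr mr (measurable_cst (kp n)).
  have h2 := measurable_maxr h1 (measurable_cst ((kp n)^-1)); exact: h2.
have mlk n : measurable_fun setT (fun x => ln (rk n x)).
  by apply: measurableT_comp => //; exact: measurable_ln.
have lkM n x : `|ln (rk n x)| <= ln (kp n).
  rewrite ler_norml -lnV ?posrE// !ler_ln ?posrE ?invr_gt0//.
  by rewrite rk_ge rk_le.
(* The dual inequality at [ln (rk n)] says that [q n] has [G]-integral at most [c - a D]. It equals
   [(rho - rk) ln rk + (rk ln rk - rk + 1)], where both terms are nonnegative since clamping moves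
   values only towards [1]; so Fatou's lemma applies. *)
pose q n x := rho x * ln (rk n x) - rk n x + 1.
have q0 n x : 0 <= q n x.
  have h := xlnx_ge (ltW (rk_gt0 n x)).
  suff : 0 <= (rho x - rk n x) * ln (rk n x) by rewrite /q; nra.
  rewrite /rk; have [h1|h1] := leP (rho x) (kp n).
    have [h2|h2] := leP (rho x) (kp n)^-1; last by rewrite subrr mul0r.
    by rewrite mulr_le0// ?subr_le0// ln_le0.
  have [h2|h2] := leP (kp n) (kp n)^-1.
    rewrite mulr_ge0 ?subr_ge0//; first by rewrite (le_trans (kpV n))// (le_trans (kp1 n))// ltW.
    by rewrite ln_ge0// (le_trans (kp1 n)).
  by apply: mulr_ge0; [rewrite subr_ge0 ltW|exact: ln_ge0].
have mq n : measurable_fun setT (q n).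
  apply: measurable_funD => //; apply: measurable_funB => //.
  exact: measurable_funM.
have iq n : G.-integrable setT (EFin \o q n).
  apply: itgD; last exact: prob_itg_cst.
  apply: itgB.
    apply: (itg_le (g := fun x => ln (kp n) * rho x)).
    - exact: measurable_funM.
    - exact: itgZ.
    - by move=> x; rewrite normrM (ger0_norm (r0 x)) mulrC ler_wpM2r.
  apply: (prob_itg G (M := kp n) (mrk n)) => x.
  by rewrite ger0_norm ?rk_le// ltW.
have qC n : (\int[G]_x (q n x)%:E <= (c - a * D)%:E)%E.
  rewrite itgE// lee_fin.
  have ilk : G.-integrable setT (EFin \o (fun x => rho x * ln (rk n x))).
    by apply/(density_itg dr) => //; exact: prob_itg (lkM n).
  have irk : G.-integrable setT (EFin \o rk n).
    apply: (prob_itg G (M := kp n) (mrk n)) => x.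
    by rewrite ger0_norm ?rk_le// ltW.
  have := dualV _ _ (mlk n) (lkM n).
  rewrite (density_int dr); last exact: prob_itg (lkM n).
  have -> : (fun x => expR (ln (rk n x)) - 1) = (fun x => rk n x - 1).
    by apply/funext => x; rewrite lnK// posrE.
  rewrite intB//; last exact: prob_itg_cst.
  rewrite /q intD; [|exact: itgB|exact: prob_itg_cst].
  rewrite intB// !prob_int_cst; lra.
have ck x : q n x @[n --> \oo] --> rho x * ln (rho x) - rho x + 1.
  have := r0 x; rewrite le_eqVlt => /predU1P[rx0|rx].
    have -> : (fun n => q n x) = (fun n => 1 - (kp n)^-1).
      apply/funext => n; rewrite /q /rk -rx0 mul0r add0r min_l; last exact: ltW.
      by rewrite max_r ?invr_ge0 ?ltW//; ring.
    rewrite -rx0 mul0r subrr add0r -[X in _ --> X]subr0.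
    by apply: cvgB; [exact: cvg_cst|exact: cvg_harmonic].
  apply: cvg_eventually.
  exists (Num.truncn (rho x + (rho x)^-1)).+1 => n hn.
  have h : rho x + (rho x)^-1 <= kp n.
    apply: le_trans (ltW (truncnS_gt _)) _.
    by rewrite ler_nat (leq_trans hn).
  have rxV : 0 < (rho x)^-1 by rewrite invr_gt0.
  have -> : q n x = rho x * ln (rho x) - rho x + 1; last by [].
  rewrite /q /rk min_l; last lra.
  by rewrite max_l// invf_ple ?posrE//; lra.
have fat := fatou_le mq q0 ck qC.
have k0 x : 0 <= rho x * ln (rho x) - rho x + 1 by have := xlnx_ge (r0 x); lra.
have ik : G.-integrable setT (EFin \o (fun x => rho x * ln (rho x) - rho x + 1)).
  apply/integrableP; split.
    apply/measurable_EFinP; apply: measurable_funD => //.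
    by apply: measurable_funB => //; exact: measurable_xlnx.
  under eq_integral do rewrite /= ger0_norm//.
  exact: le_lt_trans fat (ltry _).
have irl : G.-integrable setT (EFin \o (fun x => rho x * ln (rho x))).
  have -> : (fun x => rho x * ln (rho x)) =
      (fun x => (rho x * ln (rho x) - rho x + 1) + (rho x - 1)).
    by apply/funext => x; ring.
  by apply: itgD => //; apply: itgB => //; exact: prob_itg_cst.
rewrite (rate_val GE dr irl iV VR) lee_fin -/D.
move: fat; rewrite itgE// lee_fin intD; [|exact: itgB|exact: prob_itg_cst].
by rewrite intB// prob_int_cst r1; lra.
Qed.

(** Young's inequality for [rho] and [g + s V] is integrated against [G]. The remainder
    [- (a + s) (int V dm - Rad)] is nonpositive. *)
Lemma dual_of_rate (m : M1 R) (c : R) (g : R -> R) (M s : R) :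
  (rate_IV V Rad a m <= c%:E)%E -> measurable_fun setT g ->
  (forall x, `|g x| <= M) -> 0 <= s -> s < - a ->
  \int[m]_x g x <= c + \int[G]_x (expR (g x + s * V x) - 1) - s * Rad.
Proof.
move=> Ic mg gM s0 sa.
have [rho [dr irl iV VR E]] := rate_fin oV GE (le_lt_trans Ic (ltry _)).
move: Ic; rewrite E lee_fin => Ic.
have [mr r0 _] := dr; have r1 := density_int1 dr; have ir := density_itg1 dr.
have ig := prob_itg m mg gM.
have igV : m.-integrable setT (EFin \o (fun x => g x + s * V x)).
  by apply: itgD => //; exact: itgZ.
have gM' x : g x <= M by rewrite (le_trans (ler_norm _)).
have ie := gibbs_itg_expR_bounded mg gM' sa.
have : \int[m]_x (g x + s * V x) <=
    \int[G]_x (rho x * ln (rho x)) + \int[G]_x (expR (g x + s * V x) - 1).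
  rewrite (density_int dr igV) intB ?prob_int_cst//; last exact: prob_itg_cst.
  have -> : \int[G]_x (rho x * ln (rho x)) + (\int[G]_x expR (g x + s * V x) - 1) =
      \int[G]_x (rho x * ln (rho x) - rho x + expR (g x + s * V x)).
    by rewrite intD//; [rewrite intB// r1; ring|exact: itgB].
  apply: int_le.
  - by apply/(density_itg dr) => //; exact: itg_meas igV.
  - by apply: itgD => //; exact: itgB.
  - by move=> x; exact: young_ln.
rewrite intD//; last exact: itgZ.
by rewrite intZ//; nra.
Qed.

End entropy_duality.

Section ultrafilter_of_family.
Context (T : Type) (K : set T) (C : set (set T)).

(** The hypothesis says that [K] and the complements of members of [C] generate a proper filter; the
    empty subfamily accounts for [K] itself. *)
Lemma ultrafilter_of_family :
  (forall m (g : 'I_m -> set T), (forall j, C (g j)) ->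
     exists x, K x /\ forall j, ~ g j x) ->
  exists F : set_system T, [/\ UltraFilter F, F K & forall U, C U -> F (~` U)].
Proof.
move=> fip.
pose F0 : set_system T := [set A | exists m (g : 'I_m -> set T),
  (forall j, C (g j)) /\ forall x, K x -> (forall j, ~ g j x) -> A x].
have PF : ProperFilter F0.
  split.
    move=> [m [g [Cg h]]]; have [x [Kx gx]] := fip m g Cg.
    exact: (h x Kx gx).
  split.
  - by exists 0%N, (fun=> set0); split => // -[].
  - move=> A B [m1 [g1 [Cg1 h1]]] [m2 [g2 [Cg2 h2]]].
    exists (m1 + m2)%N, (fun i => match fintype.split i with inl j => g1 j | inr j => g2 j end).
    split => [i|x Kx hx]; first by case: (fintype.split i).
    split.
    + apply: h1 => // j; have := hx (lshift m2 j).
      by rewrite (_ : fintype.split (lshift m2 j) = inl j)//; exact: (unsplitK (inl j)).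
    + apply: h2 => // j; have := hx (rshift m1 j).
      by rewrite (_ : fintype.split (rshift m1 j) = inr j)//; exact: (unsplitK (inr j)).
  - move=> A B AB [m [g [Cg h]]]; exists m, g; split => // x Kx hx.
    exact/AB/h.
have [F [UF sF]] := ultraFilterLemma PF.
exists F; split => //.
- by apply: sF; exists 0%N, (fun=> set0); split => // -[].
- move=> U CU; apply: sF; exists 1%N, (fun=> U); split => // x _ /(_ ord0).
  exact.
Qed.

Lemma filter_forall_ord (F : set_system T) (FF : Filter F) k (A : 'I_k -> set T) :
  (forall i, F (A i)) -> F [set x | forall i, A i x].
Proof.
move=> FA.
have h (s : seq 'I_k) : F [set x | forall i, i \in s -> A i x].
  elim: s => [|j s IH]; first by apply: filterS filterT.
  apply: filterS (filterI (FA j) IH) => x [Aj As] i.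
  by rewrite inE => /predU1P[->//|]; exact: As.
by apply: filterS (h (enum 'I_k)) => x hx i; apply: hx; rewrite mem_enum.
Qed.

End ultrafilter_of_family.

(** * Limit points, compact level sets and covers of closed sets *)

Section compactness.
Context (R : realType) (V : R -> R) (Rad a : R) (G : M1 R).
Hypothesis oV : orlicz_fun V.
Hypothesis a0 : a < 0.
Hypothesis GE : G = gibbs V a :> (set R -> \bar R).

(** The integral of [exp - 1] replaces the logarithm of an exponential moment in the
    Donsker-Varadhan formula. The two are equivalent up to adding constants to [g], and this form
    matches Young's inequality pointwise. *)
Definition dual_bound (c : R) (g : R -> R) (s : R) : R :=
  c + \int[G]_x (expR (g x + s * V x) - 1) - s * Rad.

Lemma limit_point (c : R) (F : set_system (M1 R)) : UltraFilter F ->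
  F [set mu | (mV V mu <= Rad%:E)%E] ->
  (forall (g : R -> R) (M s : R), measurable_fun setT g ->
     (forall x, `|g x| <= M) -> 0 <= s -> s < - a ->
     F [set mu | \int[mu]_x g x <= dual_bound c g s]) ->
  exists m : M1 R, [/\ (mV V m <= Rad%:E)%E, (rate_IV V Rad a m <= c%:E)%E &
    forall (g : R -> R) (M : R), measurable_fun setT g -> (forall x, `|g x| <= M) ->
      ulim F (fun mu : M1 R => \int[mu]_x g x) (\int[m]_x g x)].
Proof.
move=> UF FT FD.
have FI A (t : R) : measurable A -> 0 <= t ->
    F [set mu : M1 R | t * fine (mu A) <= c + (expR t - 1) * fine (G A)].
  move=> mA t0.
  have mg : measurable_fun setT (fun x => t * \1_A x) by exact: measurable_funM.
  have gM x : `|t * \1_A x| <= t.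
    by rewrite normrM ger0_norm// indicE; case: (_ \in _); rewrite ?normr1 ?normr0 ?mulr1 ?mulr0.
  have na : (0 : R) < - a by rewrite oppr_gt0.
  apply: filterS (FD _ _ _ mg gM (lexx 0) na) => mu /=.
  rewrite /dual_bound intZ; last exact: prob_itg_indic.
  rewrite prob_int_indic// mul0r subr0.
  have -> : (fun x => expR (t * \1_A x + 0 * V x) - 1) = (fun x => (expR t - 1) * \1_A x).
    apply/funext => x; rewrite mul0r addr0 indicE.
    by case: (_ \in _); rewrite ?mulr1 ?mulr0 ?expR0 ?subrr.
  by rewrite intZ ?prob_int_indic//; exact: prob_itg_indic.
have [m [hm ac]] := limit_measure UF FI.
have um (g : R -> R) (M : R) : measurable_fun setT g -> (forall x, `|g x| <= M) ->
    ulim F (fun mu : M1 R => \int[mu]_x g x) (\int[m]_x g x).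
  by move=> mg gM; apply: (ulim_integral UF hm mg gM).
(* [V] is unbounded, so the moment bound passes to the limit only through the truncations of [V],
   which then increase to it. *)
have VR : (mV V m <= Rad%:E)%E.
  apply: (fatou_le (f_ := fun n x => Num.min (V x) n%:R)).
  - by move=> n; exact: measurable_truncV.
  - by move=> n x; exact: truncV_ge0.
  - by move=> x; exact: truncV_cvg.
  - move=> n.
    have bn x : `|Num.min (V x) n%:R| <= n%:R.
      by rewrite ger0_norm ?truncV_ge0// ge_min lexx orbT.
    have mn := measurable_truncV oV n%:R.
    rewrite itgE; last exact: prob_itg bn.
    rewrite lee_fin; apply: (ulim_le UF _ (um _ _ mn bn) (ulim_cst UF Rad)).
    apply: filterS FT => mu /= muR.
    have iV := mV_fin oV (le_lt_trans muR (ltry _)).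
    move: muR; rewrite mVE// lee_fin; apply: le_trans; apply: int_le => //.
      exact: prob_itg bn.
    by move=> x; exact: truncV_le.
exists m; split => //.
have iV := mV_fin oV (le_lt_trans VR (ltry _)).
apply: (rate_le_of_dual oV a0 GE ac iV).
  by rewrite -lee_fin -mVE.
move=> g M s mg gM s0 sa.
exact: (ulim_le UF (FD _ _ _ mg gM s0 sa) (um _ _ mg gM) (ulim_cst UF _)).
Qed.

(** The weight is [0] for the weak topology and [W] for that of [d_W]. *)
Variable w : R -> R.
Hypothesis mw : measurable_fun setT w.
Hypothesis w0 : forall x, 0 <= w x.
Hypothesis wV : forall eta : R, 0 < eta -> exists C : R, forall x, w x <= eta * V x + C.

Lemma weight_itg (mu : M1 R) : mu.-integrable setT (EFin \o V) ->
  mu.-integrable setT (EFin \o w).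
Proof.
move=> iV; have [C hC] := wV ltr01.
apply: (itg_le (g := fun x => 1 * V x + C) mw).
  by apply: itgD; [exact: itgZ|exact: prob_itg_cst].
by move=> x; rewrite ger0_norm.
Qed.

Lemma weight_WD (mu : M1 R) : (mV V mu <= Rad%:E)%E -> WD w mu.
Proof.
move=> VR; have iV := mV_fin oV (le_lt_trans VR (ltry _)).
by rewrite /WD /= /mV itgE ?ltry//; exact: weight_itg.
Qed.

(** Truncating [w] at [|C|] changes its integral by at most [eta Rad = e / 3], uniformly over the
    measures with moment at most [Rad]; the truncated weight is bounded. *)
Lemma ulim_weight (F : set_system (M1 R)) (m : M1 R) : 0 < Rad -> UltraFilter F ->
  F [set mu | (mV V mu <= Rad%:E)%E] -> (mV V m <= Rad%:E)%E ->
  (forall (g : R -> R) (M : R), measurable_fun setT g -> (forall x, `|g x| <= M) ->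
      ulim F (fun mu : M1 R => \int[mu]_x g x) (\int[m]_x g x)) ->
  ulim F (Wh w) (Wh w m).
Proof.
move=> R0 UF FT mR um e e0.
have eta0 : 0 < e / 3 / Rad by rewrite !divr_gt0.
have [C hC] := wV eta0.
pose w' x := Num.min (w x) `|C|.
have mw' : measurable_fun setT w'.
  have h := measurable_minr mw (measurable_cst `|C|); exact: h.
have w'M x : `|w' x| <= `|C|.
  by rewrite ger0_norm ?ge_min ?lexx ?orbT// le_min w0 normr_ge0.
have close (mu : M1 R) : (mV V mu <= Rad%:E)%E ->
    `|\int[mu]_x w x - \int[mu]_x w' x| <= e / 3.
  move=> muR; have iV := mV_fin oV (le_lt_trans muR (ltry _)).
  move: muR; rewrite mVE// lee_fin => muR.
  have iw := weight_itg iV; have iw' := prob_itg mu mw' w'M.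
  rewrite -intB// ger0_norm; last first.
    by apply: Rintegral_ge0 => x _; rewrite subr_ge0 ge_min lexx.
  apply: (@le_trans _ _ (\int[mu]_x (e / 3 / Rad * V x))).
    apply: int_le; [exact: itgB|exact: itgZ|move=> x].
    have := hC x; have := ler_norm C; rewrite /w'.
    have h : 0 <= e / 3 / Rad * V x by apply: mulr_ge0; [exact: ltW|exact: orlicz_ge0].
    by have [h1|h1] := leP (w x) `|C|; lra.
  rewrite intZ//; apply: (@le_trans _ _ (e / 3 / Rad * Rad)).
    by rewrite ler_wpM2l// ltW.
  by rewrite divfK// gt_eqF.
have e3 : 0 < e / 3 by lra.
apply: filterS (filterI FT (um _ _ mw' w'M _ e3)) => mu /= [muR].
have := close _ muR; have := close _ mR; rewrite /Wh /mV -/(Rintegral _ _ _) -/(Rintegral _ _ _).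
rewrite !ler_norml !ltr_norml => /andP[? ?] /andP[? ?] /andP[? ?].
by apply/andP; split; lra.
Qed.

Lemma basic_nbhd_filter (F : set_system (M1 R)) (m : M1 R) k (f : 'I_k -> R -> R) (eps : R) :
  0 < Rad -> UltraFilter F ->
  F [set mu | (mV V mu <= Rad%:E)%E] -> (mV V m <= Rad%:E)%E ->
  (forall (g : R -> R) (M : R), measurable_fun setT g -> (forall x, `|g x| <= M) ->
      ulim F (fun mu : M1 R => \int[mu]_x g x) (\int[m]_x g x)) ->
  (forall i, bounded_continuous (f i)) -> 0 < eps ->
  F (basic_nbhd (WD w) (Wh w) f eps m).
Proof.
move=> R0 UF FT mR um bf e0.
have uw := ulim_weight R0 UF FT mR um e0.
have uf : F [set mu : M1 R | forall i, `|\int[mu]_x f i x - \int[m]_x f i x| < eps].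
  apply: filter_forall_ord => i; have [cf [M fM]] := bf i.
  by apply: (um _ _ _ fM) => //; exact: continuous_measurable_fun.
apply: filterS (filterI FT (filterI uw uf)) => mu /= [muR [muw muf]].
by split; [exact: weight_WD|split].
Qed.

Lemma rate_le_mV (mu : M1 R) (c : R) : (rate_IV V Rad a mu <= c%:E)%E -> (mV V mu <= Rad%:E)%E.
Proof. by rewrite /rate_IV; case: ifP => // _; rewrite leNgt ltry. Qed.

Lemma rate_ge0 (mu : M1 R) : (0 <= rate_IV V Rad a mu)%E.
Proof.
have [h|h] := ltP (rate_IV V Rad a mu) +oo%E; last exact: le_trans h.
have [rho [dr irl iV VR ->]] := rate_fin oV GE h.
have [mr r0 _] := dr; have r1 := density_int1 dr; have ir := density_itg1 dr.
rewrite lee_fin; have : \int[G]_x (rho x - 1) <= \int[G]_x (rho x * ln (rho x)).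
  apply: int_le => //; first by apply: itgB => //; exact: prob_itg_cst.
  by move=> x; exact: xlnx_ge.
rewrite intB//; last exact: prob_itg_cst.
have : 0 <= a * (\int[mu]_x V x - Rad) by rewrite mulr_le0// ?subr_le0// ltW.
by rewrite r1 prob_int_cst; lra.
Qed.

Lemma rate_good : 0 < Rad -> good_rate_function (WD w) (Wh w) (rate_IV V Rad a).
Proof.
move=> R0; split => [mu _|c]; first exact: rate_ge0.
set K := [set mu | _]; split; first by move=> mu [].
move=> C Copen Kcov; apply: contrapT => nfin.
have fip m (g : 'I_m -> set (M1 R)) : (forall j, C (g j)) ->
    exists x, K x /\ forall j, ~ g j x.
  move=> Cg; apply: contrapT => h; apply: nfin; exists m, g; split => // mu Kmu.
  apply: contrapT => h'; apply: h; exists mu; split => // j gj.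
  by apply: h'; exists j.
have [F [UF FK FC]] := ultrafilter_of_family fip.
have FT : F [set mu | (mV V mu <= Rad%:E)%E].
  by apply: filterS FK => mu [_]; exact: rate_le_mV.
have [m [mR mc um]] : exists m : M1 R, [/\ (mV V m <= Rad%:E)%E, (rate_IV V Rad a m <= c%:E)%E &
    forall (g : R -> R) (M : R), measurable_fun setT g -> (forall x, `|g x| <= M) ->
      ulim F (fun mu : M1 R => \int[mu]_x g x) (\int[m]_x g x)].
  apply: limit_point => // g M s mg gM s0 sa.
  by apply: filterS FK => mu [_ Ic]; exact: (dual_of_rate oV a0 GE Ic mg gM s0 sa).
have [U [CU Um]] : exists U, C U /\ U m by apply: Kcov; split => //; exact: weight_WD.
have [_ /(_ _ Um)[k [f [eps [bf e0 sub]]]]] := Copen _ CU.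
have FU : F U by apply: filterS sub (basic_nbhd_filter R0 UF FT mR um bf e0).
have [x [Ux nUx]] := filter_ex (filterI FU (FC _ CU)); exact: nUx.
Qed.

Definition dual_halfspaces (c : R) : set (set (M1 R)) :=
  [set U | exists (g : R -> R) (M s : R), [/\ measurable_fun setT g,
     (forall x, `|g x| <= M), 0 <= s, s < - a &
     U = [set mu : M1 R | dual_bound c g s < \int[mu]_x g x]]].

(* The restriction to [mV V mu <= Rad] replaces tightness: it is satisfied by the
   empirical measure of every point of the ball. *)
Lemma closure_cover (A : set (M1 R)) (c : R) : 0 < Rad ->
  (c%:E < ereal_inf (rate_IV V Rad a @` sp_closure (WD w) (Wh w) A))%E ->
  exists m (U : 'I_m -> set (M1 R)), (forall j, dual_halfspaces c (U j)) /\
    forall mu, (mV V mu <= Rad%:E)%E -> sp_closure (WD w) (Wh w) A mu ->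
      exists j, U j mu.
Proof.
move=> R0 cinf; apply: contrapT => nfin.
pose K := [set mu : M1 R | (mV V mu <= Rad%:E)%E /\ sp_closure (WD w) (Wh w) A mu].
have fip m (g : 'I_m -> set (M1 R)) : (forall j, dual_halfspaces c (g j)) ->
    exists x, K x /\ forall j, ~ g j x.
  move=> Cg; apply: contrapT => h; apply: nfin; exists m, g; split => // mu mR cA.
  apply: contrapT => h'; apply: h; exists mu; split => // j gj.
  by apply: h'; exists j.
have [F [UF FK FC]] := ultrafilter_of_family fip.
have FT : F [set mu | (mV V mu <= Rad%:E)%E] by apply: filterS FK => mu [].
have [m [mR mc um]] : exists m : M1 R, [/\ (mV V m <= Rad%:E)%E, (rate_IV V Rad a m <= c%:E)%E &
    forall (g : R -> R) (M : R), measurable_fun setT g -> (forall x, `|g x| <= M) ->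
      ulim F (fun mu : M1 R => \int[mu]_x g x) (\int[m]_x g x)].
  apply: limit_point => // g M s mg gM s0 sa.
  apply: filterS (FC [set mu : M1 R | dual_bound c g s < \int[mu]_x g x] _).
    by move=> mu /= /negP; rewrite -leNgt.
  by exists g, M, s.
have mA : sp_closure (WD w) (Wh w) A m.
  split; first exact: weight_WD.
  move=> U oU Um; have [_ /(_ _ Um)[k [f [eps [bf e0 sub]]]]] := oU.
  have FU : F U by apply: filterS sub (basic_nbhd_filter R0 UF FT mR um bf e0).
  have [mu [Umu [_ [_ clA]]]] := filter_ex (filterI FU FK).
  exact: clA.
have : (ereal_inf (rate_IV V Rad a @` sp_closure (WD w) (Wh w) A) <= rate_IV V Rad a m)%E.
  by apply: ereal_inf_lbound; exists m.
by move=> h; have := lt_le_trans cinf (le_trans h mc); rewrite ltxx.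
Qed.

End compactness.

(** * Upper bound on volumes *)

Section empirical.
Context (R : realType).

Lemma empirical_measure (s : seq R) : (0 < size s)%N ->
  exists mu : M1 R, is_empirical s mu /\
    forall g : R -> R, measurable_fun setT g -> (forall x, 0 <= g x) ->
      (\int[mu]_x (g x)%:E = ((size s)%:R^-1 * \sum_(x <- s) g x)%:E)%E.
Proof.
move=> s0; have n0 : 0 <= ((size s)%:R^-1 : R) by rewrite invr_ge0.
pose D (i : nat) : {measure set R -> \bar R} := @dirac _ R (nth 0 s i) R.
pose M : {measure set R -> \bar R} := mscale (NngNum n0) (msum D (size s)).
have nz : (size s)%:R != 0 :> R by rewrite pnatr_eq0 -lt0n.
have ME A : M A = ((size s)%:R^-1 * \sum_(x <- s) \1_A x)%:E.
  rewrite /M /= /mscale /= /msum (big_nth 0) big_mkord EFinM -sumEFin; congr (_ * _)%E.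
have M1 : M setT = 1%E.
  rewrite ME; under eq_bigr do rewrite indicE in_setT.
  by rewrite big_const_seq count_predT iter_addr_0 -mulr_natl mulr1 mulVf.
have [mu muE] := probability_of (measure0 M) (measure_ge0 M) (@measure_semi_sigma_additive _ _ _ M) M1.
exists mu; split => [A mA|g mg g0]; first by rewrite muE; exact: ME.
rewrite muE ge0_integral_mscale//=; last 2 first.
- exact/measurable_EFinP.
- by move=> x _; rewrite lee_fin.
rewrite ge0_integral_measure_sum//; last 2 first.
- by move=> x _; rewrite lee_fin.
- exact/measurable_EFinP.
rewrite (big_nth 0) big_mkord EFinM -sumEFin; congr (_ * _)%E.
apply: eq_bigr => i _; rewrite integral_dirac//; last exact/measurable_EFinP.
by rewrite diracT mul1e.
Qed.

(** For the empty sequence the defining formula would give the whole line mass [0]. *)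
Lemma empirical_size (s : seq R) (mu : M1 R) : is_empirical s mu -> (0 < size s)%N.
Proof.
move=> /(_ setT measurableT); rewrite probability_setT lt0n => h.
apply/negP => /eqP /size0nil s0; move: h; rewrite s0 big_nil mulr0 => -[] /eqP.
by rewrite oner_eq0.
Qed.

Lemma empirical_ge0_integral (s : seq R) (mu : M1 R) (g : R -> R) : is_empirical s mu ->
  measurable_fun setT g -> (forall x, 0 <= g x) ->
  (\int[mu]_x (g x)%:E = ((size s)%:R^-1 * \sum_(x <- s) g x)%:E)%E.
Proof.
move=> es mg g0; have [nu [en hn]] := empirical_measure (empirical_size es).
rewrite -hn//; apply: eq_measure_integral => A mA _.
exact: etrans (es A mA) (esym (en A mA)).
Qed.

Lemma empirical_itg (s : seq R) (mu : M1 R) (g : R -> R) : is_empirical s mu ->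
  measurable_fun setT g -> mu.-integrable setT (EFin \o g).
Proof.
move=> es mg; apply/integrableP; split; first exact/measurable_EFinP.
rewrite (_ : (fun x => `|(EFin \o g) x|%E) = (fun x => (`|g x|)%:E))//.
rewrite (empirical_ge0_integral es)//; first exact: ltry.
exact: measurableT_comp.
Qed.

Lemma empirical_integral (s : seq R) (mu : M1 R) (g : R -> R) : is_empirical s mu ->
  measurable_fun setT g -> \int[mu]_x g x = (size s)%:R^-1 * \sum_(x <- s) g x.
Proof.
move=> es mg; have mn : measurable_fun setT (fun x => `|g x|) by exact: measurableT_comp.
have pos (h : R -> R) : measurable_fun setT h -> (forall x, 0 <= h x) ->
    \int[mu]_x h x = (size s)%:R^-1 * \sum_(x <- s) h x.
  by move=> mh h0; rewrite /Rintegral (empirical_ge0_integral es).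
have -> : \int[mu]_x g x = \int[mu]_x (`|g x| - (`|g x| - g x)).
  by apply: eq_Rintegral => x _; ring.
rewrite intB; [|exact: (empirical_itg es mn)|exact: (empirical_itg es (measurable_funB mn mg))].
rewrite (pos (fun x => `|g x|))// (pos (fun x => `|g x| - g x)); last 2 first.
- exact: measurable_funB.
- by move=> x; rewrite subr_ge0 ler_norm.
by rewrite -mulrBr -sumrB; congr (_ * _); apply: eq_bigr => x _; ring.
Qed.

End empirical.

Section volume_upper.
Context (R : realType) (V : R -> R) (Rad a : R) (G : M1 R).
Hypothesis oV : orlicz_fun V.
Hypothesis a0 : a < 0.
Hypothesis GE : G = gibbs V a :> (set R -> \bar R).
Local Notation leb := (@lebesgue_measure R).
Local Notation itg f := (leb.-integrable [set: R] (EFin \o f)).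

Lemma empirical_ball_mV n (s : seq R) (mu : M1 R) : orlicz_ball V Rad n s ->
  is_empirical s mu -> (mV V mu <= Rad%:E)%E.
Proof.
move=> [sn sR] es; have := empirical_size es; rewrite sn => n0.
rewrite /mV (empirical_ge0_integral es (orlicz_measurable oV) (orlicz_ge0 oV)).
by rewrite lee_fin sn ler_pdivrMl ?ltr0n// mulrC.
Qed.

Lemma tilted_integral (g : R -> R) (M s : R) : measurable_fun setT g ->
  (forall x, `|g x| <= M) -> s < - a ->
  itg (fun x => expR (g x + (a + s) * V x)) /\
  \int[leb]_x expR (g x + (a + s) * V x) =
    partition_fun V a * (1 + \int[G]_x (expR (g x + s * V x) - 1)).
Proof.
move=> mg gM sa; have Z0 := partition_gt0 oV a0.
have dG : is_density G leb (fun x => expR (a * V x) / partition_fun V a).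
  by rewrite GE; exact: gibbs_density.
have gM' x : g x <= M by rewrite (le_trans (ler_norm _)).
have ie := gibbs_itg_expR_bounded oV a0 GE mg gM' sa.
have E : (fun x => expR (g x + (a + s) * V x)) =
  (fun x => partition_fun V a * (expR (a * V x) / partition_fun V a * expR (g x + s * V x))).
  apply/funext => x; rewrite (_ : g x + (a + s) * V x = a * V x + (g x + s * V x)); last by ring.
  by rewrite (expRD (a * V x)); field; rewrite gt_eqF.
have il : itg (fun x => expR (a * V x) / partition_fun V a * expR (g x + s * V x)).
  by apply/(lebesgue_density_itg dG) => //; exact: itg_meas ie.
rewrite E; split; first exact: itgZ.
rewrite intZ// -(lebesgue_density_int dG ie); congr (_ * _).
by rewrite intB//; [rewrite prob_int_cst; ring|exact: prob_itg_cst].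
Qed.

Lemma volume_halfspaces (c : R) m (U : 'I_m -> set (M1 R)) n :
  (forall j, dual_halfspaces V Rad a G c (U j)) ->
  (vol n [set s | orlicz_ball V Rad n s /\
      exists mu, (exists j, U j mu) /\ is_empirical s mu] <=
   (m%:R * expR (n%:R * (free_energy V Rad a - c)))%:E)%E.
Proof.
move=> hU; have Z0 := partition_gt0 oV a0.
have : forall j, exists gs : (R -> R) * R * R, [/\ measurable_fun setT gs.1.1,
     (forall x, `|gs.1.1 x| <= gs.1.2), 0 <= gs.2, gs.2 < - a &
     U j = [set mu : M1 R | dual_bound V Rad G c gs.1.1 gs.2 < \int[mu]_x gs.1.1 x]].
  by move=> j; have [g [M [s [h1 h2 h3 h4 h5]]]] := hU j; exists (g, M, s).
move=> /choice[gs hgs].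
pose g j := (gs j).1.1; pose s j := (gs j).2.
pose J j := \int[G]_x (expR (g j x + s j * V x) - 1).
have bE j : dual_bound V Rad G c (g j) (s j) = c + J j - s j * Rad by [].
(* With this constant the tilted product is at least [1] on the part of the ball in the [j]-th
   halfspace: the sum of [g j] exceeds [n (c + J j - s j Rad)], and [(a + s j) (sum V - n Rad) >= 0]
   as both factors are nonpositive. *)
pose C j := expR (- (n%:R * (c + J j + a * Rad))).
pose g' j x := expR (g j x + (a + s j) * V x).
have ti j : itg (g' j) /\ \int[leb]_x g' j x = partition_fun V a * (1 + J j).
  by have [h1 h2 h3 h4 h5] := hgs j; exact: tilted_integral h2 h4.
apply: (@le_trans _ _ (\sum_j C j * (\int[leb]_x g' j x) ^+ n)%:E).
  apply: vol_le.
  - by move=> j; exact: expR_ge0.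
  - by move=> j x; exact: expR_ge0.
  - by move=> j; case: (ti j).
  - move=> t tn [[_ tR] [mu [[j Uj] es]]].
    have n0 : (0 < n)%N by rewrite -tn; exact: empirical_size es.
    have n0' : 0 < n%:R :> R by rewrite ltr0n.
    apply: (@le_trans _ _ (C j * \prod_(x <- t) g' j x)); last first.
      rewrite [leRHS](bigD1 j)//= lerDl; apply: sumr_ge0 => i _.
      by rewrite mulr_ge0 ?expR_ge0//; apply: prodr_ge0 => x _; exact: expR_ge0.
    have [h1 h2 h3 h4 h5] := hgs j.
    move: Uj; rewrite h5 /= -/(g j) -/(s j) bE (empirical_integral es h1) tn.
    rewrite ltr_pdivlMl// -/(g j) => hg.
    rewrite /g' -expR_sum /C -expRD -[leLHS]expR0 ler_expR big_split /= -mulr_sumr.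
    have as0 : a + s j <= 0 by rewrite /s; lra.
    have : 0 <= (a + s j) * (\sum_(x <- t) V x - Rad * n%:R).
      by rewrite mulr_le0// subr_le0.
    by move: hg; lra.
rewrite lee_fin.
have -> : m%:R * expR (n%:R * (free_energy V Rad a - c)) =
    \sum_(j < m) expR (n%:R * (free_energy V Rad a - c)).
  by rewrite sumr_const card_ord mulr_natl.
apply: ler_sum => j _; have [_ ->] := ti j.
have J1 : 0 <= 1 + J j.
  have : 0 <= \int[leb]_x g' j x by apply: Rintegral_ge0 => x _; exact: expR_ge0.
  by have [_ ->] := ti j; rewrite pmulr_rge0.
(* By [1 + J j <= exp (J j)], the quantity [J j] cancels against the one in [C j]. *)
apply: (@le_trans _ _ (C j * expR (n%:R * (ln (partition_fun V a) + J j)))).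
  apply: ler_wpM2l; first exact: expR_ge0.
  rewrite expRM_natl; apply: lerXn2r; rewrite ?nnegrE ?expR_ge0 ?mulr_ge0 ?(ltW Z0)//.
  by rewrite expRD lnK ?posrE// ler_pM2l//; exact: expR_ge1Dx.
by rewrite /C -expRD ler_expR /free_energy; lra.
Qed.

End volume_upper.

(** * Lower bound on volumes *)

(** Serves to gather [ln p], [V], [w] and the test functions in one family, controlled by a single
    Chebyshev estimate. *)
Definition ocons (X : Type) m (h : X) (u : 'I_m -> X) (i : 'I_m.+1) : X :=
  if unlift ord0 i is Some j then u j else h.

Lemma ocons0 (X : Type) m (h : X) (u : 'I_m -> X) : ocons h u ord0 = h.
Proof. by rewrite /ocons unlift_none. Qed.

Lemma oconsS (X : Type) m (h : X) (u : 'I_m -> X) j : ocons h u (lift ord0 j) = u j.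
Proof. by rewrite /ocons liftK. Qed.

Lemma oconsP (X : Type) m (h : X) (u : 'I_m -> X) (P : X -> Prop) :
  P h -> (forall j, P (u j)) -> forall i, P (ocons h u i).
Proof. by move=> Ph Pu i; rewrite /ocons; case: unliftP. Qed.

Lemma near_infty_natr (R : realType) (C : R) : \forall n \near \oo, C <= n%:R.
Proof.
exists (Num.truncn C).+1 => // n /= hn.
by apply: le_trans (ltW (truncnS_gt _)) _; rewrite ler_nat.
Qed.

Section weak_law.
Context (R : realType).
Local Notation leb := (@lebesgue_measure R).
Local Notation itg f := (leb.-integrable [set: R] (EFin \o f)).

(** Asymptotic equipartition: since [g ord0] is [ln p], the product density is at most
    [exp (n (int p ln p + eps))] at typical points, whose product probability is at least [1/2]. *)
Lemma volume_weak_law m (g : 'I_m.+1 -> R -> R) (p : R -> R) (M eps : R)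
    (S : nat -> set (seq R)) :
  measurable_fun setT p -> (forall x, 0 <= p x) -> itg p -> \int[leb]_x p x = 1 ->
  (forall j, measurable_fun setT (g j)) ->
  (forall j x, 0 < p x -> `|g j x| <= M) ->
  (forall x, 0 < p x -> g ord0 x = ln (p x)) -> 0 < eps ->
  (forall n s, (0 < n)%N -> size s = n -> (forall x, x \in s -> 0 < p x) ->
    (forall j, `|\sum_(x <- s) g j x - n%:R * \int[leb]_x (p x * g j x)| < n%:R * eps) ->
    S n s) ->
  \forall n \near \oo,
    ((1 / 2 * expR (- (n%:R * (\int[leb]_x (p x * g ord0 x) + eps))))%:E <= vol n (S n))%E.
Proof.
move=> mp p0 ip p1 mg gM g0 e0 hS.
have pgM j x : `|p x * g j x| <= M * p x.
  have := p0 x; rewrite le_eqVlt => /predU1P[<-|px]; first by rewrite mul0r normr0 mulr0.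
  by rewrite normrM (ger0_norm (p0 x)) mulrC ler_wpM2r// gM.
have ipg j : itg (fun x => p x * g j x).
  apply: (leb_itg_le (g := fun x : R => M * p x)) => //; last exact: itgZ.
  exact: measurable_funM.
pose mean j := \int[leb]_x (p x * g j x).
have meanM j : `|mean j| <= M.
  apply: le_trans (le_normr_Rintegral measurableT (ipg j)) _.
  rewrite -[leRHS]mulr1 -p1 -intZ//; apply: int_le.
  - by apply: integrable_norm => //; exact: ipg.
  - exact: itgZ.
  - by move=> x; exact: pgM.
have M0 : 0 <= M by apply: le_trans (meanM ord0).
(* The [m + 1] variances, each at most [4 M^2], contribute [4 (m + 1) M^2 / (n eps^2)], which has to
   be at most [1/2]. *)
have nbig := near_infty_natr (8 * (m.+1)%:R * M ^+ 2 / eps ^+ 2 + 1).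
apply: filterS nbig => n hn.
have e20 : 0 < eps ^+ 2 by rewrite exprn_gt0.
have n1 : 1 <= n%:R :> R.
  apply: le_trans hn; rewrite lerDr divr_ge0 ?(ltW e20)// !mulr_ge0// sqr_ge0.
have n0 : (0 < n)%N by rewrite -(ltr0n R); lra.
have n0' : 0 < n%:R :> R by lra.
pose ne := n%:R * eps; have ne0 : 0 < ne by rewrite mulr_gt0.
(* With this scaling an atypical point has a sum of absolute value at least [1], so its square makes
   the minorant nonpositive. *)
pose gm j x := (g j x - mean j) / ne.
pose h := mean ord0.
have pgmE j x : p x * gm j x = ne^-1 * (p x * g j x) - (ne^-1 * mean j) * p x.
  by rewrite /gm; ring.
have pgm2E j x : p x * gm j x ^+ 2 = ne^-1 ^+ 2 * (p x * (g j x - mean j) ^+ 2).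
  by rewrite /gm; ring.
have sqM j x : p x * (g j x - mean j) ^+ 2 <= (4 * M ^+ 2) * p x.
  have := p0 x; rewrite le_eqVlt => /predU1P[<-|px]; first by rewrite mul0r mulr0.
  rewrite [leRHS]mulrC ler_pM2l//.
  have h1 := gM j x px; have h2 := meanM j.
  have h3 : `|g j x - mean j| <= 2 * M by apply: le_trans (ler_normB _ _) _; lra.
  rewrite -[leLHS]real_normK ?num_real//.
  have -> : 4 * M ^+ 2 = (2 * M) ^+ 2 by ring.
  by apply: lerXn2r; rewrite ?nnegrE// mulr_ge0.
have isq j : itg (fun x => p x * (g j x - mean j) ^+ 2).
  apply: (leb_itg_le (g := fun x : R => (4 * M ^+ 2) * p x)) => //; last 2 first.
  - exact: itgZ.
  - by move=> x; rewrite ger0_norm// mulr_ge0 ?sqr_ge0.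
  - apply: measurable_funM => //; apply: measurable_funX.
    exact: measurable_funB.
pose sg := ne^-1 ^+ 2 * (4 * M ^+ 2).
apply: (@le_trans _ _ (expR (- (n%:R * (h + eps))) * (1 - \sum_(j < m.+1) (0 ^+ 2 + n%:R * sg)))%:E).
  rewrite lee_fin mulrC; apply: ler_wpM2l; first exact: expR_ge0.
  rewrite (eq_bigr (fun=> n%:R * sg)); last by move=> j _; rewrite expr0n add0r.
  rewrite sumr_const card_ord -[n%:R * sg *+ m.+1]mulr_natl.
  have -> : (m.+1)%:R * (n%:R * sg) = (4 * (m.+1)%:R * M ^+ 2 / eps ^+ 2) / n%:R.
    by rewrite /sg /ne; field; rewrite !gt_eqF.
  have : (4 * (m.+1)%:R * M ^+ 2 / eps ^+ 2) / n%:R <= 1 / 2.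
    by rewrite ler_pdivrMr//; move: hn; lra.
  by lra.
apply: (@vol_ge R n m.+1 (S n) p gm sg _ 1 (fun=> 0) p0 ip p1).
- move=> j; have -> : (fun x => p x * gm j x) =
      (fun x => ne^-1 * (p x * g j x) - (ne^-1 * mean j) * p x) by apply/funext => x.
  by apply: itgB; apply: itgZ.
- move=> j; have -> : (fun x => p x * gm j x) =
      (fun x => ne^-1 * (p x * g j x) - (ne^-1 * mean j) * p x) by apply/funext => x.
  by rewrite intB ?intZ//; [rewrite p1 /mean; ring|exact: itgZ|exact: itgZ].
- move=> j; have -> : (fun x => p x * gm j x ^+ 2) =
      (fun x => ne^-1 ^+ 2 * (p x * (g j x - mean j) ^+ 2)) by apply/funext => x.
  exact: itgZ.
- move=> j; have -> : (fun x => p x * gm j x ^+ 2) =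
      (fun x => ne^-1 ^+ 2 * (p x * (g j x - mean j) ^+ 2)) by apply/funext => x.
  rewrite intZ// ler_wpM2l ?sqr_ge0// -[leRHS]mulr1 -[X in _ <= _ * X]p1 -intZ//.
  by apply: int_le => //; exact: itgZ.
- exact: expR_ge0.
- move=> s sn; set lam := expR _.
  rewrite (eq_bigr (fun j => (\sum_(x <- s) gm j x) ^+ 2)); last by move=> j _; rewrite add0r.
  have ind0 : 0 <= \1_(S n) s :> R by rewrite indicE.
  have [all0|] := boolP (all (fun x => 0 < p x) s); last first.
    move=> /allPn[x xs /negP px0].
    have px : p x = 0 by apply/eqP; rewrite eq_le p0 andbT leNgt; exact/negP.
    by rewrite (big_rem x)//= px !(mul0r, mulr0).
  have pos x : x \in s -> 0 < p x by move=> xs; exact: (allP all0).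
  have prod0 : 0 <= \prod_(x <- s) p x by apply: prodr_ge0.
  have sumE j : \sum_(x <- s) gm j x = (\sum_(x <- s) g j x - n%:R * mean j) / ne.
    rewrite -mulr_suml sumrB; congr ((_ - _) / _).
    by rewrite big_const_seq count_predT iter_addr_0 sn mulr_natl.
  have [good|] := pselect (forall j, `|\sum_(x <- s) g j x - n%:R * mean j| < ne).
    have Ss : S n s by exact: hS.
    rewrite indicE mem_set//=.
    apply: (@le_trans _ _ (lam * \prod_(x <- s) p x)).
      rewrite -[leRHS]mulr1; apply: ler_wpM2l; first by rewrite mulr_ge0 ?expR_ge0.
      by rewrite lerBlDr lerDl; apply: sumr_ge0 => j _; exact: sqr_ge0.
    have -> : \prod_(x <- s) p x = expR (\sum_(x <- s) g ord0 x).
      rewrite expR_sum; apply: eq_big_seq => x xs.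
      by rewrite g0 ?pos// lnK// posrE pos.
    rewrite /lam -expRD -[leRHS]expR0 ler_expR.
    by have := good ord0; rewrite ltr_norml /h /ne => /andP[_]; lra.
  move=> /existsNP[j /negP]; rewrite -leNgt => bad.
  apply: le_trans ind0; apply: mulr_ge0_le0; first by rewrite mulr_ge0 ?expR_ge0.
  rewrite subr_le0 (bigD1 j)//= -[leLHS]addr0; apply: lerD; last first.
    by apply: sumr_ge0 => i _; exact: sqr_ge0.
  rewrite sumE -[leRHS]real_normK ?num_real// -[leLHS](expr1n _ 2).
  apply: lerXn2r; rewrite ?nnegrE// normrM normfV (gtr0_norm ne0) ler_pdivlMr// mul1r.
  exact: bad.
Qed.

End weak_law.

Lemma young_ln_strict (R : realType) (u y : R) : 0 <= u -> u != expR y ->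
  u * y < u * ln u - u + expR y.
Proof.
rewrite le_eqVlt => /predU1P[<- _|u0 uy]; first by rewrite !mul0r subr0 add0r expR_gt0.
have ne : y - ln u != 0.
  by apply: contra uy; rewrite subr_eq0 => /eqP ->; rewrite lnK// posrE.
have := expR_gt1Dx ne; rewrite expRB lnK ?posrE// ltr_pdivlMr//.
by lra.
Qed.

(** Young's inequality with exponent [ln z] is the tangent line at the mixture [z]; it is averaged
    over [x] and [y]. If [z = 0], both points vanish. *)
Lemma xlnx_convex (R : realType) (x y t : R) : 0 <= x -> 0 <= y -> 0 < t -> t < 1 ->
  (t * x + (1 - t) * y) * ln (t * x + (1 - t) * y) <=
  t * (x * ln x) + (1 - t) * (y * ln y).
Proof.
move=> x0 y0 t0 t1; set z := t * x + _.
have : 0 <= z by rewrite addr_ge0// mulr_ge0//; lra.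
rewrite le_eqVlt => /predU1P[z0|z0]; last first.
  have := young_ln (ln z) x0; have := young_ln (ln z) y0; rewrite lnK ?posrE//.
  move=> h1 h2; have e : z = t * x + (1 - t) * y by [].
  have : z * ln z = t * (x * ln z) + (1 - t) * (y * ln z) by rewrite {1}e; ring.
  have h3 : t * (x * ln z) <= t * (x * ln x - x + z) by rewrite ler_pM2l.
  have h4 : (1 - t) * (y * ln z) <= (1 - t) * (y * ln y - y + z).
    by rewrite ler_wpM2l//; lra.
  by move: h3 h4; rewrite {2 4}e; lra.
have tx : 0 <= t * x by rewrite mulr_ge0// ltW.
have ty : 0 <= (1 - t) * y by rewrite mulr_ge0//; lra.
have : t * x = 0 by move: z0 tx ty; rewrite /z; lra.
have : (1 - t) * y = 0 by move: z0 tx ty; rewrite /z; lra.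
move=> /eqP; rewrite mulf_eq0 gt_eqF ?subr_gt0//= => /eqP ->.
move=> /eqP; rewrite mulf_eq0 gt_eqF//= => /eqP ->.
by rewrite -z0 !mul0r !mulr0 addr0.
Qed.

Lemma xlnx_strictly_convex (R : realType) (x y t : R) :
  0 <= x -> 0 <= y -> 0 < t -> t < 1 -> x != y ->
  (t * x + (1 - t) * y) * ln (t * x + (1 - t) * y) <
  t * (x * ln x) + (1 - t) * (y * ln y).
Proof.
move=> x0 y0 t0 t1 xy; set z := t * x + _.
have tx : 0 <= t * x by rewrite mulr_ge0// ltW.
have ty : 0 <= (1 - t) * y by rewrite mulr_ge0//; lra.
have z0 : 0 < z.
  rewrite lt_neqAle addr_ge0// andbT eq_sym; apply: contra xy => /eqP z0.
  have : t * x = 0 by move: z0 tx ty; rewrite /z; lra.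
  have : (1 - t) * y = 0 by move: z0 tx ty; rewrite /z; lra.
  move=> /eqP; rewrite mulf_eq0 gt_eqF ?subr_gt0//= => /eqP ->.
  by move=> /eqP; rewrite mulf_eq0 gt_eqF//= => /eqP ->.
have xz : x != expR (ln z).
  rewrite lnK ?posrE//; apply: contra xy => /eqP xz; apply/eqP.
  have : (1 - t) * (x - y) = 0 by move: xz; rewrite /z; lra.
  by move=> /eqP; rewrite mulf_eq0 gt_eqF ?subr_gt0//= subr_eq0 => /eqP.
have := young_ln_strict x0 xz; have := young_ln (ln z) y0; rewrite lnK ?posrE//.
move=> h1 h2; have e : z = t * x + (1 - t) * y by [].
have : z * ln z = t * (x * ln z) + (1 - t) * (y * ln z) by rewrite {1}e; ring.
have h3 : t * (x * ln z) < t * (x * ln x - x + z) by rewrite ltr_pM2l.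
have h4 : (1 - t) * (y * ln z) <= (1 - t) * (y * ln y - y + z).
  by rewrite ler_wpM2l//; lra.
by move: h3 h4; rewrite {2 4}e; lra.
Qed.

Lemma mix_lt (R : realType) (t x y r : R) : 0 < t -> t < 1 -> 0 < r ->
  x <= r / 2 -> y <= r -> t * x + (1 - t) * y < r.
Proof. by move=> *; nra. Qed.

Lemma mix_lt_add (R : realType) (t x y d e : R) : t * (x - y) <= d -> d < e ->
  t * x + (1 - t) * y < y + e.
Proof. by move=> *; nra. Qed.

(** * Perturbation and truncation of densities *)

Section density_approximation.
Context (R : realType).
Local Notation leb := (@lebesgue_measure R).
Local Notation itg f := (leb.-integrable [set: R] (EFin \o f)).

Lemma density_truncation m (p : R -> R) (u : 'I_m -> R -> R) (e : R) :
  measurable_fun setT p -> (forall x, 0 <= p x) -> itg p -> \int[leb]_x p x = 1 ->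
  itg (fun x => p x * ln (p x)) ->
  (forall j, measurable_fun setT (u j)) -> (forall j, itg (fun x => p x * u j x)) ->
  0 < e ->
  exists (kap : R) (p' : R -> R), [/\
    [/\ measurable_fun setT p', (forall x, 0 <= p' x), itg p' & \int[leb]_x p' x = 1],
    (forall x, 0 < p' x -> `|x| <= kap /\ `|ln (p' x)| <= kap),
    (forall j, `|\int[leb]_x (p' x * u j x) - \int[leb]_x (p x * u j x)| < e) &
    \int[leb]_x (p' x * ln (p' x)) < \int[leb]_x (p x * ln (p x)) + e].
Proof.
move=> mp p0 ip p1 ipl mu ipu e0.
pose c (k : nat) : R := k.+1%:R.
have c0 k : 0 < c k by rewrite ltr0n.
(* Cutting the density away from [0] and infinity bounds [ln p] on both sides. Every point with
   [p x > 0] lies in [A k] eventually, so the truncated integrals converge by domination and the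
   mass [Z k] tends to [1]. *)
pose A k : set R := `[- c k, c k]%classic `&` p @^-1` `[(c k)^-1, c k]%classic.
have mA k : measurable (A k).
  apply: measurableI => //; rewrite -[X in measurable X]setTI; exact: mp.
pose tr k x := p x * \1_(A k) x.
have mtr k : measurable_fun setT (tr k) by apply: measurable_funM => //; exact: measurable_indic.
have tr0 k x : 0 <= tr k x by rewrite mulr_ge0// indicE.
have trE k x : 0 < tr k x -> A k x /\ tr k x = p x.
  rewrite /tr indicE; case: (boolP (x \in A k)) => [/set_mem h|_]; last by rewrite mulr0 ltxx.
  by rewrite mulr1.
have trle k x : tr k x <= p x.
  by rewrite /tr indicE; case: (x \in A k); rewrite ?mulr1 ?mulr0.
have trcvg (v : R -> R) x : tr k x * v x @[k --> \oo] --> p x * v x.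
  apply: cvg_eventually; have := p0 x; rewrite le_eqVlt => /predU1P[px|px].
    by exists 0%N => k _; rewrite /tr -px !mul0r.
  have pV : 0 < (p x)^-1 by rewrite invr_gt0.
  exists (Num.truncn (`|x| + p x + (p x)^-1)).+1 => k hk.
  have hc : `|x| + p x + (p x)^-1 <= c k.
    apply: le_trans (ltW (truncnS_gt _)) _.
    by rewrite ler_nat (leq_trans hk).
  rewrite /tr indicE mem_set ?mulr1//; split => /=; rewrite in_itv/=.
    by rewrite -ler_norml; have := normr_ge0 x; lra.
  rewrite invf_ple ?posrE//; have := normr_ge0 x => h; apply/andP; split; lra.
have trint (v : R -> R) : measurable_fun setT v -> itg (fun x => p x * v x) ->
    (forall k, itg (fun x => tr k x * v x)) /\
    \int[leb]_x (tr k x * v x) @[k --> \oo] --> \int[leb]_x (p x * v x).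
  move=> mv iv.
  have dom k x : `|tr k x * v x| <= `|p x * v x|.
    rewrite [leLHS]normrM [leRHS]normrM; apply: ler_wpM2r => //.
    by rewrite (ger0_norm (tr0 k x)) (ger0_norm (p0 x)); exact: trle.
  have iv' : itg (fun x => `|p x * v x|) by exact: integrable_norm.
  split => [k|].
    apply: (leb_itg_le (g := fun x : R => `|p x * v x|)) => //.
    exact: measurable_funM.
  have H := @int_dct _ _ _ leb (fun k x => tr k x * v x) (fun x => p x * v x) (fun x => `|p x * v x|).
  apply: (H _ _ _ iv' dom).2.
  - by move=> k; exact: (measurable_funM (mtr k) mv).
  - exact: (measurable_funM mp mv).
  - by move=> x; exact: trcvg.
pose Z k := \int[leb]_x tr k x.
have [itr Zc] : (forall k, itg (tr k)) /\ Z k @[k --> \oo] --> (1 : R).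
  have ip' : itg (fun x => p x * (fun=> 1) x).
    by have -> : (fun x => p x * (fun=> 1) x) = p by apply/funext => x; rewrite mulr1.
  have [h1 h2] := trint (fun=> 1) (measurable_cst _) ip'.
  have E k : (fun x => tr k x * (fun=> 1) x) = tr k by apply/funext => x; rewrite mulr1.
  split => [k|]; first by rewrite -E; exact: h1.
  move: h2; have -> : (fun k => \int[leb]_x (tr k x * (fun=> 1) x)) = Z.
    by apply/funext => k; congr (Rintegral _ _ _); exact: E.
  by have -> : (fun x => p x * (fun=> 1) x) = p; [apply/funext => x; rewrite mulr1|rewrite p1].
have ml : measurable_fun setT (fun x => ln (p x)).
  by apply: measurableT_comp => //; exact: measurable_ln.
have [itl lc] := trint _ ml ipl.
pose h := \int[leb]_x (p x * ln (p x)).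
have n1 : (1 : R) != 0 by rewrite oner_neq0.
have C1 : \forall k \near \oo, 0 < Z k by apply: (cvgr_gt 1 Zc); rewrite ltr01.
have C2 : \forall k \near \oo, forall j,
    `|\int[leb]_x (p x * u j x) - (\int[leb]_x (tr k x * u j x)) / Z k| < e.
  apply: filter_forall_ord => j; have [_ uc] := trint _ (mu j) (ipu j).
  have uc' : (\int[leb]_x (tr k x * u j x)) / Z k @[k --> \oo] --> \int[leb]_x (p x * u j x) / 1.
    by apply: cvgM => //; exact: cvgV.
  by move: uc'; rewrite divr1 => /cvgrPdist_lt /(_ _ e0).
have C3 : \forall k \near \oo,
    `|h - ((\int[leb]_x (tr k x * ln (p x))) / Z k - ln (Z k))| < e.
  have uc' : (\int[leb]_x (tr k x * ln (p x))) / Z k - ln (Z k) @[k --> \oo] --> h / 1 - ln 1.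
    apply: cvgB; first by apply: cvgM => //; exact: cvgV.
    apply: (@cvg_comp _ _ _ Z (@ln R) _ (nbhs (1 : R))) => //.
    by apply: continuous_ln; exact: ltr01.
  by move: uc'; rewrite divr1 ln1 subr0 => /cvgrPdist_lt /(_ _ e0).
have [k [[Zk hu] hl]] := filter_ex (filterI (filterI C1 C2) C3).
pose p' x := (Z k)^-1 * tr k x.
have Zk' : 0 < (Z k)^-1 by rewrite invr_gt0.
have p'gt x : 0 < p' x -> 0 < tr k x by rewrite /p' pmulr_rgt0.
have lnp' x : 0 < p' x -> ln (p' x) = ln (p x) - ln (Z k).
  move=> /p'gt trx; have [_ E] := trE _ _ trx; rewrite /p' E.
  by rewrite lnM ?posrE -?E// lnV ?posrE//; ring.
(* The first term bounds [|x|], the others bound [|ln (p' x)| = |ln (p x) - ln (Z k)|]. *)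
exists (c k + (ln (c k) + `|ln (Z k)|)), p'; split.
- split.
  + exact: measurable_funM.
  + by move=> x; rewrite mulr_ge0// ltW.
  + exact: itgZ.
  + by rewrite intZ// -/(Z k) mulVf// gt_eqF.
- move=> x px; have := lnp' x px; have [[Ax1 Ax2] E] := trE _ _ (p'gt _ px).
  move: Ax1 Ax2 => /=; rewrite !in_itv/= -ler_norml => Ax /andP[Ap1 Ap2] ->.
  have px0 : 0 < p x by rewrite -E; exact: p'gt.
  have lnc : 0 <= ln (c k) by rewrite ln_ge0// /c ler1n.
  have := normr_ge0 (ln (Z k)); split; first by lra.
  have lp : `|ln (p x)| <= ln (c k).
    by rewrite ler_norml -lnV ?posrE// !ler_ln ?posrE// ?invr_gt0// Ap1 Ap2.
  by apply: le_trans (ler_normB _ _) _; have := ltW (c0 k); lra.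
- move=> j; rewrite distrC (_ : \int[leb]_x (p' x * u j x) = (\int[leb]_x (tr k x * u j x)) / Z k)//.
  rewrite mulrC -intZ; last by have [h1 _] := trint _ (mu j) (ipu j); exact: h1.
  by congr (Rintegral _ _ _); apply/funext => x; rewrite /p'; ring.
- have -> : (fun x => p' x * ln (p' x)) =
     (fun x => (Z k)^-1 * (tr k x * ln (p x)) - ln (Z k) / Z k * tr k x).
    apply/funext => x; have := tr0 k x; rewrite le_eqVlt => /predU1P[t0|t0].
      by rewrite /p' -t0; ring.
    by rewrite lnp'; [rewrite /p'; ring|rewrite /p' mulr_gt0].
  rewrite intB; [|exact: itgZ|exact: itgZ].
  rewrite !intZ// -/(Z k) divfK ?gt_eqF// [_^-1 * _]mulrC.
  by move: hl; rewrite ltr_norml -/h => /andP[? ?]; lra.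
Qed.

(** Convexity bounds the entropy integrand from above. From below, Young's inequality with exponent
    [- V] bounds it by [- p' V - exp (- V)], integrable by the moment assumption. *)
Lemma itg_mix_xlnx (V p q : R -> R) (t : R) : orlicz_fun V ->
  (forall x, 0 <= q x) -> (forall x, 0 <= p x) -> itg q -> itg p ->
  itg (fun x => q x * ln (q x)) -> itg (fun x => p x * ln (p x)) ->
  itg (fun x => q x * V x) -> itg (fun x => p x * V x) -> 0 < t -> t < 1 ->
  itg (fun x => (t * q x + (1 - t) * p x) * ln (t * q x + (1 - t) * p x)).
Proof.
move=> oV q0 p0 iq ip iql ipl iqV ipV t0 t1.
pose p' : R -> R := fun x => t * q x + (1 - t) * p x.
have p'0 x : 0 <= p' x by rewrite addr_ge0// mulr_ge0// ?subr_ge0 ltW.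
have N1 : (-1 : R) < 0 by rewrite oppr_lt0 ltr01.
have ip' : itg p' by apply: itgD; exact: itgZ.
have mp' : measurable_fun setT p' := itg_meas ip'.
have ip'V : itg (fun x => p' x * V x).
  have -> : (fun x => p' x * V x) = (fun x => t * (q x * V x) + (1 - t) * (p x * V x)).
    by apply/funext => x; rewrite /p'; ring.
  by apply: itgD; exact: itgZ.
apply: (leb_itg_le (g := fun x : R =>
   `|t * (q x * ln (q x)) + (1 - t) * (p x * ln (p x))| + (p' x * V x + expR (- 1 * V x)))).
- exact: (measurable_xlnx mp').
- apply: itgD.
    by apply: integrable_norm => //; apply: itgD; exact: itgZ.
  by apply: itgD => //; exact: itg_expRV.
- move=> x; have := xlnx_convex (q0 x) (p0 x) t0 t1.
  have := young_ln (- 1 * V x) (p'0 x); rewrite -/(p' x).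
  have := p'0 x; have := expR_ge0 (- 1 * V x).
  have : 0 <= p' x * V x by apply: mulr_ge0; [exact: p'0|exact: orlicz_ge0].
  set k := t * (q x * _) + _; have := ler_norm k; have := normr_ge0 k.
  by rewrite ler_norml => *; apply/andP; split; lra.
Qed.

(* Mixing with a uniform density concentrated near [0] makes the moment constraint
   strict. *)
Lemma density_mixing m (V p : R -> R) (u : 'I_m -> R -> R) (Rad e M : R) :
  orlicz_fun V -> 0 < Rad ->
  measurable_fun setT p -> (forall x, 0 <= p x) -> itg p -> \int[leb]_x p x = 1 ->
  itg (fun x => p x * ln (p x)) ->
  itg (fun x => p x * V x) -> \int[leb]_x (p x * V x) <= Rad ->
  (forall j, measurable_fun setT (u j)) -> (forall j, itg (fun x => p x * u j x)) ->
  (forall j x, `|x| <= 1 -> `|u j x| <= M) ->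
  0 < e ->
  exists p' : R -> R, [/\
    [/\ measurable_fun setT p', (forall x, 0 <= p' x), itg p' & \int[leb]_x p' x = 1],
    itg (fun x => p' x * ln (p' x)) /\ (forall j, itg (fun x => p' x * u j x)),
    itg (fun x => p' x * V x) /\ \int[leb]_x (p' x * V x) < Rad,
    (forall j, `|\int[leb]_x (p' x * u j x) - \int[leb]_x (p x * u j x)| < e) &
    \int[leb]_x (p' x * ln (p' x)) < \int[leb]_x (p x * ln (p x)) + e].
Proof.
move=> oV R0 mp p0 ip p1 ipl ipV pVR mu ipu uM e0.
have V1 := orlicz1_gt0 oV; have mV := orlicz_measurable oV.
(* On [[-r, r]] one has [V <= Rad / 2], and the functions [u j] are bounded by [M]. *)
pose r : R := Num.min 1 (Rad / 2 / V 1).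
have r0 : 0 < r by rewrite lt_min ltr01 !divr_gt0.
have r1 : r <= 1 by rewrite ge_min lexx.
pose I : set R := `[- r, r]%classic.
pose q : R -> R := fun x => (2 * r)^-1 * \1_I x.
have qI x : x \in I -> `|x| <= r by rewrite inE /I /= in_itv /= -ler_norml.
have r2 : 0 < (2 * r)^-1 by rewrite invr_gt0 mulr_gt0.
have q0 x : 0 <= q x by rewrite mulr_ge0 ?(ltW r2)// indicE.
have iI : itg (\1_I) by exact: itg_indic_itv.
have iq : itg q by exact: itgZ.
have mq : measurable_fun setT q by exact: itg_meas iq.
have q1 : \int[leb]_x q x = 1.
  by rewrite intZ// int_indic_itv; [field; rewrite gt_eqF|lra].
have iqv (v : R -> R) (C : R) : measurable_fun setT v ->
    (forall x, `|x| <= 1 -> `|v x| <= C) -> itg (fun x => q x * v x).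
  move=> mv vC; apply: (leb_itg_le (g := fun x : R => C * q x)); last 2 first.
  - exact: itgZ.
  - move=> x; rewrite normrM (ger0_norm (q0 x)) mulrC /q indicE.
    case: (boolP (x \in I)) => [/qI xr|_]; last by rewrite !mulr0.
    by rewrite mulr1 ler_wpM2r ?(ltW r2)// vC//; lra.
  - exact: measurable_funM.
have iqu j : itg (fun x => q x * u j x) by apply: (iqv _ M) => //; exact: uM.
have iqV : itg (fun x => q x * V x).
  apply: (iqv _ (V 1)) => // x x1; rewrite ger0_norm ?orlicz_ge0//.
  by apply: orlicz_mono => //; rewrite normr1.
have qVR : \int[leb]_x (q x * V x) <= Rad / 2.
  rewrite -[leRHS]mulr1 -[X in _ <= _ * X]q1 -intZ//; apply: int_le => //; first exact: itgZ.
  move=> x; rewrite /q indicE; case: (boolP (x \in I)) => [/qI xr|_]; last first.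
    by rewrite !(mulr0, mul0r).
  rewrite mulr1 mulrC ler_wpM2r ?(ltW r2)//.
  have x1 : `|x| <= 1 by lra.
  apply: le_trans (orlicz_le_lin oV x1) _; rewrite -ler_pdivlMr//.
  by apply: le_trans xr _; rewrite ge_min lexx orbT.
have qlE x : q x * ln (q x) = ln (2 * r)^-1 * q x.
  rewrite /q indicE; case: (x \in I); first by rewrite mulr1; ring.
  by rewrite !(mulr0, mul0r).
have iql : itg (fun x => q x * ln (q x)).
  have -> : (fun x => q x * ln (q x)) = (fun x => ln (2 * r)^-1 * q x) by apply/funext.
  exact: itgZ.
pose B : 'I_m -> R := fun j => \int[leb]_x (q x * u j x) - \int[leb]_x (p x * u j x).
pose H : R := \int[leb]_x (q x * ln (q x)) - \int[leb]_x (p x * ln (p x)).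
pose D : R := 1 + (\sum_j `|B j| + `|H|).
have S0 : 0 <= \sum_j `|B j| by apply: sumr_ge0.
have D0 : 0 < D by rewrite ltr_pwDl// addr_ge0.
(* [D] dominates the change of every functional between [p] and [q], so mixing with weight [t] moves
   each by less than [e]. *)
pose t : R := Num.min (1 / 2) (e / 2 / D).
have t0 : 0 < t by rewrite lt_min !divr_gt0.
have t1 : t < 1.
  by apply: (@le_lt_trans _ _ (1 / 2)); [rewrite ge_min lexx|lra].
have tD : t * D < e.
  apply: (@le_lt_trans _ _ (e / 2)); last lra.
  by rewrite -ler_pdivlMr// ge_min lexx orbT.
pose p' : R -> R := fun x => t * q x + (1 - t) * p x.
have p'0 x : 0 <= p' x by rewrite addr_ge0// mulr_ge0// ?subr_ge0 ltW.
have lin (v : R -> R) : itg (fun x => q x * v x) -> itg (fun x => p x * v x) ->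
    itg (fun x => p' x * v x) /\ \int[leb]_x (p' x * v x) =
      t * \int[leb]_x (q x * v x) + (1 - t) * \int[leb]_x (p x * v x) :> R.
  move=> h1 h2; have -> : (fun x => p' x * v x) =
      (fun x => t * (q x * v x) + (1 - t) * (p x * v x)).
    by apply/funext => x; rewrite /p'; ring.
  split; first by apply: itgD; exact: itgZ.
  by rewrite intD ?intZ//; exact: itgZ.
have ip' : itg p' by apply: itgD; exact: itgZ.
have mp' : measurable_fun setT p' := itg_meas ip'.
have ip'V := (lin V iqV ipV).1.
have iconv : itg (fun x => t * (q x * ln (q x)) + (1 - t) * (p x * ln (p x))).
  by apply: itgD; exact: itgZ.
have conv x : p' x * ln (p' x) <= t * (q x * ln (q x)) + (1 - t) * (p x * ln (p x)).
  exact: xlnx_convex.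
have ip'l : itg (fun x => p' x * ln (p' x)) by exact: (itg_mix_xlnx oV).
exists p'; split.
- split => //; rewrite intD; [|exact: itgZ|exact: itgZ].
  by rewrite (intZ t iq) (intZ (1 - t) ip) q1 p1; ring.
- by split => // j; have [] := lin _ (iqu j) (ipu j).
- by split => //; rewrite (lin V iqV ipV).2; exact: mix_lt.
- move=> j; have [_ ->] := lin _ (iqu j) (ipu j).
  rewrite (_ : _ - _ = t * B j); last by rewrite /B; ring.
  rewrite normrM (gtr0_norm t0); apply: le_lt_trans tD; rewrite ler_pM2l//.
  rewrite /D (bigD1 j)//=; have : 0 <= \sum_(i < m | i != j) `|B i| by apply: sumr_ge0.
  by have := normr_ge0 H; lra.
- apply: (@le_lt_trans _ _ (\int[leb]_x (t * (q x * ln (q x)) + (1 - t) * (p x * ln (p x))))).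
    exact: int_le.
  rewrite intD; [|exact: itgZ|exact: itgZ].
  rewrite (intZ t iql) (intZ (1 - t) ipl).
  have : t * H <= t * D by rewrite ler_pM2l// /D; have := ler_norm H; lra.
  by move=> tH; exact: mix_lt_add tH tD.
Qed.

End density_approximation.

Section volume_lower.
Context (R : realType) (V : R -> R) (Rad : R).
Hypothesis oV : orlicz_fun V.
Hypothesis R0 : 0 < Rad.
Local Notation leb := (@lebesgue_measure R).
Local Notation itg f := (leb.-integrable [set: R] (EFin \o f)).
Variable w : R -> R.
Hypothesis mw : measurable_fun setT w.
Hypothesis w0 : forall x, 0 <= w x.
Hypothesis wV : forall eta : R, 0 < eta -> exists C : R, forall x, w x <= eta * V x + C.

Lemma dist3 (x y z t e : R) : `|x - y| < e / 3 -> `|y - z| < e / 3 ->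
  `|z - t| < e / 3 -> `|x - t| < e.
Proof.
rewrite !ltr_norml => /andP[? ?] /andP[? ?] /andP[? ?].
by apply/andP; split; lra.
Qed.

Lemma volume_lower (mu : M1 R) (p : R -> R) k (f : 'I_k -> R -> R) (eps dl : R) :
  is_density mu leb p -> itg (fun x => p x * ln (p x)) ->
  mu.-integrable setT (EFin \o V) -> \int[mu]_x V x <= Rad ->
  (forall i, bounded_continuous (f i)) -> 0 < eps -> 0 < dl ->
  \forall n \near \oo,
    ((1 / 2 * expR (- (n%:R * (\int[leb]_x (p x * ln (p x)) + dl))))%:E <=
     vol n [set s | orlicz_ball V Rad n s /\
       exists nu, basic_nbhd (WD w) (Wh w) f eps mu nu /\ is_empirical s nu])%E.
Proof.
move=> dp ipl iV VR bf e0 dl0.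
have measV := orlicz_measurable oV.
have [ip p1] := lebesgue_density_int1 dp; have [mp p0 _] := dp.
have ipV : itg (fun x => p x * V x) by apply/(lebesgue_density_itg dp).
have pVR : \int[leb]_x (p x * V x) <= Rad by rewrite -(lebesgue_density_int dp iV).
have iw := weight_itg mw w0 wV iV.
have mf i : measurable_fun setT (f i).
  by apply: continuous_measurable_fun; case: (bf i).
have /choice[Mf fM] : forall i, exists M : R, forall x, `|f i x| <= M.
  by move=> i; case: (bf i).
have ifm i : mu.-integrable setT (EFin \o f i) by exact: (prob_itg mu (mf i) (fM i)).
pose MF : R := \sum_i `|Mf i|.
have fMF i x : `|f i x| <= MF.
  apply: le_trans (fM i x) _; rewrite /MF (bigD1 i)//=.
  have : 0 <= \sum_(j < k | j != i) `|Mf j| by apply: sumr_ge0.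
  by have := ler_norm (Mf i); lra.
have MF0 : 0 <= MF by apply: sumr_ge0.
have [C hC] := wV ltr01.
have wK (K x : R) : `|x| <= K -> `|w x| <= V K + `|C|.
  move=> xK; rewrite ger0_norm//; apply: le_trans (hC x) _; rewrite mul1r lerD ?ler_norm//.
  apply: orlicz_mono => //; apply: le_trans xK (ler_norm _).
have VK (K x : R) : `|x| <= K -> `|V x| <= V K.
  move=> xK; rewrite ger0_norm ?orlicz_ge0//; apply: orlicz_mono => //.
  exact: le_trans xK (ler_norm _).
pose u := ocons w f.
have mu_ j : measurable_fun setT (u j) by exact: oconsP.
have uK (K x : R) j : `|x| <= K -> `|u j x| <= V K + `|C| + MF.
  move=> xK; move: j; apply: (oconsP (P := fun v => `|v x| <= V K + `|C| + MF)) => [|i].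
    by have := wK _ _ xK; lra.
  have := fMF i x; have := normr_ge0 C; have := orlicz_ge0 oV K; lra.
have imu j : mu.-integrable setT (EFin \o u j).
  exact: (oconsP (P := fun v => mu.-integrable setT (EFin \o v))).
have ipu j : itg (fun x => p x * u j x).
  by apply/(lebesgue_density_itg dp).
(* The errors of mixing, truncation and sampling share [eps] for the test functions and [dl] for the
   entropy. *)
pose e1 : R := Num.min eps dl / 3.
have e10 : 0 < e1 by rewrite divr_gt0// lt_min e0.
have e1e : e1 <= eps / 3 by rewrite ler_pM2r ?invr_gt0// ge_min lexx.
have e1d : e1 <= dl / 3 by rewrite ler_pM2r ?invr_gt0// ge_min lexx orbT.
have [p2 [[mp2 p20 ip2 p21] [ip2l ip2u] [ip2V p2V] p2u p2h]] :=
  density_mixing oV R0 mp p0 ip p1 ipl ipV pVR mu_ ipu (fun j x => uK 1 x j) e10.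
pose gap : R := Rad - \int[leb]_x (p2 x * V x).
have gap0 : 0 < gap by rewrite subr_gt0.
pose u2 := ocons V u.
have mu2 j : measurable_fun setT (u2 j) by exact: oconsP.
have ip2u2 j : itg (fun x => p2 x * u2 j x).
  exact: (oconsP (P := fun v => itg (fun x => p2 x * v x))).
(* Truncation and sampling together move the [V]-average by less than the slack [gap] won by mixing,
   so the sampled points stay in the ball. *)
pose e2 : R := Num.min e1 (gap / 2).
have e20 : 0 < e2 by rewrite lt_min e10 divr_gt0.
have e21 : e2 <= e1 by rewrite ge_min lexx.
have e2g : e2 <= gap / 2 by rewrite ge_min lexx orbT.
have [K [p3 [[mp3 p30 ip3 p31] p3K p3u p3h]]] :=
  density_truncation mp2 p20 ip2 p21 ip2l mu2 ip2u2 e20.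
pose g := ocons (fun x => ln (p3 x)) u2.
have ml3 : measurable_fun setT (fun x => ln (p3 x)).
  by apply: measurableT_comp => //; exact: measurable_ln.
have mg j : measurable_fun setT (g j) by exact: oconsP.
have gM j x : 0 < p3 x -> `|g j x| <= `|K| + (V K + `|C| + MF).
  move=> /p3K[xK lK]; have VK0 := orlicz_ge0 oV K; have C0 := normr_ge0 C.
  have K0 := ler_norm K.
  move: j; apply: (oconsP (P := fun v => `|v x| <= `|K| + (V K + `|C| + MF))) => [|j].
    by lra.
  have K1 := normr_ge0 K.
  move: j; apply: (oconsP (P := fun v => `|v x| <= `|K| + (V K + `|C| + MF))) => [|j].
    by have := VK _ _ xK; lra.
  by have := uK _ _ j xK; lra.
have g0 x : 0 < p3 x -> g ord0 x = ln (p3 x) by rewrite /g ocons0.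
have hH : \int[leb]_x (p3 x * g ord0 x) + e2 <= \int[leb]_x (p x * ln (p x)) + dl.
  rewrite /g ocons0; move: p3h p2h; lra.
pose S n : set (seq R) := [set s | orlicz_ball V Rad n s /\
       exists nu, basic_nbhd (WD w) (Wh w) f eps mu nu /\ is_empirical s nu].
have main := @volume_weak_law R _ g p3 _ e2 S mp3 p30 ip3 p31 mg gM g0 e20.
have {}main := main _.
apply: filterS (main _) => [n h|].
  apply: le_trans h; rewrite lee_fin ler_pM2l//; rewrite ler_expR lerN2.
  by rewrite ler_wpM2l.
move=> n s n0 sn spos sg.
have n0' : 0 < n%:R :> R by rewrite ltr0n.
have avg (v : R -> R) (c : R) : `|\sum_(x <- s) v x - n%:R * c| < n%:R * e2 ->
    `|n%:R^-1 * \sum_(x <- s) v x - c| < e2.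
  move=> h; have -> : n%:R^-1 * \sum_(x <- s) v x - c = n%:R^-1 * (\sum_(x <- s) v x - n%:R * c).
    by field; rewrite gt_eqF.
  by rewrite normrM normfV (gtr0_norm n0') ltr_pdivrMl.
have sV : `|n%:R^-1 * \sum_(x <- s) V x - \int[leb]_x (p3 x * V x)| < e2.
  by apply: avg; have := sg (lift ord0 ord0); rewrite /g oconsS /u2 ocons0.
have su j : `|n%:R^-1 * \sum_(x <- s) u j x - \int[leb]_x (p3 x * u j x)| < e2.
  by apply: avg; have := sg (lift ord0 (lift ord0 j)); rewrite /g oconsS /u2 oconsS.
have su' j : `|n%:R^-1 * \sum_(x <- s) u j x - \int[mu]_x u j x| < eps.
  rewrite (lebesgue_density_int dp (imu j)).
  apply: (dist3 (y := \int[leb]_x (p3 x * u j x)) (z := \int[leb]_x (p2 x * u j x))).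
  - by apply: lt_le_trans (su j) _; lra.
  - by have := p3u (lift ord0 j); rewrite /u2 oconsS => h; apply: lt_le_trans h _; lra.
  - by apply: lt_le_trans (p2u j) _; lra.
split.
  split => //; have := p3u ord0; rewrite /u2 ocons0; move: sV.
  rewrite !ltr_norml => /andP[_ h1] /andP[_ h2].
  have h3 : n%:R^-1 * \sum_(x <- s) V x < Rad by move: h1 h2; rewrite /gap in e2g; lra.
  by move: h3; rewrite ltr_pdivrMl// mulrC => /ltW.
have s0 : (0 < size s)%N by rewrite sn.
have [nu [es _]] := empirical_measure s0.
exists nu; split => //; split.
  by rewrite /WD /= /mV (empirical_ge0_integral es)// ltry.
split => [i|].
  have := su' (lift ord0 i); rewrite /u oconsS.
  by have := empirical_integral es (mf i); rewrite sn => <-.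
have := su' ord0; rewrite /u ocons0.
by have := empirical_integral es mw; rewrite sn => <-.
Qed.

End volume_lower.

(** * The large deviation principle *)

Section elog_lemmas.
Context (R : realType).
Implicit Types x y : R.

Lemma elog_ge x y : 0 < y -> y <= x -> ((ln y)%:E <= elog x%:E)%E.
Proof.
by move=> y0 yx; rewrite /= (lt_le_trans y0 yx) lee_fin ler_ln ?posrE// (lt_le_trans y0).
Qed.

Lemma elog_le x y : 0 < y -> x <= y -> (elog x%:E <= (ln y)%:E)%E.
Proof.
move=> y0 xy /=; case: ltP => // x0; last by rewrite leNye.
by rewrite lee_fin ler_ln ?posrE.
Qed.

Lemma near_div_le (C e : R) : 0 < e -> \forall n \near \oo, (0 < n)%N /\ C / n%:R <= e.
Proof.
move=> e0; have := near_infty_natr (`|C| / e + 1); apply: filterS => n hn.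
have Ce : 0 <= `|C| / e by rewrite divr_ge0// ltW.
have n0 : 0 < n%:R :> R by lra.
split; first by rewrite -(ltr0n R).
rewrite ler_pdivrMr//; apply: le_trans (ler_norm C) _.
by rewrite -ler_pdivrMl// mulrC; lra.
Qed.

End elog_lemmas.

Section zero_integral.
Context (R : realType).
Local Notation leb := (@lebesgue_measure R).
Local Notation itg f := (leb.-integrable [set: R] (EFin \o f)).

Lemma int_le0_ae (f : R -> R) : (forall x, 0 <= f x) -> itg f ->
  \int[leb]_x f x <= 0 -> {ae leb, forall x, f x = 0}.
Proof.
move=> f0 itf fle; have mf := itg_meas itf.
have mf' : measurable_fun setT (EFin \o f) by exact/measurable_EFinP.
have := ae_eq_integral_abs leb measurableT mf'.
have E : (\int[leb]_x `|(EFin \o f) x| = 0)%E.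
  under eq_integral do rewrite /= ger0_norm//.
  rewrite itgE//; congr EFin; apply/eqP; rewrite eq_le fle/=.
  exact: Rintegral_ge0.
by move=> [/(_ E) + _]; apply: filterS => x /(_ I) [].
Qed.

End zero_integral.

Section main.
Context (R : realType) (V : R -> R) (Rad a : R) (G : M1 R).
Hypothesis oV : orlicz_fun V.
Hypothesis R0 : 0 < Rad.
Hypothesis a0 : a < 0.
Hypothesis GE : G = gibbs V a :> (set R -> \bar R).
Hypothesis crit : \int[@lebesgue_measure R]_x ((V x - Rad) * expR (a * V x)) = 0.
Local Notation leb := (@lebesgue_measure R).
Local Notation itg f := (leb.-integrable [set: R] (EFin \o f)).
Local Notation phi := (free_energy V Rad).
Local Notation Z := (partition_fun V).
Local Notation B n := (vol n (orlicz_ball V Rad n)).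

Lemma gibbs_moment : G.-integrable setT (EFin \o V) /\ \int[G]_x V x = Rad.
Proof.
have dG : is_density G leb (fun x => expR (a * V x) / Z a) by rewrite GE; exact: gibbs_density.
have Z0 := partition_gt0 oV a0; have measV := orlicz_measurable oV.
have iVe := itg_VexpRV oV a0; have ie := itg_expRV oV a0.
have E : (fun x => expR (a * V x) / Z a * V x) = (fun x => (Z a)^-1 * (V x * expR (a * V x))).
  by apply/funext => x; ring.
have iG : G.-integrable setT (EFin \o V).
  by apply/(lebesgue_density_itg dG) => //; rewrite E; exact: itgZ.
split => //; rewrite (lebesgue_density_int dG iG) E intZ//.
move: crit; have -> : (fun x => (V x - Rad) * expR (a * V x)) =
    (fun x => V x * expR (a * V x) - Rad * expR (a * V x)) by apply/funext => x; ring.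
rewrite intB ?intZ//; last exact: itgZ.
rewrite -/(Z a) => /eqP; rewrite subr_eq0 => /eqP ->.
by rewrite mulrC mulfK// gt_eqF.
Qed.

Lemma rate_gibbs : rate_IV V Rad a G = 0%E.
Proof.
have [iV VR] := gibbs_moment.
have d1 : is_density G G (fun=> 1).
  by split => // A mA; rewrite integral_cst// mul1e.
have i1 : G.-integrable setT (EFin \o (fun=> 1 * ln 1)) by exact: prob_itg_cst.
rewrite (rate_val GE d1 i1 iV); last by rewrite VR.
by rewrite prob_int_cst VR ln1 mulr0 subrr mulr0 addr0.
Qed.

Lemma gibbs_entropy : exists p, [/\ is_density G leb p,
  itg (fun x => p x * ln (p x)) & \int[leb]_x (p x * ln (p x)) = - phi a].
Proof.
have h : (rate_IV V Rad a G < +oo)%E by rewrite rate_gibbs ltry.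
have [p [dp ip _ _ E]] := rate_fin_lebesgue oV a0 GE h.
exists p; split => //; move: E; rewrite rate_gibbs => -[] E.
by apply/eqP; rewrite -addr_eq0 -E.
Qed.

(** On the ball the product of [exp (a V)] is at least [exp (n a Rad)], since [a < 0]. *)
Lemma ball_upper n : (B n <= (expR (n%:R * phi a))%:E)%E.
Proof.
have Z0 := partition_gt0 oV a0.
have := @vol_le R n 1 (orlicz_ball V Rad n) (fun=> expR (- (n%:R * (a * Rad))))
  (fun _ x => expR (a * V x)) (fun _ => expR_ge0 _) (fun _ _ => expR_ge0 _) (fun _ => itg_expRV oV a0).
move=> /(_ _)/le_trans; apply => [s sn [_ sR]|].
  rewrite big_ord1 -expR_sum -expRD -[leLHS]expR0 ler_expR -mulr_sumr.
  by have := ler_wnM2l (ltW a0) sR; lra.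
rewrite big_ord1 lee_fin -/(Z a) -{1}(lnK (x := Z a)) ?posrE//.
by rewrite -expRM_natl -expRD ler_expR /free_energy; lra.
Qed.

(** The general lower bound at [G], with zero weight and no test function; the entropy integral of
    [G] is [- phi a] because its rate vanishes. *)
Lemma ball_lower (dl : R) : 0 < dl ->
  \forall n \near \oo, ((1 / 2 * expR (n%:R * (phi a - dl)))%:E <= B n)%E.
Proof.
move=> dl0; have [p [dp ip E]] := gibbs_entropy; have [iV VR] := gibbs_moment.
have wV0 (eta : R) : 0 < eta -> exists C : R, forall x : R, (fun=> 0) x <= eta * V x + C.
  by move=> eta0; exists 0 => x; rewrite addr0; exact: mulr_ge0 (ltW eta0) (orlicz_ge0 oV x).
have := @volume_lower R V Rad oV R0 (fun=> 0) (measurable_cst _) (fun=> lexx 0) wV0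
  G p 0 (fun i _ => 0) 1 dl dp ip iV.
move=> /(_ _ _ ltr01 dl0)H; apply: filterS (H _ _).
- move=> n h; apply: (le_trans (le_trans _ h)).
    by rewrite E lee_fin ler_pM2l// ler_expR; lra.
  by apply: vol_mono => s [].
- by rewrite VR.
- by case.
Qed.

Lemma ball_fine n : B n = (fine (B n))%:E.
Proof.
rewrite fineK// ge0_fin_numE; last exact: vol_ge0.
exact: le_lt_trans (ball_upper n) (ltry _).
Qed.

Definition ball_event n (A : set (M1 R)) : set (seq R) :=
  [set s | orlicz_ball V Rad n s /\ exists mu, A mu /\ is_empirical s mu].

Lemma event_fine n A : vol n (ball_event n A) = (fine (vol n (ball_event n A)))%:E.
Proof.
rewrite fineK// ge0_fin_numE; last exact: vol_ge0.
apply: le_lt_trans (vol_mono _ _) (le_lt_trans (ball_upper n) (ltry _)).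
by move=> s [].
Qed.

Lemma emp_lawE n A : emp_law V Rad n A =
  (fine (vol n (ball_event n A)) / fine (B n))%:E.
Proof. by rewrite /emp_law -/(ball_event n A) event_fine -EFinM. Qed.

Section with_weight.
Variable w : R -> R.
Hypothesis mw : measurable_fun setT w.
Hypothesis w0 : forall x, 0 <= w x.
Hypothesis wV : forall eta : R, 0 < eta -> exists C : R, forall x, w x <= eta * V x + C.
Local Notation D := (WD w).
Local Notation h := (Wh w).
Local Notation I := (rate_IV V Rad a).

(** The volume of a neighbourhood of [mu] inside [U] is divided by the upper bound for the ball; the
    factor [1/2] costs [ln 2 / n]. *)
Lemma lower_bound (U : set (M1 R)) (mu : M1 R) (r dl : R) :
  sp_open D h U -> U mu -> I mu = r%:E -> 0 < dl ->
  \forall n \near \oo, ((- (r + dl))%:E <= (n%:R^-1)%:E * elog (emp_law V Rad n U))%E.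
Proof.
move=> oU Umu Imu dl0.
have [p [dp ip iV VR E]] : exists p, [/\ is_density mu leb p, itg (fun x => p x * ln (p x)),
      mu.-integrable setT (EFin \o V), \int[mu]_x V x <= Rad &
      rate_IV V Rad a mu = (\int[leb]_x (p x * ln (p x)) + phi a)%:E].
  by apply: (rate_fin_lebesgue oV a0 GE); rewrite Imu ltry.
have [_ /(_ _ Umu)[k [f [eps [bf e0 sub]]]]] := oU.
have rE : r = \int[leb]_x (p x * ln (p x)) + phi a by move: E; rewrite Imu => -[].
have d2 : 0 < dl / 2 by lra.
have V1 := volume_lower oV R0 mw w0 wV dp ip iV VR bf e0 d2.
have N1 := near_div_le (ln 2) d2.
have B1 := ball_lower d2.
apply: filterS (filterI V1 (filterI N1 B1)) => n [v1 [[n0 n1] b1]].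
have n0' : 0 < n%:R :> R by rewrite ltr0n.
have Bpos : 0 < fine (B n).
  rewrite -lte_fin -ball_fine; apply: lt_le_trans b1.
  by rewrite lte_fin mulr_gt0// expR_gt0.
have v2 : 1 / 2 * expR (- (n%:R * (\int[leb]_x (p x * ln (p x)) + dl / 2))) <=
    fine (vol n (ball_event n U)).
  rewrite -lee_fin -event_fine; apply: le_trans v1 _.
  by apply: vol_mono => s [bs [nu [Nnu es]]]; split => //; exists nu; split => //; exact: sub.
have b2 : fine (B n) <= expR (n%:R * phi a) by rewrite -lee_fin -ball_fine; exact: ball_upper.
rewrite emp_lawE.
have x0 : 0 < 1 / 2 * expR (- (n%:R * (r + dl / 2))) by rewrite mulr_gt0// expR_gt0.
have le1 : 1 / 2 * expR (- (n%:R * (r + dl / 2))) <= fine (vol n (ball_event n U)) / fine (B n).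
  rewrite ler_pdivlMr//; apply: le_trans v2.
  apply: (@le_trans _ _ (1 / 2 * expR (- (n%:R * (r + dl / 2))) * expR (n%:R * phi a))).
    by rewrite ler_wpM2l// ltW.
  rewrite -mulrA -expRD ler_pM2l// ler_expR rE; lra.
apply: le_trans (lee_wpmul2l _ (elog_ge x0 le1)); last by rewrite lee_fin invr_ge0 ltW.
rewrite -EFinM lee_fin lnM ?posrE ?expR_gt0// expRK ln_div ?posrE// ln1 sub0r.
have -> : n%:R^-1 * (- ln 2 + - (n%:R * (r + dl / 2))) = - (ln 2 / n%:R) - (r + dl / 2).
  by field; rewrite gt_eqF.
by lra.
Qed.

Lemma upper_bound (A : set (M1 R)) (c dl : R) : 0 < dl ->
  (c%:E < ereal_inf (I @` sp_closure D h A))%E ->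
  \forall n \near \oo, ((n%:R^-1)%:E * elog (emp_law V Rad n (sp_closure D h A)) <= (- c + dl)%:E)%E.
Proof.
move=> dl0 cinf.
have [m [U [hU cov]]] := closure_cover oV a0 GE mw w0 wV R0 cinf.
have d2 : 0 < dl / 2 by lra.
(* The cover may be empty; [m + 1] in place of [m] keeps the argument of the logarithm positive. *)
have N1 := near_div_le (ln (2 * m.+1%:R)) d2.
have B1 := ball_lower d2.
apply: filterS (filterI N1 B1) => n [[n0 n1] b1].
have n0' : 0 < n%:R :> R by rewrite ltr0n.
have m0 : 0 < m.+1%:R :> R by rewrite ltr0n.
have b2 : 1 / 2 * expR (n%:R * (phi a - dl / 2)) <= fine (B n) by rewrite -lee_fin -ball_fine.
have b0 : 0 < 1 / 2 * expR (n%:R * (phi a - dl / 2)) by rewrite mulr_gt0// expR_gt0.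
have Bpos : 0 < fine (B n) by apply: lt_le_trans b2.
have v1 : fine (vol n (ball_event n (sp_closure D h A))) <= m.+1%:R * expR (n%:R * (phi a - c)).
  rewrite -lee_fin -event_fine.
  apply: (@le_trans _ _ (m%:R * expR (n%:R * (phi a - c)))%:E); last first.
    by rewrite lee_fin ler_pM2r ?expR_gt0// ler_nat.
  apply: le_trans (volume_halfspaces oV a0 GE n hU).
  apply: vol_mono => s [bs [mu [Amu es]]]; split => //; exists mu; split => //.
  by apply: cov => //; exact: empirical_ball_mV bs es.
rewrite emp_lawE.
have y0 : 0 < 2 * m.+1%:R * expR (- (n%:R * (c - dl / 2))) by rewrite !mulr_gt0// expR_gt0.
have le1 : fine (vol n (ball_event n (sp_closure D h A))) / fine (B n) <=
    2 * m.+1%:R * expR (- (n%:R * (c - dl / 2))).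
  rewrite ler_pdivrMr//; apply: le_trans v1 _.
  apply: (@le_trans _ _ (2 * m.+1%:R * expR (- (n%:R * (c - dl / 2))) *
      (1 / 2 * expR (n%:R * (phi a - dl / 2))))); last by rewrite ler_pM2l.
  have -> : 2 * m.+1%:R * expR (- (n%:R * (c - dl / 2))) * (1 / 2 * expR (n%:R * (phi a - dl / 2))) =
    m.+1%:R * (expR (- (n%:R * (c - dl / 2))) * expR (n%:R * (phi a - dl / 2))) by field.
  by rewrite ler_pM2l// -expRD ler_expR; lra.
apply: le_trans (lee_wpmul2l _ (elog_le y0 le1)) _; first by rewrite lee_fin invr_ge0 ltW.
rewrite -EFinM lee_fin lnM ?posrE ?expR_gt0 ?mulr_gt0// expRK.
have -> : n%:R^-1 * (ln (2 * m.+1%:R) + - (n%:R * (c - dl / 2))) =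
    ln (2 * m.+1%:R) / n%:R - (c - dl / 2).
  by field; rewrite gt_eqF.
by lra.
Qed.

Lemma sp_interior_open (A : set (M1 R)) : A `<=` D -> sp_open D h (sp_interior D h A).
Proof.
move=> AD; split.
  by move=> mu [U [_ Umu UA]]; exact/AD/UA.
move=> mu [U [[UD oU] Umu UA]]; have [k [f [eps [bf e0 sub]]]] := oU _ Umu.
exists k, f, eps; split => // nu /sub Unu; exists U; split => //; by split.
Qed.

Lemma LDP_weighted : LDP D h (emp_law V Rad) I.
Proof.
split; first exact: (rate_good oV a0 GE mw w0 wV R0).
move=> A AD; split.
  rewrite leeNl; apply: le_ereal_inf_tmp => _ [mu intA <-].
  have [Ifin|Iinf] := ltP (I mu) +oo%E; last exact: le_trans (leey _) Iinf.
  have [p [_ _ _ _ E]] := rate_fin_lebesgue oV a0 GE Ifin.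
  rewrite E leeNl; apply/lee_subgt0Pr => e e0.
  apply: limn_einf_ge_near.
  apply: filterS (lower_bound (sp_interior_open AD) intA E e0) => n.
  by rewrite opprD EFinB EFinN.
set L := limn_esup _; set J := ereal_inf _.
have key (c : R) : (c%:E < J)%E -> (L <= (- c)%:E)%E.
  move=> cJ; apply/lee_addgt0Pr => e e0.
  by apply: limn_esup_le_near; exact: (upper_bound e0 cJ).
have J0 : (0 <= J)%E.
  by apply: le_ereal_inf_tmp => _ [mu _ <-]; exact: (rate_ge0 Rad oV a0 GE).
clearbody L J; case: J J0 key => [j| |] J0 key //.
  apply/lee_addgt0Pr => e e0; rewrite -EFinN -EFinD addrC -opprB.
  by apply: key; rewrite lte_fin ltrBlDr ltrDl.
(* When the infimum is [+oo], every [c] is admissible; this one gives [L <= L - 1] for real [L]. *)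
have h1 := key _ (ltry (1 - fine L)).
case: L h1 key => [l| |] //= h1 key.
  by exfalso; move: h1; rewrite lee_fin; lra.
Qed.

End with_weight.

Lemma weak_WD : @weakD R = WD (fun=> 0).
Proof.
apply/seteqP; split => mu // _; rewrite /WD /= /mV.
by rewrite integral0 ltry.
Qed.

Lemma weak_Wh : @weakh R = Wh (fun=> 0).
Proof. by apply/funext => mu; rewrite /Wh /mV integral0. Qed.

Lemma LDP_weak : LDP (@weakD R) (@weakh R) (emp_law V Rad) (rate_IV V Rad a).
Proof.
rewrite weak_WD weak_Wh; apply: LDP_weighted => // eta eta0.
by exists 0 => x; rewrite addr0; exact: mulr_ge0 (ltW eta0) (orlicz_ge0 oV x).
Qed.

(* [e^X - 1 - X >= 0] with [X = (b - a) (V - Rad)], integrated against [e^{aV}]. *)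
Lemma free_energy_min (b : R) : b < 0 -> phi b <= phi a -> b = a.
Proof.
have Rad2 : Rad / 2 < Rad by move: R0; lra.
move=> b0 ba; apply/eqP; apply: contraT => neq; exfalso.
have Za := partition_gt0 oV a0; have Zb := partition_gt0 oV b0.
pose X x := (b - a) * (V x - Rad).
pose F x := expR (a * V x) * (expR (X x) - 1 - X x).
have F0 x : 0 <= F x.
  by rewrite mulr_ge0 ?expR_ge0//; have := expR_ge1Dx (X x); lra.
have FE : F = (fun x => expR (- (b - a) * Rad) * expR (b * V x) - expR (a * V x)
    - (b - a) * ((V x - Rad) * expR (a * V x))).
  apply/funext => x; rewrite /F /X -expRD.
  rewrite mulrBr mulrBr mulr1 -expRD.
  have -> : a * V x + (b - a) * (V x - Rad) = - (b - a) * Rad + b * V x by ring.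
  by ring.
have ia := itg_expRV oV a0; have ib := itg_expRV oV b0.
have iVa : itg (fun x => (V x - Rad) * expR (a * V x)).
  have -> : (fun x => (V x - Rad) * expR (a * V x)) =
    (fun x => V x * expR (a * V x) - Rad * expR (a * V x)) by apply/funext => x; ring.
  by apply: itgB; [exact: itg_VexpRV|exact: itgZ].
have iF : itg F.
  rewrite FE; apply: itgB; last exact: itgZ.
  by apply: itgB => //; exact: itgZ.
(* The critical equation removes the linear term, so the integral is
   [exp (- (b - a) Rad) Z b - Z a], which is nonpositive exactly when [phi b <= phi a]. *)
have Fle : \int[leb]_x F x <= 0.
  rewrite FE intB; [|by apply: itgB => //; exact: itgZ|exact: itgZ].
  rewrite intB//; last exact: itgZ.
  rewrite (intZ _ iVa) crit mulr0 subr0 intZ// -/(Z a) -/(Z b) subr_le0.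
  rewrite -[leRHS]lnK ?posrE// -[X in _ * X]lnK ?posrE// -expRD ler_expR.
  by move: ba; rewrite /free_energy; lra.
have [N [mN N0 sub]] := int_le0_ae F0 iF Fle.
pose r := Num.min 1 (Rad / 2 / V 1).
have V1 := orlicz1_gt0 oV.
have r0 : 0 < r by rewrite lt_min ltr01 !divr_gt0.
(* Near [0] one has [V <= Rad / 2 < Rad], so [X] does not vanish and [F > 0]; but [F] vanishes off
   the null set [N], which would then contain an interval. *)
have IN (x : R) : `|x| <= r -> N x.
  move=> xr; apply: sub => /= Fx.
  have x1 : `|x| <= 1 by apply: le_trans xr _; rewrite ge_min lexx.
  have VR : V x <= Rad / 2.
    apply: le_trans (orlicz_le_lin oV x1) _; rewrite -ler_pdivlMr//.
    by apply: le_trans xr _; rewrite ge_min lexx orbT.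
  have Xn : X x != 0.
    apply: mulf_neq0; rewrite subr_eq0//.
    by rewrite lt_eqF//; exact: le_lt_trans VR Rad2.
  have : 0 < F x by rewrite mulr_gt0 ?expR_gt0//; have := expR_gt1Dx Xn; lra.
  by rewrite Fx ltxx.
pose J : set R := `[- r, r]%classic.
have : (leb J <= leb N)%E.
  apply: le_measure.
  - by rewrite inE; exact: measurable_itv.
  - by rewrite inE.
  - by move=> x; rewrite /J /= in_itv/= -ler_norml; exact: IN.
rewrite N0 /J lebesgue_measure_itv/= lte_fin gtrN// -EFinB lee_fin.
by lra.
Qed.

Lemma empirical_all n : (0 < n)%N -> ball_event n setT = orlicz_ball V Rad n.
Proof.
move=> n0; apply/seteqP; split => s; first by move=> [].
move=> bs; split => //; have sn : (0 < size s)%N by case: bs => ->.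
by have [mu [es _]] := empirical_measure sn; exists mu.
Qed.

(** On the whole space the probability is eventually [1], so the upper bound makes the infimum of
    the rate at [b] nonpositive. Where finite, this rate is the one at [a] plus [phi b - phi a],
    hence [phi b <= phi a]. *)
Lemma critical_unique (b : R) : b < 0 ->
  LDP (@weakD R) (@weakh R) (emp_law V Rad) (rate_IV V Rad b) -> b = a.
Proof.
move=> b0 [_ /(_ setT (fun _ _ => Logic.I))[_ ub]].
have clT : sp_closure (@weakD R) (@weakh R) setT = setT.
  by apply/seteqP; split => // mu _; split => // U _ Umu; exists mu.
rewrite clT in ub.
have L0 : (0 <= limn_esup (fun n => (n%:R^-1)%:E * elog (emp_law V Rad n setT)))%E.
  apply: le_trans (limn_einf_sup _); apply: limn_einf_ge_near.
  apply: filterS (filterI (ball_lower ltr01) (@near_div_le R 0 1 ltr01)) => n [b1 [n0 _]].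
  have Bpos : 0 < fine (B n).
    rewrite -lte_fin -ball_fine; apply: lt_le_trans b1.
    by rewrite lte_fin mulr_gt0// expR_gt0.
  by rewrite emp_lawE empirical_all// divff ?gt_eqF//= ltr01 ln1 mule0.
have inf0 : (ereal_inf (rate_IV V Rad b @` setT) <= 0)%E.
  by have := le_trans L0 ub; rewrite leeNr oppe0.
have [Gb GbE] := gibbs_probability oV b0.
have infge : ((phi b - phi a)%:E <= ereal_inf (rate_IV V Rad b @` setT))%E.
  apply: le_ereal_inf_tmp => _ [mu _ <-].
  have [Ifin|Iinf] := ltP (rate_IV V Rad b mu) +oo%E; last exact: le_trans (leey _) Iinf.
  have [p [dp ip iV VR ->]] := rate_fin_lebesgue oV b0 GbE Ifin.
  have := rate_ge0 Rad oV a0 GE mu; rewrite (rate_val_lebesgue oV a0 GE dp ip iV VR).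
  by rewrite !lee_fin; lra.
apply: free_energy_min => //.
by have := le_trans infge inf0; rewrite lee_fin; lra.
Qed.

(** In terms of Lebesgue densities only the integral of [p ln p] is not constant. Without strict
    inequality the nonnegative convexity gap would vanish almost everywhere, the densities would
    agree, and so would the measures. *)
Lemma rate_strictly_convex : strictly_convex_rate (rate_IV V Rad a).
Proof.
move=> mu nu rho t /andP[t0 t1] rhoE [A0 [mA0 neq]] Imu Inu.
have mixD (x y z c : R) : x < t * y + (1 - t) * z ->
    x + c < t * (y + c) + (1 - t) * (z + c) by lra.
have [p [dp ipl iV VR ->]] := rate_fin_lebesgue oV a0 GE Imu.
have [q [dq iql iV' VR' ->]] := rate_fin_lebesgue oV a0 GE Inu.
have measV := orlicz_measurable oV.
have [ip p1] := lebesgue_density_int1 dp; have [iq q1] := lebesgue_density_int1 dq.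
have := dp => /lebesgue_densityP[mp p0 pP]; have := dq => /lebesgue_densityP[mq q0 qP].
have ipV : itg (fun x => p x * V x) by apply/(lebesgue_density_itg dp).
have iqV : itg (fun x => q x * V x) by apply/(lebesgue_density_itg dq).
rewrite (lebesgue_density_int dp iV) in VR; rewrite (lebesgue_density_int dq iV') in VR'.
pose m x := t * p x + (1 - t) * q x.
have t1' : 0 <= 1 - t by rewrite subr_ge0 ltW.
have m0 x : 0 <= m x by rewrite addr_ge0// mulr_ge0// ltW.
have im : itg m by apply: itgD; exact: itgZ.
have mm : measurable_fun setT m := itg_meas im.
have dm : is_density rho leb m.
  apply/lebesgue_densityP; split => // A mA; rewrite rhoE// pP// qP//.
  under [RHS]eq_integral do rewrite EFinD !EFinM.
  have mpA : measurable_fun A (EFin \o p) by apply/measurable_funTS/measurable_EFinP.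
  have mqA : measurable_fun A (EFin \o q) by apply/measurable_funTS/measurable_EFinP.
  rewrite ge0_integralD//=.
  - rewrite !ge0_integralZl//=.
    + by move=> x _; rewrite lee_fin.
    + by move=> x _; rewrite lee_fin.
    + by rewrite lee_fin ltW.
  - by move=> x _; rewrite -EFinM lee_fin mulr_ge0// ltW.
  - by apply: emeasurable_funM.
  - by move=> x _; rewrite -EFinM lee_fin mulr_ge0.
  - by apply: emeasurable_funM.
have mVE : (fun x => m x * V x) = (fun x => t * (p x * V x) + (1 - t) * (q x * V x)).
  by apply/funext => x; rewrite /m; ring.
have imV : itg (fun x => m x * V x) by rewrite mVE; apply: itgD; exact: itgZ.
have iVr : rho.-integrable setT (EFin \o V) by apply/(lebesgue_density_itg dm).
have VRr : \int[rho]_x V x <= Rad.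
  rewrite (lebesgue_density_int dm iVr) mVE intD; [|exact: itgZ|exact: itgZ].
  rewrite (intZ t ipV) (intZ (1 - t) iqV).
  have h1 := ler_wpM2l (ltW t0) VR; have h2 := ler_wpM2l t1' VR'.
  by apply: le_trans (lerD h1 h2) _; lra.
have iml : itg (fun x => m x * ln (m x)) by exact: (itg_mix_xlnx oV).
rewrite (rate_val_lebesgue oV a0 GE dm iml iVr VRr) -!EFinM -EFinD lte_fin.
pose K x := t * (p x * ln (p x)) + (1 - t) * (q x * ln (q x)).
have iK : itg K by apply: itgD; exact: itgZ.
have KE : \int[leb]_x K x = t * \int[leb]_x (p x * ln (p x)) + (1 - t) * \int[leb]_x (q x * ln (q x)).
  by rewrite intD ?(intZ t ipl) ?(intZ (1 - t) iql)//; exact: itgZ.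
apply: mixD; rewrite -KE.
rewrite ltNge; apply/negP => Kle; apply: neq.
have gap0 x : 0 <= K x - m x * ln (m x) by rewrite subr_ge0; exact: xlnx_convex.
have igap : itg (fun x => K x - m x * ln (m x)) by exact: itgB.
have gapE : \int[leb]_x (K x - m x * ln (m x)) <= 0 by rewrite intB// subr_le0.
have pq : {ae leb, forall x, p x = q x}.
  have [N [mN N0 sub]] := int_le0_ae gap0 igap gapE.
  exists N; split => // x /= /eqP xy; apply: sub => /= Kx.
  have := xlnx_strictly_convex (p0 x) (q0 x) t0 t1 xy.
  by rewrite -/(m x) -/(K x) -subr_gt0 Kx ltxx.
rewrite pP// qP//; apply: ae_eq_integral => //.
- by apply/measurable_funTS/measurable_EFinP.
- by apply/measurable_funTS/measurable_EFinP.
- have [N [mN N0 sub]] := pq; exists N; split => // x h; apply: sub => /= pqx.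
  by apply: h => _ /=; rewrite pqx.
Qed.

End main.

Theorem theoremA (R : realType) (V : R -> R) (Rad : R) :
  orlicz_fun V -> 0 < Rad ->
  exists alpha : R,
    [/\ alpha < 0,
        LDP (@weakD R) (@weakh R) (emp_law V Rad) (rate_IV V Rad alpha),
        (forall beta : R, beta < 0 ->
           LDP (@weakD R) (@weakh R) (emp_law V Rad) (rate_IV V Rad beta) ->
           beta = alpha),
        strictly_convex_rate (rate_IV V Rad alpha) &
        (forall W : R -> R, orlicz_fun W ->
           (forall M : R, exists r : R, forall x : R,
              r < `|x| -> M < V x / W x) ->
           LDP (WD W) (Wh W) (emp_law V Rad) (rate_IV V Rad alpha))].
Proof.
move=> oV R0; have [a a0 crit] := exists_critical oV R0.
have [G GE] := gibbs_probability oV a0.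
exists a; split => //.
- exact: (LDP_weak oV R0 a0 GE crit).
- by move=> b b0; exact: (critical_unique oV R0 a0 GE crit b0).
- exact: (rate_strictly_convex oV a0 GE).
- move=> W oW VW; apply: (LDP_weighted oV R0 a0 GE crit).
  + exact: orlicz_measurable.
  + exact: orlicz_ge0.
  (* For [|x| > r] the growth condition gives [W <= eta V]; for [|x| <= r] monotonicity bounds [W x]
     by [W r]. *)
  + move=> eta eta0; have [r hr] := VW eta^-1.
    exists (W r) => x; have Vx := orlicz_ge0 oV x; have [xr|xr] := leP `|x| r.
      apply: (@le_trans _ _ (W r)); last by rewrite lerDr mulr_ge0// ltW.
      by apply: orlicz_mono => //; exact: le_trans xr (ler_norm _).
    have Wx := orlicz_ge0 oW x; have Wr := orlicz_ge0 oW r.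
    have := hr x xr; have : 0 < eta^-1 by rewrite invr_gt0.
    move: Wx; rewrite le_eqVlt => /predU1P[<-|Wx] h1 h2.
      by rewrite addr_ge0// mulr_ge0// ltW.
    move: h2; rewrite ltr_pdivlMr// ltr_pdivrMl// => h2.
    by lra.
Qed.
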